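(* Let $n\ge 1$, $\alpha>n$, $\kappa>0$, $T>0$, and $\lambda\ge 0$ with $\alpha-n>\lambda$. Let $\varphi\in\mathfrak{M}_\lambda$ and let $f:\mathbb{Q}_p^n\times[0,T]\to\mathbb{C}$ be continuous in $(x,t)$ and belong to $\mathfrak{M}_\lambda$ uniformly with respect to $t$. Then the function $$u(x,t)=\int_{\mathbb{Q}_p^n}Z(x-y,t)\varphi(y)\,d^ny+\int_0^t\int_{\mathbb{Q}_p^n}Z(x-y,t-\theta)f(y,\theta)\,d^ny\,d\theta ,$$ (with $u(x,0)=\varphi(x)$) is a solution of the Cauchy problem $$\frac{\partial u}{\partial t}(x,t)-\kappa\,(\boldsymbol{W}_\alpha u)(x,t)=f(x,t),\quad x\in\mathbb{Q}_p^n,\ t\in(0,T];\qquad u(x,0)=\varphi(x).$$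
   Context: $p$ is a prime; on $\mathbb{Q}_p^n$, $\|x\|_p=\max_i|x_i|_p$ and $d^nx$ is the Haar measure giving $\mathbb{Z}_p^n$ volume $1$. $\Psi(y)=\exp(2\pi i\{y\}_p)$ for $y\in\mathbb{Q}_p$, where $\{y\}_p$ is the fractional part, and $x\cdot\xi=\sum_j x_j\xi_j$. $\widetilde{\mathcal{E}}$ is the space of functions $\varphi:\mathbb{Q}_p^n\to\mathbb{C}$ for which there is $l\in\mathbb{Z}$ with $\varphi(x+x')=\varphi(x)$ for all $x$ and all $\|x'\|_p\le p^l$ (the largest such $l$ is the parameter of local constancy). For $\lambda\ge0$, $\mathfrak{M}_\lambda$ is the space of $\varphi\in\widetilde{\mathcal{E}}$ with $|\varphi(x)|\le C(1+\|x\|_p^\lambda)$ for some constant $C$. A function depending also on $t$ belongs to $\mathfrak{M}_\lambda$ uniformly with respect to $t$ if $C$ and the parameter of local constancy $l$ can be chosen independent of $t$. $w_\alpha:\mathbb{Q}_p^n\to[0,\infty)$ is a fixed continuous radial function, $w_\alpha(y)=w_\alpha(\|y\|_p)$, vanishing only at $y=0$, with constants $C_0,C_1>0$ such that $C_0\|y\|_p^\alpha\le w_\alpha(\|y\|_p)\le C_1\|y\|_p^\alpha$ for all $y$. Put $$A_{w_\alpha}(\xi)=\int_{\mathbb{Q}_p^n}\frac{1-\Psi(-y\cdot\xi)}{w_\alpha(\|y\|_p)}\,d^ny$$ (a radial function, written $A_{w_\alpha}(\|\xi\|_p)$) and $$(\boldsymbol{W}_\alpha\varphi)(x)=\int_{\mathbb{Q}_p^n}\frac{\varphi(x-y)-\varphi(x)}{w_\alpha(\|y\|_p)}\,d^ny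 ,$$ acting in the variable $x$, with domain $\mathfrak{M}_\lambda$, $\alpha-n>\lambda$. For $t>0$, $$Z(x,t)=\int_{\mathbb{Q}_p^n}e^{-\kappa tA_{w_\alpha}(\|\xi\|_p)}\Psi(x\cdot\xi)\,d^n\xi .$$ A function $u:\mathbb{Q}_p^n\times[0,T]\to\mathbb{C}$ is a solution of the Cauchy problem if $u$ is continuous in $(x,t)$, $u(\cdot,t)\in\mathfrak{M}_\lambda$ for $t\in[0,T]$, $u(x,\cdot)$ is continuously differentiable for $t\in(0,T]$, $u\in\mathfrak{M}_\lambda$ uniformly in $t$, and $u$ satisfies the equation for all $t>0$ and the initial condition. *)

(* Defs.v *)
From HB Require Import structures.
From mathcomp Require Import all_boot all_order all_algebra.
From mathcomp Require Import ring_quotient generic_quotient complex ring lra.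
From mathcomp Require Import all_classical all_reals all_analysis.

Set Implicit Arguments.
Unset Strict Implicit.
Unset Printing Implicit Defensive.
Import Order.TTheory GRing.Theory Num.Theory.
Import numFieldNormedType.Exports.
Local Open Scope classical_set_scope.
Local Open Scope ring_scope.
Local Open Scope quotient_scope.

Section absq.
Variables (R : realType) (p : nat).

Definition absz_p (a : int) : R :=
  if a == 0 then 0 else p%:R ^- logn p `|a|%N.

(* |a / b|_p = p^-(ord_p a) / p^-(ord_p b) *)
Definition absq_p (x : rat) : R := absz_p (numq x) / absz_p (denq x).

Hypothesis pP : prime p.

Let p_gt0 : 0 < p%:R :> R. Proof. by rewrite ltr0n prime_gt0. Qed.

Lemma absz_p_gt0 a : a != 0 -> 0 < absz_p a.
Proof. by rewrite /absz_p => /negPf ->; rewrite invr_gt0 exprn_gt0. Qed.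

Lemma absz_pM : {morph absz_p : a b / a * b}.
Proof.
move=> a b; rewrite /absz_p mulf_eq0.
have [|a0] /= := eqVneq a 0; first by rewrite mul0r.
have [|b0] := eqVneq b 0; first by rewrite mulr0.
by rewrite abszM lognM ?absz_gt0// exprD invfM.
Qed.

Lemma absz_pD a b : absz_p (a + b) <= Num.max (absz_p a) (absz_p b).
Proof.
have [->|a0] := eqVneq a 0; first by rewrite add0r le_max lexx orbT.
have [->|b0] := eqVneq b 0; first by rewrite addr0 le_max lexx.
have [ab0|ab0] := eqVneq (a + b) 0.
  by rewrite ab0 {1}/absz_p eqxx le_max ltW// absz_p_gt0.
wlog le_ab : a b a0 b0 ab0 / (logn p `|a| <= logn p `|b|)%N.
  move=> H; have [/H|/ltnW /H] := leqP (logn p `|a|) (logn p `|b|); first exact.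
  by rewrite addrC maxC; apply; rewrite // addrC.
rewrite le_max /absz_p (negPf a0) (negPf ab0) lef_pV2 ?posrE ?exprn_gt0//.
rewrite ler_eXn2l ?ltr1n ?prime_gt1// -pfactor_dvdn ?absz_gt0//.
have pa : (Posz (p ^ logn p `|a|)%N %| a)%Z by rewrite dvdzE /= pfactor_dvdnn.
have pb : (Posz (p ^ logn p `|a|)%N %| b)%Z.
  by rewrite dvdzE /= pfactor_dvdn ?absz_gt0.
by have := rpredD pa pb; rewrite dvdzE /= => ->.
Qed.

Lemma absq_p_frac (a b : int) : b != 0 ->
  absq_p (a%:Q / b%:Q) = absz_p a / absz_p b.
Proof.
move=> b0; pose x : rat := a%:Q / b%:Q; rewrite /absq_p -/x.
have E : numq x * b = a * denq x.
  apply: (@intr_inj rat); rewrite !rmorphM /=.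
  have d0 : (denq x)%:Q != 0 by rewrite intr_eq0 denq_eq0.
  have b0' : b%:Q != 0 by rewrite intr_eq0.
  have -> : (numq x)%:Q = x * (denq x)%:Q.
    by rewrite -{2}(divq_num_den x) divfK.
  by rewrite mulrAC {1}/x divfK.
have db := absz_p_gt0 b0; have dd := absz_p_gt0 (denq_neq0 x).
by apply/eqP; rewrite eqr_div ?(gt_eqF db) ?(gt_eqF dd)// -!absz_pM E.
Qed.

Lemma absq_p0 : absq_p 0 = 0. Proof. by rewrite /absq_p /absz_p /= mul0r. Qed.

Lemma absq_p_ge0 x : 0 <= absq_p x.
Proof.
rewrite /absq_p divr_ge0//; first last.
  by rewrite ltW// absz_p_gt0// denq_neq0.
have [->|] := eqVneq (numq x) 0; first by rewrite /absz_p eqxx.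
by move=> /absz_p_gt0/ltW.
Qed.

Lemma absq_p_gt0 x : (0 < absq_p x) = (x != 0).
Proof.
have [->|x0] := eqVneq x 0; first by rewrite absq_p0 ltxx.
by rewrite divr_gt0// absz_p_gt0// ?denq_neq0// numq_eq0.
Qed.

Lemma absq_pM : {morph absq_p : x y / x * y}.
Proof.
move=> x y; rewrite -[in LHS](divq_num_den x) -[in LHS](divq_num_den y).
rewrite mulf_div -!rmorphM /= absq_p_frac ?mulf_neq0 ?denq_neq0//.
by rewrite !absz_pM /absq_p mulf_div.
Qed.

Lemma absq_pD x y : absq_p (x + y) <= Num.max (absq_p x) (absq_p y).
Proof.
have d0 z : (denq z)%:Q != 0 by rewrite intr_eq0 denq_neq0.
have dz z : 0 < absz_p (denq z) by rewrite absz_p_gt0// denq_neq0.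
rewrite -[x in X in X <= _](divq_num_den x) -[y in X in X <= _](divq_num_den y).
rewrite addf_div// -!intrM -intrD absq_p_frac ?mulf_neq0 ?denq_neq0//.
have dxy : 0 < absz_p (denq x * denq y) by rewrite absz_pM mulr_gt0.
have nd z : absz_p (denq z) != 0 by rewrite gt_eqF.
rewrite ler_pdivrMr// (le_trans (absz_pD _ _))// maxr_pMl ?(ltW dxy)//.
rewrite !absz_pM /absq_p mulrA divfK ?nd//.
by rewrite [X in _ / _ * X]mulrC mulrA divfK ?nd.
Qed.

Lemma absq_pN x : absq_p (- x) = absq_p x.
Proof.
have H z : absq_p (- z) <= absq_p z.
  rewrite -mulN1r absq_pM /absq_p /absz_p /= !logn1 !expr0 !invr1.
  by rewrite !mul1r.
by apply/eqP; rewrite eq_le H /= -{1}(opprK x) H.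
Qed.

Lemma absq_pB x y : absq_p (x - y) = absq_p (y - x).
Proof. by rewrite -absq_pN opprB. Qed.

Lemma absq_p1 : absq_p 1 = 1.
Proof. by rewrite /absq_p /absz_p /= logn1 expr0 !invr1 mul1r. Qed.

Lemma absq_pV x : absq_p x^-1 = (absq_p x)^-1.
Proof.
have [->|x0] := eqVneq x 0; first by rewrite invr0 absq_p0 invr0.
have := absq_p_gt0 x; rewrite x0 => /gt_eqF/negbT ax0.
by apply: (mulfI ax0); rewrite -absq_pM !divff// absq_p1.
Qed.

Lemma absq_p_isosceles x y : absq_p (x - y) < absq_p y -> absq_p x = absq_p y.
Proof.
move=> xy; apply/eqP; rewrite eq_le; apply/andP; split.
  rewrite -{1}(subrK y x) (le_trans (absq_pD _ _))// ge_max lexx andbT.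
  exact: ltW.
have := absq_pD (y - x) x; rewrite subrK le_max absq_pB => /orP[|//].
by rewrite leNgt xy.
Qed.

End absq.

Section cauchy.
Variables (R : realType) (p : nat) (pP : prime p).
Local Notation absq := (@absq_p R p).

Definition cauchy_p (_ : prime p) : {pred nat -> rat} := [pred u : nat -> rat |
  `[< forall e : R, 0 < e -> exists N, forall i j,
      (N <= i)%N -> (N <= j)%N -> absq (u i - u j) < e >] ].

Lemma cauchy_pP u : reflect (forall e : R, 0 < e -> exists N, forall i j,
      (N <= i)%N -> (N <= j)%N -> absq (u i - u j) < e) (u \in cauchy_p pP).
Proof. exact: asboolP. Qed.

Lemma cauchy_p_const q : (fun=> q) \in cauchy_p pP.
Proof. by apply/cauchy_pP => e e0; exists 0%N => *; rewrite subrr absq_p0. Qed.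

Lemma cauchy_p_bounded u : u \in cauchy_p pP ->
  exists2 C : R, 0 < C & forall i, absq (u i) <= C.
Proof.
move=> /cauchy_pP /(_ 1 ltr01)[N HN].
exists (1 + \sum_(k < N.+1) absq (u k)).
  by rewrite ltr_wpDr// sumr_ge0// => i _; rewrite absq_p_ge0.
move=> i; have [Ni|iN] := leqP N i; last first.
  rewrite (bigD1 (Ordinal (leq_trans iN (leqnSn N))))//= addrCA lerDl.
  by rewrite addr_ge0// sumr_ge0// => k _; rewrite absq_p_ge0.
rewrite -(subrK (u N) (u i)) (le_trans (absq_pD _ pP _ _))// ge_max.
rewrite (le_trans (ltW (HN _ _ Ni (leqnn N))))/=; last first.
  by rewrite lerDl sumr_ge0// => k _; rewrite absq_p_ge0.
rewrite (bigD1 ord_max)//= addrCA lerDl.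
by rewrite addr_ge0// sumr_ge0// => k _; rewrite absq_p_ge0.
Qed.

Lemma cauchy_p_subring : GRing.subring_closed (cauchy_p pP).
Proof.
split; first exact: (cauchy_p_const 1).
- move=> u v /cauchy_pP hu /cauchy_pP hv; apply/cauchy_pP => e e0.
  have [N HN] := hu _ e0; have [M HM] := hv _ e0.
  exists (maxn N M) => i j; rewrite !geq_max => /andP[Ni Mi] /andP[Nj Mj].
  rewrite (_ : _ - _ = (u i - u j) + (v j - v i)); last first.
    by rewrite !fctE; ring.
  rewrite (le_lt_trans (absq_pD _ pP _ _))// gt_max HN//=.
  exact: HM.
- move=> u v Hu Hv; apply/cauchy_pP => e e0.
  have [C C0 HC] := cauchy_p_bounded Hu; have [D D0 HD] := cauchy_p_bounded Hv.
  have [N HN] := cauchy_pP _ Hu _ (divr_gt0 e0 D0).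
  have [M HM] := cauchy_pP _ Hv _ (divr_gt0 e0 C0).
  exists (maxn N M) => i j; rewrite !geq_max => /andP[Ni Mi] /andP[Nj Mj].
  rewrite (_ : _ - _ = (u i - u j) * v i + u j * (v i - v j)); last first.
    by rewrite !fctE; ring.
  rewrite (le_lt_trans (absq_pD _ pP _ _))// gt_max !absq_pM//.
  apply/andP; split.
    rewrite (le_lt_trans (ler_wpM2l (absq_p_ge0 _ pP _) (HD i)))//.
    by rewrite -ltr_pdivlMr// HN.
  rewrite (le_lt_trans (ler_wpM2r (absq_p_ge0 _ pP _) (HC j)))//.
  by rewrite mulrC -ltr_pdivlMr// HM.
Qed.

HB.instance Definition _ :=
  GRing.isSubringClosed.Build (nat -> rat) (cauchy_p pP) cauchy_p_subring.

Record cseq := CSeq { cseq_val :> nat -> rat; _ : cseq_val \in cauchy_p pP }.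
HB.instance Definition _ := [isSub for cseq_val].
HB.instance Definition _ := [Choice of cseq by <:].
HB.instance Definition _ := [SubChoice_isSubComNzRing of cseq by <:].

Lemma cseqP (u : cseq) : (u : nat -> rat) \in cauchy_p pP. Proof. by case: u. Qed.

Definition null_p : {pred cseq} := [pred u : cseq |
  `[< forall e : R, 0 < e -> exists N, forall i, (N <= i)%N -> absq (u i) < e >] ].

Lemma null_pP (u : cseq) : reflect (forall e : R, 0 < e ->
  exists N, forall i, (N <= i)%N -> absq (u i) < e) (u \in null_p).
Proof. exact: asboolP. Qed.

Lemma null_p_ideal : idealr_closed null_p.
Proof.
split.
- by apply/null_pP => e e0; exists 0%N => i _; rewrite absq_p0.
- apply/negP => /null_pP /(_ _ ltr01)[N /(_ N (leqnn N))].
  by rewrite /= absq_p1 ltxx.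
- move=> a u v /null_pP Hu /null_pP Hv; apply/null_pP => e e0.
  have [C C0 HC] := cauchy_p_bounded (cseqP a).
  have [N HN] := Hu _ (divr_gt0 e0 C0); have [M HM] := Hv _ e0.
  exists (maxn N M) => i; rewrite !geq_max => /andP[Ni Mi].
  rewrite (le_lt_trans (absq_pD _ pP _ _))// gt_max HM// andbT absq_pM//.
  rewrite (le_lt_trans (ler_wpM2r (absq_p_ge0 _ pP _) (HC i)))//.
  by rewrite mulrC -ltr_pdivlMr// HN.
Qed.

HB.instance Definition _ := isIdealr.Build cseq null_p null_p_ideal.

Lemma cseq_stationary (u : cseq) : u \notin null_p -> exists N,
  0 < absq (u N) /\ forall i, (N <= i)%N -> absq (u i) = absq (u N).
Proof.
move=> /null_pP/existsNP[e /not_implyP[e0 /forallNP He]].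
have [N HN] := cauchy_pP _ (cseqP u) _ e0.
have /existsNP[k /not_implyP[Nk /negP]] := He N; rewrite -leNgt => ek.
exists k; split; first exact: lt_le_trans ek.
move=> i ki; apply: absq_p_isosceles => //.
by rewrite (lt_le_trans _ ek)// HN// (leq_trans Nk).
Qed.

(* Q_p as the completion of Q: Cauchy sequences of rationals for |.|_p modulo
   null sequences. *)
Definition padic := {ideal_quot null_p}.
HB.instance Definition _ := GRing.ComNzRing.on padic.

Local Notation pi := (\pi_padic).

Lemma padic_eq (u v : cseq) : (pi u == pi v :> padic) = (u - v \in null_p).
Proof. by rewrite -Quotient.idealrBE. Qed.

Lemma padic_eq0 (u : cseq) : (pi u == 0 :> padic) = (u \in null_p).
Proof.
rewrite -[u in RHS]subr0 -padic_eq; congr (_ == _).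
by rewrite rmorph0.
Qed.

Lemma padic_mulVr_ex (x : padic) : x != 0 -> exists y, y * x = 1.
Proof.
rewrite -[x]reprK padic_eq0; set u := repr x => /cseq_stationary[N [c0 HN]].
set c := absq (u N) in c0 HN.
have Hv : (fun i => (u i)^-1) \in cauchy_p pP.
  apply/cauchy_pP => e e0.
  have [M HM] := cauchy_pP _ (cseqP u) _ (mulr_gt0 e0 (mulr_gt0 c0 c0)).
  exists (maxn N M) => i j; rewrite !geq_max => /andP[Ni Mi] /andP[Nj Mj].
  have u0 k : (N <= k)%N -> u k != 0.
    by move=> Nk; rewrite -(absq_p_gt0 R pP) HN.
  have -> : (u i)^-1 - (u j)^-1 = (u j - u i) / (u i * u j).
    by field; rewrite !u0.
  rewrite absq_pM// absq_pV// absq_pM// !HN// ltr_pdivrMr ?(mulr_gt0 c0 c0)//.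
  exact: HM.
exists (pi (CSeq Hv)); rewrite -rmorphM/=.
apply/eqP; rewrite -(rmorph1 pi) padic_eq; apply/null_pP => e e0; exists N => i Ni.
rewrite /= [X in absq X](_ : _ = (u i)^-1 * u i - 1)// mulVf ?subrr ?absq_p0//.
by rewrite -(absq_p_gt0 R pP) HN.
Qed.

Definition padic_inv (x : padic) : padic := xget 0 [set y | y * x = 1].

Lemma padic_mulVr (x : padic) : x != 0 -> padic_inv x * x = 1.
Proof.
move=> /padic_mulVr_ex[y xy]; rewrite /padic_inv.
by case: xgetP => [z ->//|/(_ y)].
Qed.

Lemma padic_inv0 : padic_inv 0 = 0.
Proof.
rewrite /padic_inv; case: xgetP => [z _|//].
by move=> /eqP; rewrite mulr0 eq_sym oner_eq0.
Qed.

HB.instance Definition _ :=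
  GRing.ComNzRing_isField.Build padic padic_mulVr padic_inv0.

(* The absolute value of Q_p extends the one of Q by continuity. *)
Definition padic_abs (x : padic) : R := limn (fun i => absq (repr x i)).

Lemma padic_abs_pi_cvg (u : cseq) : absq (u i) @[i --> \oo] --> padic_abs (pi u).
Proof.
have cv (v : cseq) : if v \in null_p then absq (v i) @[i --> \oo] --> (0 : R)
    else exists N, 0 < absq (v N) /\ absq (v i) @[i --> \oo] --> absq (v N).
  case: ifPn => [/null_pP v0|/cseq_stationary[N [v0 HN]]].
    apply/cvgrPdist_lt => e /v0[N HN]; exists N => // i /= Ni.
    by rewrite sub0r normrN ger0_norm ?absq_p_ge0// HN.
  exists N; split=> //; apply: cvg_near_cst.
  by exists N => // i /= Ni; rewrite HN.
set v : cseq := repr (pi u : padic).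
have uv : u - v \in null_p by rewrite -padic_eq reprK.
suff H : absq (u i) - absq (v i) @[i --> \oo] --> (0 : R).
  have cvv : cvgn (fun i => absq (v i)).
    have := cv v; case: ifPn => _; first by move=> h; exact: cvgP h.
    by move=> [N [_ h]]; exact: cvgP h.
  have -> : (fun i => absq (u i)) =
      (fun i => (absq (u i) - absq (v i)) + absq (v i)).
    by apply/funext => i; rewrite subrK.
  by rewrite /padic_abs -/v -[limn _]add0r; exact: cvgD.
apply/cvgrPdist_lt => e e0; have [N HN] := null_pP _ uv _ e0.
exists N => // i /= Ni; have {HN} := HN _ Ni => /= uvi.
rewrite sub0r normrN.
have [a b] : absq (u i) <= Num.max (absq (u i - v i)) (absq (v i)) /\
   absq (v i) <= Num.max (absq (u i - v i)) (absq (u i)).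
  split; first by rewrite -{1}(subrK (v i) (u i)) absq_pD.
  by rewrite -{1}(subrK (u i) (v i)) absq_pB// absq_pD.
have := absq_p_ge0 R pP (u i); have := absq_p_ge0 R pP (v i).
move: uvi a b; rewrite !le_max ltr_norml.
move=> uvi /orP[a|a] /orP[b|b] u0 v0; apply/andP; split; lra.
Qed.

End cauchy.

Section padic_abs_theory.
Variables (R : realType) (p : nat) (pP : prime p).
Local Notation absq := (@absq_p R p).
Local Notation Qp := (padic R pP).
Local Notation pi := (\pi_Qp).
Implicit Types x y : Qp.

Lemma padic_abs_pi (u : cseq R pP) : padic_abs (pi u) = limn (fun i => absq (u i)).
Proof. by apply/esym/cvg_lim => //; exact: padic_abs_pi_cvg. Qed.

Lemma padic_abs_ge0 x : 0 <= padic_abs x.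
Proof.
rewrite -[x]reprK padic_abs_pi; apply: limr_ge.
  exact: cvgP (@padic_abs_pi_cvg R p pP (repr x)).
by apply: nearW => i; rewrite absq_p_ge0.
Qed.

Lemma padic_absM : {morph @padic_abs R p pP : x y / x * y}.
Proof.
move=> x y; rewrite -[x]reprK -[y]reprK -rmorphM/= padic_abs_pi.
apply/cvg_lim => //.
rewrite (_ : (fun i => _) = (fun i => absq (repr x i) * absq (repr y i))).
  by apply: cvgM; exact: padic_abs_pi_cvg.
by apply/funext => i; rewrite -absq_pM.
Qed.

Lemma padic_absN x : padic_abs (- x) = padic_abs x.
Proof.
rewrite -[x]reprK -rmorphN/= !padic_abs_pi; congr (lim (_ @ \oo)).
by apply/funext => i; rewrite -[RHS]absq_pN.
Qed.

Lemma padic_absB x y : padic_abs (x - y) = padic_abs (y - x).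
Proof. by rewrite -padic_absN opprB. Qed.

Lemma padic_absD x y :
  padic_abs (x + y) <= Num.max (padic_abs x) (padic_abs y).
Proof.
rewrite -[x]reprK -[y]reprK -rmorphD/=.
set u := repr x; set v := repr y.
have cu := @padic_abs_pi_cvg R p pP u; have cv := @padic_abs_pi_cvg R p pP v.
have cuv := @padic_abs_pi_cvg R p pP (u + v).
rewrite leNgt; apply/negP; set M := Num.max _ _ => Mlt.
pose e := (padic_abs (pi (u + v)) - M) / 2.
have e0 : 0 < e by rewrite divr_gt0// subr_gt0.
have Me : M + e = padic_abs (pi (u + v)) - e by rewrite /e; field.
have lu : padic_abs (pi u) < M + e.
  by rewrite (@le_lt_trans _ _ M) ?ltrDl// le_max lexx.
have lv : padic_abs (pi v) < M + e.
  by rewrite (@le_lt_trans _ _ M) ?ltrDl// le_max lexx orbT.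
have luv : M + e < padic_abs (pi (u + v)) by rewrite Me ltrBlDr ltrDl.
have [i [[ui vi] uvi]] := @filter_ex _ \oo _ _ (filterI (filterI
  (cvgr_lt _ cu _ lu) (cvgr_lt _ cv _ lv)) (cvgr_gt _ cuv _ luv)).
have := le_lt_trans (absq_pD R pP (u i) (v i)) (_ : _ < M + e).
rewrite gt_max ui vi => /(_ isT); rewrite ltNge => /negP; apply.
exact: ltW.
Qed.

Lemma padic_abs_eq0 x : (padic_abs x == 0) = (x == 0).
Proof.
apply/idP/idP => [|/eqP ->]; last first.
  rewrite -(rmorph0 pi) padic_abs_pi; apply/eqP/cvg_lim => //.
  rewrite (_ : (fun i => _) = cst 0); first exact: cvg_cst.
  by apply/funext => i; rewrite absq_p0.
rewrite -[x]reprK padic_eq0; set u := repr x => /eqP u0.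
apply: contraT => /cseq_stationary[N [uN0 HN]].
suff H : padic_abs (pi u) = absq (u N) by rewrite -H u0 ltxx in uN0.
rewrite padic_abs_pi; apply/cvg_lim => //.
by apply: cvg_near_cst; exists N => // i /= Ni; rewrite HN.
Qed.

Lemma padic_abs0 : padic_abs (0 : Qp) = 0.
Proof. by apply/eqP; rewrite padic_abs_eq0. Qed.

Lemma padic_pi_ratr (q : rat) : pi (CSeq (cauchy_p_const R pP q)) = ratr q :> Qp.
Proof.
pose f (q : rat) : Qp := pi (CSeq (cauchy_p_const R pP q)).
have fB : zmod_morphism f.
  move=> a b; rewrite /f -rmorphB/=; congr (\pi_Qp _).
  by apply/val_inj.
have fM : monoid_morphism f.
  split=> [|a b]; first by rewrite -(rmorph1 pi); congr (\pi_Qp _); apply/val_inj.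
  by rewrite /f -rmorphM/=; congr (\pi_Qp _); apply/val_inj.
pose fA := GRing.isZmodMorphism.Build _ _ f fB.
pose fMM := GRing.isMonoidMorphism.Build _ _ f fM.
pose F : {rmorphism rat -> Qp} := HB.pack f fA fMM.
exact: (fmorph_eq_rat F).
Qed.

Lemma padic_abs_ratr (q : rat) : padic_abs (ratr q : Qp) = absq q.
Proof.
rewrite -padic_pi_ratr padic_abs_pi; apply/cvg_lim => //.
exact: (@cvg_cst _ (absq q) nat \oo).
Qed.

Lemma padic_dense x (e : R) : 0 < e -> exists q : rat, padic_abs (x - ratr q) < e.
Proof.
move=> e0; rewrite -[x]reprK; set u := repr x.
have [N HN] := cauchy_pP _ _ _ (cseqP u) _ (divr_gt0 e0 (ltr0Sn _ 1)).
exists (u N); rewrite -padic_pi_ratr -rmorphB/=.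
rewrite (@le_lt_trans _ _ (e / 2))//; last first.
  by rewrite ltr_pdivrMr// ltr_pMr// ltr1n.
rewrite padic_abs_pi; apply: limr_le; first exact: cvgP (@padic_abs_pi_cvg R p pP _).
by exists N => // i /= Ni; rewrite ltW// HN.
Qed.

Let padic_dist x y : R := padic_abs (x - y).

Let padic_distxx x : padic_dist x x = 0.
Proof. by rewrite /padic_dist subrr padic_abs0. Qed.

Let padic_dist_pos x y : padic_dist x y = 0 -> x = y.
Proof. by move/eqP; rewrite padic_abs_eq0 subr_eq0 => /eqP. Qed.

Let padic_dist_sym x y : padic_dist x y = padic_dist y x.
Proof. exact: padic_absB. Qed.

Let padic_dist_triangle y x z : padic_dist x z <= padic_dist x y + padic_dist y z.
Proof.
rewrite /padic_dist -(subrK y x) -addrA (le_trans (padic_absD _ _))//.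
by rewrite subrK ge_max lerDl lerDr !padic_abs_ge0.
Qed.

HB.instance Definition _ := isPointed.Build Qp 0.
HB.instance Definition _ := isMetric.Build R Qp padic_distxx padic_dist_pos
  padic_dist_sym padic_dist_triangle.

Lemma padic_ballE x (e : R) : ball x e = [set y | padic_abs (x - y) < e].
Proof. by rewrite ballEmdist. Qed.

End padic_abs_theory.

Section frac.
Variables (R : realType) (p : nat) (pP : prime p).
Local Notation Qp := (padic R pP).

(* y = sum_(j >= -k) y_j p^j has fractional part sum_(-k <= j < 0) y_j p^j: this
   is a / p^k with 0 <= a < p^k, and the remaining part of y lies in Z_p.
   Existence and uniqueness are proved below. *)
Definition is_padic_frac (y : Qp) (r : rat) :=
  (exists k a : nat, (a < p ^ k)%N /\ r = a%:R / p%:R ^+ k)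
  /\ padic_abs (y - ratr r) <= 1.

Definition padic_frac (y : Qp) : rat := xget 0 (is_padic_frac y).

Lemma padic_ratrB (a b : rat) : ratr (a - b) = ratr a - ratr b :> Qp.
Proof.
rewrite -!padic_pi_ratr -rmorphB/=; congr (\pi_Qp _).
by apply/val_inj.
Qed.

Lemma padic_frac_exists (y : Qp) : exists r, is_padic_frac y r.
Proof.
have [q yq] := padic_dense y (ltr01 : 0 < 1 :> R).
have p0 : (p%:R : rat) != 0 by rewrite pnatr_eq0 -lt0n prime_gt0.
pose d := `|denq q|%N; have d0 : (0 < d)%N by rewrite absz_gt0 denq_neq0.
have [[|m] pm dE] := pfactor_coprime pP d0.
  by rewrite dE mul0n in d0.
set k := logn p d in dE.
have cm : coprime m.+1 (p ^ k) by rewrite coprime_sym coprimeXl.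
have [u v uv _] := egcdnP (p ^ k) (ltn0Sn m).
rewrite (eqP cm) in uv.
have pk0 : Posz (p ^ k)%N != 0 by rewrite -lt0n expn_gt0 prime_gt0.
pose a := `|((numq q * u) %% Posz (p ^ k)%N)%Z|%N.
have aE : Posz a = ((numq q * u) %% Posz (p ^ k)%N)%Z.
  by rewrite gez0_abs// modz_ge0.
have alt : (a < p ^ k)%N by rewrite -ltz_nat aE ltz_pmod// ltz_nat expn_gt0 prime_gt0.
exists (a%:R / p%:R ^+ k); split; first by exists k, a.
rewrite -(subrK (ratr q) y) -addrA -padic_ratrB.
rewrite (le_trans (padic_absD _ _))// ge_max (ltW yq)/= padic_abs_ratr.
pose n := ((numq q * u) %/ Posz (p ^ k)%N)%Z.
have nE : numq q * u = n * Posz (p ^ k)%N + Posz a by rewrite aE -divz_eq.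
have dqE : denq q = Posz (m.+1 * p ^ k)%N by rewrite -dE gez0_abs// denq_ge0.
have E : numq q - Posz a * m.+1 = Posz (p ^ k)%N * (n * m.+1 - numq q * v).
  have uvZ : (Posz u * m.+1 = Posz v * Posz (p ^ k)%N + 1) by rewrite -!PoszM -PoszD uv.
  have -> : Posz a = numq q * u - n * Posz (p ^ k)%N by rewrite nE addrC addKr.
  rewrite mulrBl -mulrA uvZ; ring.
have -> : q - a%:R / p%:R ^+ k = (n * m.+1 - numq q * v)%:Q / (Posz m.+1)%:Q.
  have pE : (p%:R ^+ k : rat) = (Posz (p ^ k)%N)%:Q by rewrite -natrX.
  have pz : (Posz (p ^ k)%N)%:Q != 0 by rewrite intr_eq0.
  have mz : (Posz m.+1)%:Q != 0 by rewrite intr_eq0.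
  have qE : q = (numq q)%:Q / ((Posz m.+1)%:Q * (Posz (p ^ k)%N)%:Q).
    by rewrite -{1}(divq_num_den q) dqE PoszM intrM.
  have EX := congr1 (fun z : int => z%:Q) E; move: EX.
  rewrite pE {3}qE !(intrM, intrB); move: (numq q) pz mz => N.
  set P := (Posz (p ^ k)%N)%:Q; set M := (Posz m.+1)%:Q.
  set X := _ - N%:~R * _ => pz mz EX.
  have -> : X = (N%:Q - a%:Q * M) / P by rewrite EX [P * _]mulrC mulfK.
  by field; rewrite nat1r; apply/andP.
rewrite absq_p_frac// [absz_p _ _ (Posz m.+1)]/absz_p /= lognE pP /=.
rewrite (_ : (p %| m.+1)%N = false); last first.
  by apply/negbTE; rewrite -prime_coprime.
rewrite expr0 invr1 divr1 /absz_p; case: ifP => // _.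
by rewrite invf_le1 ?exprn_gt0 ?ltr0n ?prime_gt0// exprn_ege1// ler1n prime_gt0.
Qed.

Lemma padic_frac_unique (y : Qp) r s :
  is_padic_frac y r -> is_padic_frac y s -> r = s.
Proof.
move=> [[k [a [ak rE]]] yr] [[l [b [bl sE]]] ys].
have : absq_p R p (r - s) <= 1.
  rewrite -(padic_abs_ratr R pP) padic_ratrB.
  rewrite -(subrK y (ratr r)) -addrA (le_trans (padic_absD _ _))// ge_max.
  by rewrite padic_absB yr ys.
have p0 : (p%:R : rat) != 0 by rewrite pnatr_eq0 -lt0n prime_gt0.
pose c : int := Posz (a * p ^ l)%N - Posz (b * p ^ k)%N.
have rsE : r - s = c%:Q / (Posz (p ^ (k + l))%N)%:Q.
  rewrite rE sE /c intrB -!pmulrn !natrM !natrX exprD.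
  by field; rewrite !expf_neq0.
have pkl0 : Posz (p ^ (k + l))%N != 0 by rewrite eqz_nat -lt0n expn_gt0 prime_gt0.
rewrite rsE absq_p_frac// ler_pdivrMr ?absz_p_gt0// mul1r.
have [c0|c0] := eqVneq c 0.
  by move=> _; apply/eqP; rewrite -subr_eq0 rsE c0 mul0r.
rewrite /absz_p (negPf c0) (negPf pkl0) /= pfactorK//.
rewrite lef_pV2 ?posrE ?exprn_gt0 ?ltr0n ?prime_gt0//.
rewrite ler_eXn2l ?ltr1n ?prime_gt1// -pfactor_dvdn ?absz_gt0//.
move=> /dvdn_leq; rewrite absz_gt0 c0 => /(_ isT); rewrite leqNgt => /negP[].
have A : (a * p ^ l < p ^ (k + l))%N.
  by rewrite expnD ltn_pmul2r// expn_gt0 prime_gt0.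
have B : (b * p ^ k < p ^ (k + l))%N.
  by rewrite addnC expnD ltn_pmul2r// expn_gt0 prime_gt0.
rewrite /c; have [le|/ltnW le] := leqP (b * p ^ k) (a * p ^ l).
  by rewrite distnEl// (leq_ltn_trans (leq_subr _ _)).
by rewrite distnEr// (leq_ltn_trans (leq_subr _ _)).
Qed.

End frac.

Section complex_valued.
Variable R : realType.
Local Notation C := R[i].

Definition cexp (z : C) : C :=
  (expR (complex.Re z))%:C%C * (cos (complex.Im z) +i* sin (complex.Im z))%C.

(* Absolute convergence, componentwise. *)
Definition cintegrable d (T : measurableType d)
    (mu : {measure set T -> \bar R}) (D : set T) (f : T -> C) : Prop :=
  mu.-integrable D (fun x => (complex.Re (f x))%:E) /\
  mu.-integrable D (fun x => (complex.Im (f x))%:E).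

Definition cintegral d (T : measurableType d)
    (mu : {measure set T -> \bar R}) (D : set T) (f : T -> C) : C :=
  (\int[mu]_(x in D) complex.Re (f x) +i*
   \int[mu]_(x in D) complex.Im (f x))%C.

(* One-sided at the endpoints of D. *)
Definition has_derivative_within (D : set R) (g : R -> C) (t : R) (l : C) : Prop :=
  (fun s => (s - t)^-1%:C%C * (g s - g t) : C^o) @ within D t^' --> (l : C^o).

End complex_valued.

Section padic_space.
Variables (R : realType) (p : nat) (pP : prime p) (n : nat).
Local Notation C := R[i].
Local Notation V := 'rV[padic R pP]_n.

Definition padicn_norm (x : V) : R := \big[Num.max/0]_(i < n) padic_abs (x 0 i).

Definition padicn_dot (x xi : V) : padic R pP := \sum_(j < n) x 0 j * xi 0 j.

Definition padic_char (y : padic R pP) : C :=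
  cexp (0 +i* (2 * pi * ratr (padic_frac y)))%C.

Definition padicn_borel := g_sigma_algebraType (@open V).

(* Haar measure on Q_p^n normalized on Z_p^n, which determines it uniquely. *)
Definition is_haar (mu : {measure set padicn_borel -> \bar R}) : Prop :=
  (forall (a : V) (A : set padicn_borel), measurable A ->
    mu [set a + x | x in (A : set V)] = mu A) /\
  mu [set x : V | padicn_norm x <= 1] = 1%E.

Definition loc_const (l : int) (phi : V -> C) : Prop :=
  forall x x' : V, padicn_norm x' <= p%:R ^ l -> phi (x + x') = phi x.

(* [powR 0 0 = 1], so for lambda = 0 the bound is 2 c everywhere. *)
Definition growth_le (lambda c : R) (phi : V -> C) : Prop :=
  forall x : V, `|phi x| <= (c * (1 + padicn_norm x `^ lambda))%:C%C.

Definition M_space (lambda : R) (phi : V -> C) : Prop :=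
  (exists l, loc_const l phi) /\ (exists c, growth_le lambda c phi).

Definition M_space_unif (lambda : R) (D : set R) (u : V -> R -> C) : Prop :=
  exists l c, forall t, D t -> loc_const l (u ^~ t) /\ growth_le lambda c (u ^~ t).

Definition is_weight (alpha : R) (w : V -> R) : Prop :=
  [/\ continuous w,
      forall x y, padicn_norm x = padicn_norm y -> w x = w y,
      forall y, 0 <= w y,
      forall y, w y = 0 <-> y = 0 &
      exists C0 C1, [/\ 0 < C0, 0 < C1 & forall y,
        C0 * padicn_norm y `^ alpha <= w y <= C1 * padicn_norm y `^ alpha]].

Variables (mu : {measure set padicn_borel -> \bar R}) (w : V -> R).

(* At y = 0 the integrands of [W_symbol] and [W_op] are 0 / 0 = 0. *)
Definition W_symbol (xi : V) : C :=
  cintegral mu setT (fun y : V =>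
    (1 - padic_char (- padicn_dot y xi)) / (w y)%:C%C).

Definition W_integrand (phi : V -> C) (x y : V) : C :=
  (phi (x - y) - phi x) / (w y)%:C%C.

Definition W_op (phi : V -> C) (x : V) : C :=
  cintegral mu setT (W_integrand phi x).

Variable kappa : R.

Definition heat_kernel (x : V) (t : R) : C :=
  cintegral mu setT (fun xi : V =>
    cexp (- (kappa * t)%:C%C * W_symbol xi) * padic_char (padicn_dot x xi)).

Definition heat_conv (t : R) (g : V -> C) (x : V) : C :=
  cintegral mu setT (fun y : V => heat_kernel (x - y) t * g y).

(* The inner integral at theta = t involves the kernel at time 0, which is not
   meaningful; this is a single value of theta. *)
Definition heat_u (phi : V -> C) (f : V -> R -> C) (x : V) (t : R) : C :=
  if t == 0 then phi x
  else heat_conv t phi x +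
       cintegral lebesgue_measure `[0, t]
         (fun theta : R => heat_conv (t - theta) (f ^~ theta) x).

Definition heat_u_defined (phi : V -> C) (f : V -> R -> C) (x : V) (t : R) : Prop :=
  [/\ cintegrable mu setT (fun y : V => heat_kernel (x - y) t * phi y),
      forall theta, 0 <= theta < t ->
        cintegrable mu setT (fun y : V => heat_kernel (x - y) (t - theta) * f y theta)
    & cintegrable lebesgue_measure `[0, t]
        (fun theta : R => heat_conv (t - theta) (f ^~ theta) x)].

Definition continuous_xt (T : R) (u : V -> R -> C) : Prop :=
  {within [set: V] `*` `[0, T], continuous (fun z : V * R => u z.1 z.2 : C^o)}.

Definition is_solution (lambda T : R) (phi : V -> C) (f u : V -> R -> C) : Prop :=
  [/\ continuous_xt T u,
      forall t, 0 <= t <= T -> M_space lambda (u ^~ t),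
      M_space_unif lambda `[0, T] u,
      exists du : V -> R -> C,
        (forall x, {within `]0, T], continuous (du x : R -> C^o)}) /\
        (forall x t, 0 < t <= T ->
          [/\ has_derivative_within `]0, T] (u x) t (du x t),
              cintegrable mu setT (W_integrand (u ^~ t) x)
            & du x t - kappa%:C%C * W_op (u ^~ t) x = f x t])
    & forall x, u x 0 = phi x].

End padic_space.

(* Main.v *)
Require Import Defs.
From HB Require Import structures.
From mathcomp Require Import all_boot all_order all_algebra.
From mathcomp Require Import complex ring lra.
From mathcomp Require Import all_classical all_reals all_analysis measurable_realfun.
Import Order.TTheory GRing.Theory Num.Theory.
Import numFieldNormedType.Exports.
Local Open Scope classical_set_scope.
Local Open Scope ring_scope.

Set Implicit Arguments.
Unset Strict Implicit.
Unset Printing Implicit Defensive.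

(** The operator W acts on locally constant functions one frequency at a time.
    Let g be constant on the balls of radius p ^ l, and let avg l i g (x) be the
    mean value of g over the ball of radius p ^ (l + i) around x. This is a finite
    average, since the ball is a disjoint union of p ^ (n i) balls of radius p ^ l.
    The averages are nested projections, so that their consecutive differences
    avgdiff l i are orthogonal projections [avgdiff_avgdiff]; the i-th one keeps
    the frequencies of absolute value p ^ - (l + i), where the radial symbol has
    a constant value a_i. Decomposing the integrals into spheres and balls, one
    finds
      W g = - sum_i a_i avgdiff l i g                        [operator_integral],
      Z(., t) * g = g + sum_i (exp (- kappa t a_i) - 1) avgdiff l i g
                                                               [kernel_conv].
    The first formula is a summation by parts over the spheres around x. For the
    second one, exp (- kappa t A) is a combination of indicator functions of balls
    around 0 in the frequency space, so that Z is a superposition of normalized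
    indicator functions of the dual balls [kernel_fourier], and the convolution
    with such a function is an average. Both need no Fourier transform of g, which
    would not exist for growing g.

    All the series are dominated by geometric series. Put s = p ^ (n - alpha) and
    r = p ^ lambda. The bounds of the weight give c s ^ i <= a_i <= C s ^ i, the
    growth condition gives |avgdiff l i g (x)| <= K(x) r ^ i, and the assumption
    lambda < alpha - n says that r s < 1 [growth_ratio].

    The Cauchy problem becomes a sequence of linear equations, as the i-th
    component y_i = avgdiff l i u of a solution u satisfies
    y_i' = - kappa a_i y_i + avgdiff l i f [relax]. With the solutions y_i of these
    equations, the function
      u = phi + int_0^t (f - sum_i kappa a_i y_i)
    is differentiable in t by construction, since the sum is continuous in t as a
    uniform limit [sol_is_derive]. It remains to see that avgdiff l i u = y_i, so
    that the sum is - kappa W u [sol_operator], and that u is the function given by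
    the kernel [sol_duhamel]. Both follow by integrating the series termwise.
    As the symbol and the kernel are real, real and imaginary parts are treated
    separately up to this point, and are put together at the end. *)

(** * Integrable functions with a prescribed integral *)

Section has_integral.
Context d (T : measurableType d) (R : realType).
Variables (mu : {measure set T -> \bar R}) (D : set T).
Hypothesis mD : measurable D.
Implicit Types (g h : T -> R) (v : R).

Definition has_integral g v :=
  mu.-integrable D (EFin \o g) /\ (\int[mu]_(x in D) (g x)%:E)%E = v%:E.

Lemma has_integral_Rintegral g v : has_integral g v ->
  \int[mu]_(x in D) g x = v.
Proof. by case=> _ gv; rewrite /Rintegral gv. Qed.

Lemma integrable_has_integral g : mu.-integrable D (EFin \o g) ->
  has_integral g (\int[mu]_(x in D) g x).
Proof.
move=> ig; split=> //; rewrite /Rintegral fineK//.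
exact: (integrable_fin_num mD ig).
Qed.

Lemma eq_has_integral g h v : (forall x, D x -> g x = h x) ->
  has_integral g v -> has_integral h v.
Proof.
move=> gh [ig gv]; split.
  by apply: (eq_integrable mD _ _ _ ig) => x /set_mem Dx /=; rewrite gh.
by rewrite -gv; apply: eq_integral => x /set_mem Dx; rewrite gh.
Qed.

Lemma has_integral0 : has_integral (fun=> 0) 0.
Proof. by split; [exact: integrable0|rewrite integral0]. Qed.

Lemma has_integralD g h v w : has_integral g v -> has_integral h w ->
  has_integral (fun x => g x + h x) (v + w).
Proof.
move=> [ig gv] [ih hw]; split.
  by apply: eq_integrable (integrableD mD ig ih) => //.
under eq_integral do rewrite EFinD.
by rewrite integralD_EFin//= gv hw.
Qed.

Lemma has_integralZ (k : R) g v : has_integral g v ->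
  has_integral (fun x => k * g x) (k * v).
Proof.
move=> [ig gv]; split.
  by apply: eq_integrable (integrableZl mD k ig) => //.
under eq_integral do rewrite EFinM.
by rewrite integralZl// gv.
Qed.

Lemma has_integralB g h v w : has_integral g v -> has_integral h w ->
  has_integral (fun x => g x - h x) (v - w).
Proof.
move=> gv /(has_integralZ (-1)); rewrite mulN1r => hw.
apply: eq_has_integral (has_integralD gv hw) => x _.
by rewrite mulN1r.
Qed.

Lemma has_integral_sum (I : Type) (r : seq I) (F : I -> T -> R) (V : I -> R) :
  (forall i, has_integral (F i) (V i)) ->
  has_integral (fun x => \sum_(i <- r) F i x) (\sum_(i <- r) V i).
Proof.
move=> FV; elim: r => [|i r IH].
  by rewrite big_nil; apply: eq_has_integral has_integral0 => x; rewrite big_nil.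
rewrite big_cons; apply: eq_has_integral (has_integralD (FV i) IH) => x _.
by rewrite big_cons.
Qed.

Lemma has_integral_unique g v w : has_integral g v -> has_integral g w -> v = w.
Proof. by move=> /has_integral_Rintegral <- /has_integral_Rintegral. Qed.

Lemma has_integral_le g h v w : (forall x, D x -> g x <= h x) ->
  has_integral g v -> has_integral h w -> v <= w.
Proof.
move=> gh [ig gv] [ih hw]; rewrite -lee_fin -gv -hw.
by apply: le_integral => // x /set_mem Dx; rewrite lee_fin gh.
Qed.

Lemma dominated_has_integral g h w : measurable_fun D g ->
  (forall x, D x -> `|g x| <= h x) -> has_integral h w ->
  exists v, has_integral g v.
Proof.
move=> mg gh [ih hw]; exists (\int[mu]_(x in D) g x).
apply: integrable_has_integral; apply: (le_integrable mD _ _ ih) => /=.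
  exact/measurable_EFinP.
move=> x Dx; rewrite lee_fin (le_trans (gh _ Dx))//.
exact: ler_norm.
Qed.

(** Termwise integration of a pointwise convergent series: the series of the
    majorants has an integrable sum, which dominates all the partial sums. *)
Lemma has_integral_series (psi phi : nat -> T -> R) (v m : nat -> R) s S K :
  (forall i, has_integral (psi i) (v i)) ->
  (forall i, has_integral (phi i) (m i)) ->
  (forall i x, D x -> `|psi i x| <= phi i x) ->
  (forall N, \sum_(i < N) m i <= K) ->
  (forall x, D x -> \sum_(i < N) psi i x @[N --> \oo] --> s x) ->
  \sum_(i < N) v i @[N --> \oo] --> S ->
  has_integral s S.
Proof.
move=> psiv phim le_psi mK cs cS.
pose f_ N x : \bar R := (\sum_(i < N) psi i x)%:E.
pose G x : \bar R := (\sum_(i <oo) (phi i x)%:E)%E.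
have phi0 i x : D x -> 0 <= phi i x.
  by move=> Dx; apply: le_trans (le_psi i x Dx).
have phiE0 i x : D x -> (0 <= (phi i x)%:E)%E by move=> Dx; rewrite lee_fin phi0.
have mphi i : measurable_fun D (fun x => (phi i x)%:E).
  by have [/measurable_int] := phim i.
have mf_ N : measurable_fun D (f_ N).
  have [/measurable_int] := has_integral_sum (index_enum 'I_N) (fun i : 'I_N => psiv i).
  exact.
have cf x : D x -> f_ N x @[N --> \oo] --> (s x)%:E.
  by move=> Dx; apply/fine_cvgP; split; [exact: nearW|exact: cs].
have ms : measurable_fun D (EFin \o s).
  by apply: (emeasurable_fun_cvg _ _ mf_) => x Dx; exact: cf.
have mG : measurable_fun D G.
  apply: ge0_emeasurable_sum => [i x Dx _|i _]; first exact: phiE0.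
  exact: mphi.
have iG : mu.-integrable D G.
  apply/integrableP; split => //.
  rewrite (eq_integral G); last first.
    move=> x /set_mem Dx; rewrite gee0_abs//.
    by apply: nneseries_ge0 => i _ _; exact: phiE0.
  rewrite /G integral_nneseries//.
  apply: (@le_lt_trans _ _ K%:E); last by rewrite ltry.
  apply: lime_le.
    apply: is_cvg_nneseries => i _ _; apply: integral_ge0 => x; exact: phiE0.
  apply: nearW => N; rewrite big_mkord.
  under eq_bigr do rewrite (phim _).2.
  by rewrite sumEFin lee_fin.
have fG : {ae mu, forall x N, D x -> (`|f_ N x| <= G x)%E}.
  apply: aeW => x N Dx; rewrite /f_ abse_EFin.
  apply: (@le_trans _ _ (\sum_(i < N) (phi i x)%:E)%E).
    rewrite sumEFin lee_fin (le_trans (ler_norm_sum _ _ _))//.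
    by apply: ler_sum => i _; exact: le_psi.
  rewrite -(big_mkord predT (fun i => (phi i x)%:E)).
  by apply: nneseries_lim_ge => i _ _; exact: phiE0.
have cae : {ae mu, forall x, D x -> f_ ^~ x @ \oo --> (EFin \o s) x}.
  by apply: aeW.
have [i_s _ ci] := dominated_convergence mD mf_ ms cae iG fG.
split=> //; apply/esym.
have cE : (\sum_(i < N) v i)%:E @[N --> \oo] --> S%:E.
  by apply/fine_cvgP; split; [exact: nearW|exact: cS].
apply: (cvg_unique _ cE) => //.
apply: cvg_trans ci; apply: near_eq_cvg; apply: nearW => N /=.
by have [_ <-] := has_integral_sum (index_enum 'I_N) (fun i : 'I_N => psiv i).
Qed.

End has_integral.

(** * The norm of the space of p-adic vectors *)

Section padic_norm.
Local Open Scope quotient_scope.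
Variables (R : realType) (p : nat) (pP : prime p).
Local Notation Qp := (padic R pP).
Local Notation pR := (p%:R : R).

Lemma p_gt1 : 1 < pR. Proof. by rewrite ltr1n prime_gt1. Qed.
Lemma p_gt0 : 0 < pR. Proof. by rewrite ltr0n prime_gt0. Qed.
Lemma p_neq0 : pR != 0. Proof. by rewrite gt_eqF// p_gt0. Qed.
Lemma ppow_gt0 (k : int) : 0 < pR ^ k.
Proof. by rewrite exprz_gt0// p_gt0. Qed.

Lemma ppow_le (k m : int) : (pR ^ k <= pR ^ m) = (k <= m).
Proof. by rewrite ler_eXz2l// p_gt1. Qed.

Lemma ppow_lt (k m : int) : (pR ^ k < pR ^ m) = (k < m).
Proof. by rewrite ltr_eXz2l// p_gt1. Qed.

Lemma ppowD (k m : int) : pR ^ (k + m) = pR ^ k * pR ^ m.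
Proof. by rewrite expfzDr// p_neq0. Qed.

Lemma absq_p_exp (x : rat) : x != 0 -> exists m : int, absq_p R p x = pR ^ m.
Proof.
move=> x0; exists (Posz (logn p `|denq x|%N) - Posz (logn p `|numq x|%N)).
rewrite /absq_p /absz_p numq_eq0 (negPf x0) denq_eq0 /= invrK mulrC ppowD.
by rewrite -exprz_inv -!exprnP -exprVn.
Qed.

Lemma padic_abs_exp (x : Qp) : x != 0 -> exists m : int, padic_abs x = pR ^ m.
Proof.
rewrite -[x]reprK padic_eq0; set u := repr x => /cseq_stationary[N [u0 HN]].
have [m um] : exists m : int, absq_p R p (u N) = pR ^ m.
  by apply: absq_p_exp; rewrite -(absq_p_gt0 R pP).
exists m; rewrite -um padic_abs_pi; apply/cvg_lim => //.
by apply: cvg_near_cst; exists N => // i /= Ni; rewrite HN.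
Qed.

Lemma padic_abs_natp : padic_abs (p%:R : Qp) = pR^-1.
Proof.
rewrite -[p%:R](ratr_nat _ p) padic_abs_ratr.
have := @absq_p_frac R p pP (Posz p) 1 isT; rewrite divr1 -pmulrn => ->.
rewrite /absz_p /= logn1 expr0 invr1 divr1.
by rewrite eqz_nat -leqn0 leqNgt prime_gt0//= logn_prime// eqxx.
Qed.

Lemma padic_abs1 : padic_abs (1 : Qp) = 1.
Proof. by have := padic_abs_ratr R pP 1%:R; rewrite ratr_nat absq_p1. Qed.

Lemma padic_absX (x : Qp) k : padic_abs (x ^+ k) = padic_abs x ^+ k.
Proof.
elim: k => [|k IH]; first by rewrite !expr0 padic_abs1.
by rewrite !exprS padic_absM IH.
Qed.

Lemma padic_absV (x : Qp) : padic_abs x^-1 = (padic_abs x)^-1.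
Proof.
have [->|x0] := eqVneq x 0; first by rewrite !(invr0, padic_abs0).
have ax0 : padic_abs x != 0 by rewrite padic_abs_eq0.
by apply: (mulfI ax0); rewrite -padic_absM !divff// padic_abs1.
Qed.

(** Indexed by the exponent of its absolute value, not by that of p. *)
Definition pscal (k : int) : Qp := p%:R ^ (- k).

Lemma pscal_abs k : padic_abs (pscal k) = pR ^ k.
Proof.
rewrite /pscal; case: k => k.
  by rewrite -exprnN padic_absV padic_absX padic_abs_natp exprVn invrK.
by rewrite NegzE opprK -exprnP padic_absX padic_abs_natp -exprnN exprVn.
Qed.

Lemma pscal_neq0 k : pscal k != 0.
Proof. by rewrite -padic_abs_eq0 pscal_abs gt_eqF// ppow_gt0. Qed.

Lemma padic_abs_lt_exp (x : Qp) (k : int) :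
  (padic_abs x < pR ^ (k + 1)) = (padic_abs x <= pR ^ k).
Proof.
have [->|/padic_abs_exp[m ->]] := eqVneq x 0.
  by rewrite padic_abs0 ppow_gt0 ltW// ppow_gt0.
by rewrite ppow_lt ppow_le ltzD1.
Qed.

Lemma padic_abs_int (z : int) : z != 0 -> padic_abs (z%:~R : Qp) = absz_p R p z.
Proof.
move=> z0; rewrite -(ratr_int _ z) padic_abs_ratr.
have := @absq_p_frac R p pP z 1 isT; rewrite divr1 => ->.
by rewrite [X in _ / X]/absz_p /= logn1 expr0 invr1 divr1.
Qed.

Lemma padic_abs_nat (m : nat) : padic_abs (m%:R : Qp) <= 1.
Proof.
have [->|m0] := eqVneq m 0; first by rewrite padic_abs0 ler01.
rewrite pmulrn padic_abs_int; last by rewrite eqz_nat.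
rewrite /absz_p eqz_nat (negPf m0) /= invf_le1 ?exprn_gt0 ?p_gt0//.
by rewrite exprn_ege1// ltW// p_gt1.
Qed.

Lemma padic_digit_uniq (r s : 'I_p) :
  padic_abs (r%:R - s%:R : Qp) < 1 -> r = s.
Proof.
move=> rs; apply/eqP/negPn/negP => rs0.
pose z : int := Posz r - Posz s.
have z0 : z != 0 by rewrite subr_eq0 eqz_nat.
have zE : (r%:R - s%:R : Qp) = z%:~R by rewrite intrB -!pmulrn.
move: rs; rewrite zE padic_abs_int// /absz_p (negPf z0) lognE pP absz_gt0 z0 /=.
case: ifPn => [|_]; last by rewrite expr0 invr1 ltxx.
move=> /dvdn_leq; rewrite absz_gt0 z0 => /(_ isT); rewrite leqNgt => /negP[].
rewrite /z; have [le|/ltnW le] := leqP r s.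
  by rewrite distnEr// (leq_ltn_trans (leq_subr _ _)).
by rewrite distnEl// (leq_ltn_trans (leq_subr _ _)).
Qed.

(** The leading digit of y is read off the fractional part of y / p. *)
Lemma padic_digit_exists (y : Qp) : padic_abs y <= 1 ->
  exists r : 'I_p, padic_abs (y - r%:R) < 1.
Proof.
move=> y1; have [q [[k [a [ak qE]]] yq]] := padic_frac_exists (y / p%:R).
have pQ0 : (p%:R : rat) != 0 by rewrite pnatr_eq0 -lt0n prime_gt0.
have ap0 : padic_abs (p%:R : Qp) != 0 by rewrite padic_abs_natp invr_neq0// p_neq0.
have p0 : (p%:R : Qp) != 0 by rewrite -padic_abs_eq0.
have yqp : padic_abs (y - ratr (q * p%:R)) < 1.
  have -> : y - ratr (q * p%:R) = (y / p%:R - ratr q) * p%:R :> Qp.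
    rewrite mulrBl divfK//; congr (_ - _).
    have -> : (p%:R : Qp) = ratr p%:R by rewrite ratr_nat.
    rewrite -!padic_pi_ratr -rmorphM/=; congr (\pi_Qp _).
    exact/val_inj.
  rewrite padic_absM padic_abs_natp ltr_pdivrMr ?p_gt0// mul1r.
  exact: le_lt_trans yq p_gt1.
have qp1 : absq_p R p (q * p%:R) <= 1.
  rewrite -(padic_abs_ratr R pP) -(subrK y (ratr _)).
  by rewrite (le_trans (padic_absD _ _))// ge_max y1 andbT padic_absB ltW.
suff [r rE] : exists r : 'I_p, q * p%:R = r%:R.
  by exists r; rewrite rE ratr_nat in yqp.
rewrite qE; case: k ak qE => [|k] ak qE.
  move: ak; rewrite expn0 ltnS leqn0 => /eqP ->.
  by exists (Ordinal (prime_gt0 pP)); rewrite !mul0r.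
have [a0|a0] := eqVneq a 0%N.
  by exists (Ordinal (prime_gt0 pP)); rewrite a0 !mul0r.
have aE : a%:R / p%:R ^+ k.+1 * p%:R = a%:R / p%:R ^+ k :> rat.
  by rewrite exprS; field; rewrite pQ0 expf_neq0.
have pa : (p ^ k %| a)%N.
  have pk0 : Posz (p ^ k)%N != 0 by rewrite eqz_nat -lt0n expn_gt0 prime_gt0.
  move: qp1; rewrite qE aE.
  have := @absq_p_frac R p pP (Posz a) (Posz (p ^ k)%N) pk0.
  rewrite -!pmulrn natrX => -> /=.
  rewrite ler_pdivrMr ?absz_p_gt0// mul1r /absz_p (negPf pk0) eqz_nat (negPf a0) /=.
  rewrite pfactorK// lef_pV2 ?posrE ?exprn_gt0 ?p_gt0//.
  by rewrite ler_eXn2l ?p_gt1// pfactor_dvdn// lt0n.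
have lt : (a %/ p ^ k < p)%N.
  by rewrite ltn_divLR ?expn_gt0 ?prime_gt0// -expnS.
exists (Ordinal lt); rewrite aE /= -{1}(divnK pa) natrM natrX mulfK//.
by rewrite expf_neq0.
Qed.

Lemma padic_digit (k : int) (y : Qp) : padic_abs y <= pR ^ (k + 1) ->
  exists! r : 'I_p, padic_abs (y - r%:R * pscal (k + 1)) <= pR ^ k.
Proof.
move=> yk; pose z := y / pscal (k + 1).
have E (r : 'I_p) : (padic_abs (y - r%:R * pscal (k + 1)) <= pR ^ k) =
    (padic_abs (z - r%:R) < 1).
  have -> : y - r%:R * pscal (k + 1) = (z - r%:R) * pscal (k + 1).
    by rewrite mulrBl divfK// pscal_neq0.
  rewrite -padic_abs_lt_exp padic_absM pscal_abs.
  by rewrite -[X in _ < X]mul1r ltr_pM2r// ppow_gt0.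
have z1 : padic_abs z <= 1.
  by rewrite padic_absM padic_absV pscal_abs ler_pdivrMr ?ppow_gt0// mul1r.
have [r zr] := padic_digit_exists z1.
exists r; split; first by rewrite E.
move=> s; rewrite E => zs; apply: padic_digit_uniq.
have -> : r%:R - s%:R = (z - s%:R) + (r%:R - z) :> Qp by ring.
by rewrite (le_lt_trans (padic_absD _ _))// gt_max zs padic_absB zr.
Qed.

Section vectors.
Variable n : nat.
Local Notation V := 'rV[Qp]_n.
Implicit Types x y z : V.
Local Notation norm := (@padicn_norm R p pP n).

Lemma padicn_norm_ge0 x : 0 <= norm x.
Proof. exact: bigmax_ge_id. Qed.

Lemma padicn_norm_leP x (r : R) : 0 <= r ->
  reflect (forall i, padic_abs (x 0 i) <= r) (norm x <= r).
Proof.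
move=> r0; apply: (iffP idP) => [/bigmax_leP[_ xr] i|xr]; first exact: xr.
by apply/bigmax_leP; split => // i _; exact: xr.
Qed.

Lemma padic_abs_le_norm x i : padic_abs (x 0 i) <= norm x.
Proof. exact: (elimT (padicn_norm_leP _ (padicn_norm_ge0 x))). Qed.

Lemma padicn_norm0 : norm 0 = 0.
Proof.
apply/eqP; rewrite eq_le padicn_norm_ge0 andbT; apply/padicn_norm_leP => // i.
by rewrite mxE padic_abs0.
Qed.

Lemma padicn_norm_eq0 x : (norm x == 0) = (x == 0).
Proof.
apply/eqP/eqP => [x0|->]; last exact: padicn_norm0.
apply/rowP => i; rewrite mxE; apply/eqP; rewrite -padic_abs_eq0.
by rewrite eq_le padic_abs_ge0 andbT -x0 padic_abs_le_norm.
Qed.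

Lemma padicn_normN x : norm (- x) = norm x.
Proof. by apply: eq_bigr => i _; rewrite mxE padic_absN. Qed.

Lemma padicn_normB x y : norm (x - y) = norm (y - x).
Proof. by rewrite -padicn_normN opprB. Qed.

Lemma padicn_normD_le x y (r : R) : norm x <= r -> norm y <= r -> norm (x + y) <= r.
Proof.
move=> xr yr; have r0 := le_trans (padicn_norm_ge0 x) xr.
apply/padicn_norm_leP => // i; rewrite mxE (le_trans (padic_absD _ _))// ge_max.
by rewrite (le_trans (padic_abs_le_norm _ _) xr) (le_trans (padic_abs_le_norm _ _) yr).
Qed.

Lemma padicn_norm_shift x y (r : R) : norm y <= r ->
  (norm (x + y) <= r) = (norm x <= r).
Proof.
move=> yr; apply/idP/idP => xr; last exact: padicn_normD_le.
by rewrite -(addrK y x); apply: padicn_normD_le; rewrite ?padicn_normN.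
Qed.

Lemma padicn_norm_attained x : x != 0 -> exists i, norm x = padic_abs (x 0 i).
Proof.
rewrite -padicn_norm_eq0 => x0.
have [i _] : exists i : 'I_n, x 0 i != 0.
  apply: contrapT => /forallNP xi; move/eqP: x0; apply; apply/eqP.
  rewrite padicn_norm_eq0; apply/eqP/rowP => i; rewrite mxE.
  by apply/eqP/negPn/negP; exact: xi.
have [j _ jE] := @eq_bigmax _ _ _ 0 i predT (fun i => padic_abs (x 0 i)) isT
  (fun i _ => padic_abs_ge0 _).
by exists j.
Qed.

Lemma padicn_norm_exp x : x != 0 -> exists m : int, norm x = pR ^ m.
Proof.
move=> x0; have [i xi] := padicn_norm_attained x0.
rewrite xi; apply: padic_abs_exp; move: x0; apply: contraNneq => xi0.
by rewrite -padicn_norm_eq0 xi xi0 padic_abs0.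
Qed.

Lemma padicn_norm_lt_exp x (k : int) : (norm x < pR ^ (k + 1)) = (norm x <= pR ^ k).
Proof.
have [->|/padicn_norm_exp[m ->]] := eqVneq x 0.
  by rewrite padicn_norm0 ppow_gt0 ltW// ppow_gt0.
by rewrite ppow_lt ppow_le ltzD1.
Qed.

Definition pvec (k : int) : V := \row_i pscal k.

Lemma pvec_norm k : (0 < n)%N -> norm (pvec k) = pR ^ k.
Proof.
move=> n0; apply/eqP; rewrite eq_le; apply/andP; split.
  by apply/padicn_norm_leP => [|i]; [rewrite ltW// ppow_gt0|rewrite mxE pscal_abs].
by rewrite (le_trans _ (padic_abs_le_norm _ (Ordinal n0)))// mxE pscal_abs.
Qed.

Lemma padicn_dot_abs x y (r s : R) : norm x <= r -> norm y <= s ->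
  padic_abs (padicn_dot x y) <= r * s.
Proof.
move=> xr ys; have r0 := le_trans (padicn_norm_ge0 x) xr.
have s0 := le_trans (padicn_norm_ge0 y) ys.
rewrite /padicn_dot; elim/big_ind: _ => [|a b ar br|i _].
- by rewrite padic_abs0 mulr_ge0.
- by rewrite (le_trans (padic_absD _ _))// ge_max ar.
rewrite padic_absM ler_pM ?padic_abs_ge0//.
  exact: le_trans (padic_abs_le_norm _ _) xr.
exact: le_trans (padic_abs_le_norm _ _) ys.
Qed.

Lemma padicn_dotDr x y z : padicn_dot x (y + z) = padicn_dot x y + padicn_dot x z.
Proof.
by rewrite /padicn_dot -big_split/=; apply: eq_bigr => i _; rewrite mxE mulrDr.
Qed.

Lemma padicn_dotC x y : padicn_dot x y = padicn_dot y x.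
Proof. by apply: eq_bigr => i _; rewrite mulrC. Qed.

(** Balls enter through their indicator functions, in order that they can be
    superposed and integrated. *)
Definition pball (k : int) x : R := (norm x <= pR ^ k)%R%:R.

Lemma pballN k x : pball k (- x) = pball k x.
Proof. by rewrite /pball padicn_normN. Qed.

Lemma pball_shift k x y : norm y <= pR ^ k -> pball k (x + y) = pball k x.
Proof. by move=> yk; rewrite /pball padicn_norm_shift. Qed.

Lemma pball_ge0 k x : 0 <= pball k x. Proof. by rewrite ler0n. Qed.

Lemma pball_le k m x : k <= m -> pball k x <= pball m x.
Proof.
move=> km; rewrite /pball ler_nat; case: leP => // xk.
by rewrite (le_trans xk)// ppow_le.
Qed.

(** The leading digits of the coordinates of a vector of norm at most p ^ k, and
    the vector that they represent modulo the ball of radius p ^ (k - 1). *)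
Definition digits : finType := {ffun 'I_n -> 'I_p}.

Definition digitv (k : int) (r : digits) : V := \row_j ((r j)%:R * pscal k).

Lemma card_digits : #|digits| = (p ^ n)%N.
Proof. by rewrite card_ffun !card_ord. Qed.

Lemma digitv_norm k r : norm (digitv k r) <= pR ^ k.
Proof.
apply/padicn_norm_leP => [|i]; first by rewrite ltW// ppow_gt0.
by rewrite mxE padic_absM pscal_abs ler_piMl ?padic_abs_nat// ltW// ppow_gt0.
Qed.

Lemma pball_split k y : pball (k + 1) y = \sum_(r : digits) pball k (y - digitv (k + 1) r).
Proof.
rewrite {1}/pball; case: (boolP (norm y <= _)) => [yk|yk]; last first.
  rewrite big1// => r _; rewrite /pball; case: (boolP (norm _ <= _)) => // yr.
  case/negP: yk; rewrite -(subrK (digitv (k + 1) r) y).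
  apply: padicn_normD_le; last exact: digitv_norm.
  by rewrite (le_trans yr)// ppow_le lerDl.
have yi i : padic_abs (y 0 i) <= pR ^ (k + 1).
  exact: le_trans (padic_abs_le_norm _ _) yk.
have [f Hf] := choice (fun i => padic_digit (yi i)).
pose r0 : digits := [ffun i => f i].
have k0 : 0 <= pR ^ k by rewrite ltW// ppow_gt0.
rewrite (bigD1 r0)//= big1 => [|r rr0].
  rewrite addr0 /pball; case: (boolP (norm _ <= _)) => // /negP[].
  by apply/padicn_norm_leP => // i; rewrite !mxE ffunE; have [] := Hf i.
rewrite /pball; case: (boolP (norm _ <= _)) => // /padicn_norm_leP yr.
case/eqP: rr0; apply/ffunP => i; rewrite ffunE; have [_ /(_ (r i))->//] := Hf i.
by have := yr k0 i; rewrite !mxE.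
Qed.

Lemma pball_splitN k y : pball (k + 1) y = \sum_(r : digits) pball k (y + digitv (k + 1) r).
Proof.
rewrite -pballN pball_split; apply: eq_bigr => r _.
by rewrite -pballN opprD !opprK.
Qed.

End vectors.
End padic_norm.

(** * Locally constant functions and the Haar measure *)

Section locally_constant.
Variables (R : realType) (p : nat) (pP : prime p) (n : nat).
Local Notation V := 'rV[padic R pP]_n.
Local Notation pR := (p%:R : R).
Local Notation norm := (@padicn_norm R p pP n).

Definition lc (S : Type) (k : int) (g : V -> S) : Prop :=
  forall x x', norm x' <= pR ^ k -> g (x + x') = g x.

Lemma lc_near S k (g : V -> S) x y : lc k g -> norm (y - x) <= pR ^ k -> g y = g x.
Proof. by move=> gk yx; rewrite -(subrK x y) addrC gk. Qed.

Lemma lc_le S k m (g : V -> S) : k <= m -> lc m g -> lc k g.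
Proof. by move=> km gm x x' x'k; apply: gm; rewrite (le_trans x'k)// ppow_le. Qed.

Lemma lc_pball k : lc k (pball (pP := pP) (n := n) k).
Proof. by move=> x x' x'k; rewrite pball_shift. Qed.

Lemma padicn_ballP (x y : V) (k : int) : ball x (pR ^ k) y -> norm (y - x) <= pR ^ k.
Proof.
move=> [e0 xy]; apply/padicn_norm_leP => [|i]; first by rewrite ltW// ppow_gt0.
by have := xy 0 i; rewrite padic_ballE !mxE padic_absB => /ltW.
Qed.

Lemma near_padicn_norm (x : V) (k : int) : \forall y \near x, norm (y - x) <= pR ^ k.
Proof.
apply/nbhs_ballP; exists (pR ^ k); first exact: ppow_gt0.
by move=> y; exact: padicn_ballP.
Qed.

Lemma lc_open S k (g : V -> S) (A : set S) : lc k g -> open (g @^-1` A).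
Proof.
move=> gk; rewrite openE => x Ax; rewrite /interior /=.
by near=> y; rewrite /= (@lc_near _ k _ x)//; near: y; exact: near_padicn_norm.
Unshelve. all: by end_near. Qed.

Lemma lc_measurable k (g : padicn_borel R pP n -> R) : lc k g ->
  measurable_fun setT g.
Proof.
move=> gk _ Y _; rewrite setTI; apply: sub_sigma_algebra.
exact: (@lc_open _ k).
Qed.

Lemma open_translate (a : V) (A : set V) : open A -> open ((fun x => a + x) @^-1` A).
Proof.
rewrite !openE => oA x /oA; rewrite /interior /= => /nbhs_ballP[e e0 xe].
apply/nbhs_ballP; exists e => // y [_ xy]; apply: xe; split=> // i j.
have := xy i j; rewrite !padic_ballE/=.
suff -> : (a + x)%R i j - (a + y)%R i j = x i j - y i j by [].
by rewrite mxE [X in _ - X]mxE opprD addrACA subrr add0r.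
Qed.

Lemma measurable_translate (a : V) :
  measurable_fun setT ((fun x => a + x) : padicn_borel R pP n -> padicn_borel R pP n).
Proof.
apply: (@measurability _ _ _ _ _ _ (@open V : set (set (padicn_borel R pP n)))) => //.
move=> _ [A oA <-]; rewrite setTI; apply: sub_sigma_algebra.
exact: open_translate.
Qed.

End locally_constant.

Section haar.
Variables (R : realType) (p : nat) (pP : prime p) (n : nat).
Local Notation V := 'rV[padic R pP]_n.
Local Notation pR := (p%:R : R).
Local Notation norm := (@padicn_norm R p pP n).
Local Notation B := (padicn_borel R pP n).
Variable mu : {measure set B -> \bar R}.
Hypothesis haar : is_haar mu.
Local Notation hasint := (@has_integral _ B R mu setT).
Local Notation pball := (@pball R p pP n).

Lemma haar_pushforward (a : V) (A : set B) : measurable A ->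
  pushforward mu ((fun x => a + x) : B -> B) A = mu A.
Proof.
move=> mA; rewrite /pushforward -[in RHS](haar.1 (- a) _ mA); congr (mu _).
apply/seteqP; split => [x /= ax|x /= [y Ay <-]]; last by rewrite addNKr.
by exists (a + x) => //; rewrite addKr.
Qed.

Lemma has_integral_translate (a : V) (g : V -> R) v :
  hasint g v -> hasint (fun x => g (a + x)) v.
Proof.
move=> [ig gv].
have mt := @measurable_translate R p pP n.
pose ph : B -> B := fun x : V => - a + x.
have mph : measurable_fun setT ph := mt (- a).
pose h : B -> R := fun x : V => g (a + x).
have hph : EFin \o h \o ph = EFin \o g.
  by apply/funext => x /=; rewrite /h /ph addNKr.
have mh : measurable_fun setT (EFin \o h).
  have := measurable_int _ ig; move=> mg.
  exact: (measurableT_comp mg (mt a)).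
have ih' : mu.-integrable (ph @^-1` setT) (EFin \o h \o ph).
  by rewrite hph preimage_setT.
have ih := integrable_pushforward mph mh ih' measurableT.
have eh := integral_pushforward mph mh ih' measurableT.
have E (F : B -> \bar R) : (\int[pushforward mu ph]_x F x = \int[mu]_x F x)%E.
  by apply: eq_measure_integral => A mA _; exact: haar_pushforward.
split.
  apply/integrableP; split => //; rewrite -E.
  by have /integrableP[] := ih.
by rewrite -E eh preimage_setT hph gv.
Qed.

Lemma pball_split_integral k v : hasint (pball k) v ->
  hasint (pball (k + 1)) (pR ^+ n * v).
Proof.
move=> kv; have -> : pR ^+ n * v = \sum_(r : digits p n) v.
  by rewrite sumr_const card_digits -natrX mulr_natl.
apply: eq_has_integral; first exact: measurableT; last first.
  apply: (has_integral_sum measurableT (index_enum (digits p n)) (fun r : digits p n => _)) => r.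
  exact: (has_integral_translate (digitv R pP (k + 1) r) kv).
move=> x _; rewrite pball_splitN; apply: eq_bigr => r _.
by rewrite addrC.
Qed.

Lemma pball0E : pball 0 = \1_([set x | norm x <= 1] : set B).
Proof.
apply/funext => x; rewrite /pball expr0z indicE.
case: (boolP (norm x <= 1)) => x1; first by rewrite mem_set.
by rewrite memNset//; exact/negP.
Qed.

Lemma measurable_pball0 : measurable ([set x | norm x <= 1] : set B).
Proof.
have -> : [set x : V | norm x <= 1] = (fun x => norm x <= 1) @^-1` [set true] by [].
apply: sub_sigma_algebra; apply: (@lc_open _ _ pP n _ 0) => x x' x'1.
by rewrite padicn_norm_shift// -(expr0z pR).
Qed.

Hint Resolve measurable_pball0 : core.

Lemma pball_integrable k : exists v, hasint (pball k) v.
Proof.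
have step m : (exists v, hasint (pball m) v) -> exists v, hasint (pball (m + 1)) v.
  by move=> [v /pball_split_integral]; eexists; eassumption.
have H0 : exists v, hasint (pball 0) v.
  exists 1; rewrite pball0E; split; last by rewrite integral_indic// setIT haar.2.
  apply/integrableP; split; first exact/measurable_EFinP/measurable_indic.
  under eq_integral do rewrite /= ger0_norm//.
  by rewrite integral_indic// setIT haar.2 ltry.
have dom m m' : m <= m' -> (exists v, hasint (pball m') v) -> exists v, hasint (pball m) v.
  move=> mm' [v Hv]; apply: (dominated_has_integral measurableT _ _ Hv).
    exact: (@lc_measurable R p pP n m _ (@lc_pball R p pP n m)).
  by move=> x _; rewrite ger0_norm ?pball_ge0// pball_le.
have Hn (m : nat) : exists v, hasint (pball m) v.
  by elim: m => [//|m IH]; rewrite intS addrC; exact: step.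
case: k => [k|k]; first exact: Hn.
by apply: (dom _ 0).
Qed.

(** The volume of the unit ball determines the volume of all the balls, since
    the ball of radius p ^ (k + 1) is a disjoint union of p ^ n translates of the
    ball of radius p ^ k. *)
Lemma pball_integral k : hasint (pball k) ((pR ^+ n) ^ k).
Proof.
have P0 : pR ^+ n != 0 by rewrite expf_neq0// p_neq0.
have PS (m : int) : (pR ^+ n) ^ (m + 1) = pR ^+ n * (pR ^+ n) ^ m.
  by rewrite expfzDr// mulrC.
have up m : hasint (pball m) ((pR ^+ n) ^ m) -> hasint (pball (m + 1)) ((pR ^+ n) ^ (m + 1)).
  by move=> /pball_split_integral; rewrite PS.
have down m : hasint (pball (m + 1)) ((pR ^+ n) ^ (m + 1)) -> hasint (pball m) ((pR ^+ n) ^ m).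
  move=> H; have [v Hv] := pball_integrable m.
  have := has_integral_unique (pball_split_integral Hv) H.
  by rewrite PS => /(mulfI P0) <-.
have H0 : hasint (pball 0) 1.
  have [v Hv] := pball_integrable 0.
  suff <- : v = 1 by [].
  by have := Hv.2; rewrite pball0E integral_indic// setIT haar.2 => -[].
have Hp (m : nat) : hasint (pball m) ((pR ^+ n) ^ m).
  by elim: m => [//|m IH]; rewrite intS addrC; exact: up.
have Hm (m : nat) : hasint (pball (- m%:Z)) ((pR ^+ n) ^ (- m%:Z)).
  elim: m => [//|m IH]; apply: down.
  by rewrite intS opprD addrC addNKr.
by case: k => k; [exact: Hp|rewrite NegzE; exact: Hm].
Qed.

End haar.

(** * Averages over balls *)

Section averages.
Variables (R : realType) (p : nat) (pP : prime p) (n : nat).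
Local Notation V := 'rV[padic R pP]_n.
Local Notation pR := (p%:R : R).
Local Notation norm := (@padicn_norm R p pP n).
Local Notation pball := (@pball R p pP n).
Local Notation vol1 := (pR ^+ n).
Implicit Types (l : int) (i j : nat) (g h : V -> R) (x y : V).

Lemma vol1_gt0 : 0 < vol1. Proof. by rewrite exprn_gt0// p_gt0. Qed.
Lemma vol1_neq0 : vol1 != 0. Proof. by rewrite gt_eqF// vol1_gt0. Qed.

(** Representatives of the balls of radius p ^ l in the ball of radius
    p ^ (l + i). *)
Fixpoint reps l i : seq V :=
  if i is j.+1 then [seq s + digitv R pP (l + Posz j + 1) r | s <- reps l j, r <- index_enum (digits p n)]
  else [:: 0].

Definition avg l i g x : R := vol1 ^- i * \sum_(s <- reps l i) g (x + s).

Lemma avg0 l g x : avg l 0 g x = g x.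
Proof. by rewrite /avg /= big_seq1 addr0 expr0 invr1 mul1r. Qed.

Lemma avgS l i g x : avg l i.+1 g x =
  vol1^-1 * \sum_(r : digits p n) avg l i g (x + digitv R pP (l + Posz i + 1) r).
Proof.
rewrite /avg /= big_allpairs_dep/= exprS invfM -mulrA -mulr_sumr; congr (_ * (_ * _)).
rewrite exchange_big/=; apply: eq_bigr => r _; apply: eq_bigr => s _.
by rewrite addrA addrAC.
Qed.

Lemma reps_norm l i s : s \in reps l i -> norm s <= pR ^ (l + Posz i).
Proof.
elim: i s => [|i IH] s /=.
  by rewrite inE => /eqP ->; rewrite padicn_norm0 ltW// ppow_gt0.
move=> /allpairsP[[t r] [/= /IH tl _ ->]].
rewrite intS [1 + _]addrC addrA; apply: padicn_normD_le; last exact: digitv_norm.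
by rewrite (le_trans tl)// ppow_le// lerDl.
Qed.

Lemma avg_cst l i (c : R) x : avg l i (fun=> c) x = c.
Proof.
elim: i x => [|i IH] x; first by rewrite avg0.
rewrite avgS; under eq_bigr do rewrite IH.
by rewrite sumr_const card_digits -[c *+ _]mulr_natl natrX mulKf// vol1_neq0.
Qed.

Lemma eq_avg l i g h x : (forall y, norm (y - x) <= pR ^ (l + Posz i) -> g y = h y) ->
  avg l i g x = avg l i h x.
Proof.
move=> gh; rewrite /avg; congr (_ * _); apply: eq_big_seq => s /reps_norm sl.
by apply: gh; rewrite addrC addKr.
Qed.

Lemma avgD l i g h x : avg l i (fun y => g y + h y) x = avg l i g x + avg l i h x.
Proof. by rewrite /avg big_split/= mulrDr. Qed.

Lemma avgZ l i c g x : avg l i (fun y => c * g y) x = c * avg l i g x.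
Proof. by rewrite /avg -mulr_sumr mulrCA. Qed.

Lemma avgB l i g h x : avg l i (fun y => g y - h y) x = avg l i g x - avg l i h x.
Proof. by rewrite /avg sumrB mulrBr. Qed.

Lemma avg_le l i g (M : R) x :
  (forall y, norm (y - x) <= pR ^ (l + Posz i) -> `|g y| <= M) -> `|avg l i g x| <= M.
Proof.
move=> gM; rewrite -(avg_cst l i M x) /avg normrM ger0_norm; last first.
  by rewrite invr_ge0 exprn_ge0// ltW// vol1_gt0.
apply: ler_wpM2l; first by rewrite invr_ge0 exprn_ge0// ltW// vol1_gt0.
rewrite (le_trans (ler_norm_sum _ _ _))//.
rewrite big_seq [X in _ <= X]big_seq; apply: ler_sum => s /reps_norm sl.
by apply: gM; rewrite addrC addKr.
Qed.

Lemma avg_cvg l i (F : nat -> V -> R) g x :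
  (forall y, F N y @[N --> \oo] --> g y) ->
  avg l i (F N) x @[N --> \oo] --> avg l i g x.
Proof.
move=> Fg; apply: cvgM; first exact: cvg_cst.
elim: (reps l i) => [|s ss IH].
  by rewrite big_nil; under eq_fun do rewrite big_nil; exact: cvg_cst.
by rewrite big_cons; under eq_fun do rewrite big_cons; exact: cvgD.
Qed.

Lemma avg_has_integral d (T : measurableType d) (nu : {measure set T -> \bar R})
    (D : set T) l i (F : V -> T -> R) (I : V -> R) x : measurable D ->
  (forall y, has_integral nu D (F y) (I y)) ->
  has_integral nu D (fun t => avg l i (F ^~ t) x) (avg l i I x).
Proof.
by move=> mD FI; apply: has_integralZ => //; apply: has_integral_sum.
Qed.

Lemma lc_avg k l i g : lc k g -> lc k (avg l i g).
Proof.
move=> gk x x' x'k; rewrite /avg; congr (_ * _); apply: eq_bigr => s _.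
by rewrite addrAC; exact: gk.
Qed.

Lemma avg_id l i g x : lc (l + Posz i) g -> avg l i g x = g x.
Proof.
move=> gl; rewrite -[RHS](avg_cst l i _ x); apply: eq_avg => y yx.
exact: lc_near gl yx.
Qed.

Section haar.
Local Notation B := (padicn_borel R pP n).
Variable mu : {measure set B -> \bar R}.
Hypothesis haar : is_haar mu.
Local Notation hasint := (@has_integral _ B R mu setT).

Lemma avg_vol_step l i g x : vol1 ^ (l + Posz i.+1) * avg l i.+1 g x =
  \sum_(r : digits p n) vol1 ^ (l + Posz i) * avg l i g (x + digitv R pP (l + Posz i + 1) r).
Proof.
rewrite avgS -mulr_sumr mulrA intS [1 + _]addrC addrA; congr (_ * _).
by rewrite expfzDr ?vol1_neq0// expr1z mulfK// vol1_neq0.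
Qed.

Lemma avg_ball_integral l i g x : lc l g ->
  hasint (fun y : V => pball (l + Posz i) (x - y) * g y) (vol1 ^ (l + Posz i) * avg l i g x).
Proof.
move=> gl; elim: i x => [|i IH] x.
  have E (y : V) : g x * pball l (- x + y) = pball (l + Posz 0) (x - y) * g y.
    rewrite addr0 -pballN opprD opprK mulrC /pball.
    case: (boolP (norm _ <= _)) => xy; last by rewrite !mul0r.
    by rewrite (lc_near gl xy).
  rewrite avg0 addr0 mulrC -[l in pball l]addr0.
  have H := has_integralZ measurableT (g x)
    (has_integral_translate haar (- x) (pball_integral haar l)).
  by apply: eq_has_integral H => // y _; exact: E.
rewrite avg_vol_step.
have E (y : V) : \sum_(r : digits p n) pball (l + Posz i) (x + digitv R pP (l + Posz i + 1) r - y) * g y =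
    pball (l + Posz i.+1) (x - y) * g y.
  rewrite intS [1 + _]addrC addrA pball_splitN mulr_suml; apply: eq_bigr => r _.
  by rewrite addrAC.
have H := has_integral_sum measurableT (index_enum (digits p n))
  (fun r => IH (x + digitv R pP (l + Posz i + 1) r)).
by apply: eq_has_integral H => // y _; exact: E.
Qed.

Lemma avg_ball_integral_conv l i g x : lc l g ->
  hasint (fun y : V => pball (l + Posz i) y * g (x - y)) (vol1 ^ (l + Posz i) * avg l i g x).
Proof.
move=> gl; elim: i x => [|i IH] x.
  have E (y : V) : g x * pball l y = pball (l + Posz 0) y * g (x - y).
    rewrite addr0 mulrC /pball.
    case: (boolP (norm _ <= _)) => yl; last by rewrite !mul0r.
    by rewrite gl// padicn_normN.
  rewrite avg0 addr0 mulrC -[l in pball l]addr0.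
  have H := has_integralZ measurableT (g x) (pball_integral haar l).
  by apply: eq_has_integral H => // y _; exact: E.
rewrite avg_vol_step.
have E (y : V) : \sum_(r : digits p n) pball (l + Posz i) (digitv R pP (l + Posz i + 1) r + y) *
      g (x + digitv R pP (l + Posz i + 1) r - (digitv R pP (l + Posz i + 1) r + y)) =
    pball (l + Posz i.+1) y * g (x - y).
  rewrite intS [1 + _]addrC addrA pball_splitN mulr_suml; apply: eq_bigr => r _.
  by rewrite [_ + y]addrC opprD addrACA subrr addr0.
have H := has_integral_sum measurableT (index_enum (digits p n))
  (fun r => has_integral_translate haar (digitv R pP (l + Posz i + 1) r)
              (IH (x + digitv R pP (l + Posz i + 1) r))).
by apply: eq_has_integral H => // y _; exact: E.
Qed.

(** The integral of g over a ball depends on the ball only, and not on the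
    center chosen in it. *)
Lemma lc_avg_ball l i g : lc l g -> lc (l + Posz i) (avg l i g).
Proof.
move=> gl x x' x'l; apply: (@mulfI _ (vol1 ^ (l + Posz i))).
  by rewrite gt_eqF// exprz_gt0// vol1_gt0.
apply: (has_integral_unique (avg_ball_integral i (x + x') gl)).
have E (y : V) : pball (l + Posz i) (x - y) * g y = pball (l + Posz i) (x + x' - y) * g y.
  by rewrite [x + x' - y]addrAC (pball_shift _ x'l).
by apply: eq_has_integral (avg_ball_integral i x gl) => // y _; exact: E.
Qed.

(** An average over a ball of radius p ^ (l + j) is constant on these balls, and
    is therefore not changed by averaging over smaller ones; in the other order,
    the averages compose because the large ball splits into small ones. *)
Lemma avg_avg l i j g x : lc l g -> avg l i (avg l j g) x = avg l (maxn i j) g x.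
Proof.
move=> gl.
have le_case a b y : (a <= b)%N -> avg l a (avg l b g) y = avg l b g y.
  move=> ab; apply: avg_id; apply: (@lc_le _ _ _ _ _ _ (l + Posz b)).
    by rewrite lerD2l lez_nat.
  exact: lc_avg_ball.
have [ij|ji] := leqP i j; first by rewrite le_case// (maxn_idPr ij).
elim: i x ji => [|i IH] x ji //.
rewrite !avgS; congr (_ * _); apply: eq_bigr => r _.
move: ji; rewrite ltnS leq_eqVlt => /orP[/eqP <-|/IH //].
exact: le_case.
Qed.

Definition avgdiff l i g x : R := avg l i g x - avg l i.+1 g x.

(** Averaging over balls of radius p ^ (l + i) removes the frequencies of absolute
    value greater than p ^ - (l + i), so that avgdiff isolates the frequencies of
    absolute value p ^ - (l + i), and these are disjoint for distinct i. *)
Lemma avgdiff_avgdiff l i j g x : lc l g ->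
  avgdiff l i (avgdiff l j g) x = if i == j then avgdiff l i g x else 0.
Proof.
move=> gl; rewrite {1}/avgdiff /avgdiff !avgB !avg_avg//.
case: (ltngtP i j) => [ij|ij|->].
- by rewrite (maxn_idPr (leqW (ltnW ij))) (maxn_idPr ij) (maxn_idPr (leqW ij)) subrr.
- rewrite (maxn_idPl ij) (maxn_idPl (leqW (ltnW ij))).
  by rewrite (maxn_idPl (leqW ij)) !subrr.
- by rewrite maxnn (maxn_idPr (leqnSn j)) (maxn_idPl (leqnSn j)) subrr subr0.
Qed.

End haar.

Lemma lc_avgdiff k l i g : lc k g -> lc k (avgdiff l i g).
Proof. by move=> gk x x' x'k; rewrite /avgdiff !(lc_avg _ _ gk). Qed.

Lemma avgdiffD l i g h x :
  avgdiff l i (fun y => g y + h y) x = avgdiff l i g x + avgdiff l i h x.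
Proof. by rewrite /avgdiff !avgD opprD addrACA. Qed.

Lemma avgdiffZ l i c g x : avgdiff l i (fun y => c * g y) x = c * avgdiff l i g x.
Proof. by rewrite /avgdiff !avgZ mulrBr. Qed.

Lemma avgdiff_cvg l i (F : nat -> V -> R) g x :
  (forall y, F N y @[N --> \oo] --> g y) ->
  avgdiff l i (F N) x @[N --> \oo] --> avgdiff l i g x.
Proof. by move=> Fg; apply: cvgB; exact: avg_cvg. Qed.

Lemma avgdiff_has_integral d (T : measurableType d) (nu : {measure set T -> \bar R})
    (D : set T) l i (F : V -> T -> R) (I : V -> R) x : measurable D ->
  (forall y, has_integral nu D (F y) (I y)) ->
  has_integral nu D (fun t => avgdiff l i (F ^~ t) x) (avgdiff l i I x).
Proof. by move=> mD FI; apply: has_integralB => //; exact: avg_has_integral. Qed.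

End averages.

(** * Integrals of characters over balls *)

Section characters.
Variables (R : realType) (p : nat) (pP : prime p).
Local Notation Qp := (padic R pP).
Local Notation pR := (p%:R : R).

Definition char_arg (y : Qp) : R := 2 * pi * ratr (padic_frac y).

Lemma padic_fracP (y : Qp) : is_padic_frac y (padic_frac y).
Proof.
rewrite /padic_frac; have [r Hr] := padic_frac_exists y.
by case: xgetP => [z _ //|/(_ r)].
Qed.

Lemma padic_frac_eq (y : Qp) r : is_padic_frac y r -> padic_frac y = r.
Proof. exact: padic_frac_unique (padic_fracP y). Qed.

Lemma padic_ratr0 : ratr 0 = 0 :> Qp. Proof. exact: (ratr_nat _ 0). Qed.
Lemma padic_ratr1 : ratr 1 = 1 :> Qp. Proof. exact: (ratr_nat _ 1). Qed.

Lemma padic_ratrD (a b : rat) : ratr (a + b) = ratr a + ratr b :> Qp.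
Proof. by rewrite -[b in LHS]opprK padic_ratrB -[- b]sub0r padic_ratrB padic_ratr0 sub0r opprK. Qed.

Lemma padic_frac0 (y : Qp) : padic_abs y <= 1 -> padic_frac y = 0.
Proof.
move=> y1; apply: padic_frac_eq; split; first by exists 0%N, 0%N; rewrite mul0r.
by rewrite padic_ratr0 subr0.
Qed.

(** The sum of the two fractional parts lies in [0, 2), has a power of p as its
    denominator, and is congruent to y + z modulo the p-adic integers. *)
Lemma padic_fracD (y z : Qp) :
  padic_frac (y + z) = padic_frac y + padic_frac z \/
  padic_frac (y + z) = padic_frac y + padic_frac z - 1.
Proof.
have := padic_fracP z; have := padic_fracP y.
move: (padic_frac y) (padic_frac z) => r s [[k [a [ak rE]]] yr] [[m [b [bm sE]]] zs].
pose c := (a * p ^ m + b * p ^ k)%N.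
have pk j : (0 < p ^ j)%N by rewrite expn_gt0 prime_gt0.
have pQ j : (p%:R : rat) ^+ j != 0 by rewrite expf_neq0// pnatr_eq0 -lt0n prime_gt0.
have cE : r + s = c%:R / p%:R ^+ (k + m).
  rewrite rE sE /c natrD !natrM !natrX exprD.
  by field; rewrite !pQ.
have yz : padic_abs (y + z - ratr (r + s)) <= 1.
  rewrite padic_ratrD opprD addrACA (le_trans (padic_absD _ _))// ge_max.
  by rewrite yr zs.
have [cp|cp] := ltnP c (p ^ (k + m)).
  by left; apply: padic_frac_eq; split=> //; exists (k + m)%N, c.
right; apply: padic_frac_eq; split.
  exists (k + m)%N, (c - p ^ (k + m))%N; split.
    have ak' : (a * p ^ m < p ^ (k + m))%N by rewrite expnD ltn_pmul2r.
    have bm' : (b * p ^ k < p ^ (k + m))%N by rewrite addnC expnD ltn_pmul2r.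
    by rewrite ltn_subLR// /c -addSn leq_add// ltnW.
  by rewrite natrB// mulrBl natrX divff// cE.
have -> : y + z - ratr (r + s - 1) = (y + z - ratr (r + s)) + 1.
  by rewrite padic_ratrB padic_ratr1 opprB addrA addrAC.
by rewrite (le_trans (padic_absD _ _))// ge_max yz padic_abs1 lexx.
Qed.

Lemma char_argD (y z : Qp) :
  char_arg (y + z) = char_arg y + char_arg z \/
  char_arg (y + z) = char_arg y + char_arg z - pi *+ 2.
Proof.
rewrite /char_arg; have [->|->] := padic_fracD y z; [left|right].
  by rewrite rmorphD/= mulrDr.
by rewrite rmorphB rmorphD rmorph1/= mulrBr mulrDr mulr1 [2 * pi]mulr_natl.
Qed.

Lemma cos_charD (y z : Qp) : cos (char_arg (y + z)) = cos (char_arg y + char_arg z).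
Proof.
have [->//|->] := char_argD y z.
by rewrite -[in RHS](subrK (pi *+ 2) (_ + _)) cosD2pi.
Qed.

Lemma sin_charD (y z : Qp) : sin (char_arg (y + z)) = sin (char_arg y + char_arg z).
Proof.
have [->//|->] := char_argD y z.
by rewrite -[in RHS](subrK (pi *+ 2) (_ + _)) sinD2pi.
Qed.

Lemma char_arg0 (y : Qp) : padic_abs y <= 1 -> char_arg y = 0.
Proof. by move=> y1; rewrite /char_arg padic_frac0// rmorph0 mulr0. Qed.

(** At 1 / p the character takes the value of a primitive p-th root of unity. *)
Lemma cos_char_pinv : cos (char_arg (pscal R pP 1)) != 1.
Proof.
have fE : padic_frac (pscal R pP 1) = p%:R^-1.
  apply: padic_frac_eq; split.
    by exists 1%N, 1%N; rewrite expn1 prime_gt1// expr1 mul1r.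
  have -> : pscal R pP 1 = ratr p%:R^-1.
    have ap : padic_abs (p%:R : Qp) != 0 by rewrite padic_abs_natp invr_eq0 p_neq0.
    have p0 : (p%:R : Qp) != 0 by rewrite -padic_abs_eq0.
    apply: (mulfI p0); rewrite /pscal -exprnN expr1 divff//.
    have -> : (p%:R : Qp) = ratr p%:R by rewrite ratr_nat.
    rewrite -!padic_pi_ratr -rmorphM/=.
    rewrite -padic_ratr1 -!padic_pi_ratr; congr (\pi_Qp _)%qT; apply/val_inj/funext => i /=.
    by rewrite fctE/= mulfV// pnatr_eq0 -lt0n prime_gt0.
  by rewrite subrr padic_abs0 ler01.
rewrite /char_arg fE fmorphV/= ratr_nat; apply/eqP; rewrite -[X in _ = X]cos0 => /cos_inj H.
have p2 : 2 <= pR by rewrite ler_nat prime_gt1.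
have pg := pi_gt0 R.
have : 2 * pi / pR = 0.
  apply: H; rewrite in_itv/= ?lexx ?(ltW pg)//.
  by rewrite divr_ge0 ?mulr_ge0 ?(ltW pg)//= ler_pdivrMr ?p_gt0// mulrC ler_pM2l.
by move/eqP; rewrite !mulf_eq0 invr_eq0 (negPf (p_neq0 R pP)) pnatr_eq0 (gt_eqF pg).
Qed.

Section vectors.
Variable n : nat.
Local Notation V := 'rV[Qp]_n.
Local Notation norm := (@padicn_norm R p pP n).
Local Notation pball := (@pball R p pP n).
Local Notation B := (padicn_borel R pP n).
Variable mu : {measure set B -> \bar R}.
Hypothesis haar : is_haar mu.
Local Notation hasint := (@has_integral _ B R mu setT).
Local Notation vol1 := (pR ^+ n).

Lemma lc_char_arg (x : V) m (F : R -> R) :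
  (forall y z, padic_abs z <= 1 -> F (char_arg (y + z)) = F (char_arg y)) ->
  norm x <= pR ^ m -> lc (- m) (fun xi : V => F (char_arg (padicn_dot x xi))).
Proof.
move=> HF xm xi xi' xi'm; rewrite padicn_dotDr HF//.
rewrite (le_trans (padicn_dot_abs xm xi'm))//.
by rewrite -ppowD// subrr expr0z.
Qed.

Lemma lc_cos_char (x : V) m : norm x <= pR ^ m ->
  lc (- m) (fun xi : V => cos (char_arg (padicn_dot x xi))).
Proof.
by apply: lc_char_arg => y z z1; rewrite cos_charD (char_arg0 z1) addr0.
Qed.

Lemma lc_sin_char (x : V) m : norm x <= pR ^ m ->
  lc (- m) (fun xi : V => sin (char_arg (padicn_dot x xi))).
Proof.
by apply: lc_char_arg => y z z1; rewrite sin_charD (char_arg0 z1) addr0.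
Qed.

Lemma padicn_norm_bounded (x : V) : exists m : int, norm x <= pR ^ m.
Proof.
have [->|/padicn_norm_exp[m ->]] := eqVneq x 0; last by exists m.
by exists 0; rewrite padicn_norm0 expr0z ler01.
Qed.

Lemma bounded_char_integral m (h : V -> R) k : lc k h -> (forall y, `|h y| <= 1) ->
  exists v, hasint (fun xi => pball m xi * h xi) v.
Proof.
move=> hk h1.
have mh : measurable_fun setT ((fun xi => pball m xi * h xi) : B -> R).
  apply: measurable_funM; last exact: lc_measurable hk.
  exact: lc_measurable (@lc_pball _ _ _ _ m).
apply: (dominated_has_integral measurableT mh _ (pball_integral haar m)).
move=> y _; rewrite normrM ger0_norm ?pball_ge0//.
by rewrite ler_piMr// pball_ge0.
Qed.

(** If x is so large that the character is not trivial on the ball, then a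
    translation of the ball by a suitable vector multiplies the integral by a
    number other than 1, and the integral vanishes. *)
Lemma char_ball_integral (x : V) m :
  hasint (fun xi => pball m xi * cos (char_arg (padicn_dot x xi))) (vol1 ^ m * pball (- m) x) /\
  hasint (fun xi => pball m xi * sin (char_arg (padicn_dot x xi))) 0.
Proof.
rewrite {2}/pball; case: (boolP (norm x <= _)) => xm /=.
  have E (xi : V) : pball m xi * char_arg (padicn_dot x xi) = 0.
    rewrite /pball; case: (boolP (norm xi <= _)) => xim; last by rewrite mul0r.
    rewrite mul1r char_arg0// (le_trans (padicn_dot_abs xm xim))//.
    by rewrite -ppowD// addNr expr0z.
  have E' (xi : V) : pball m xi = 0 \/ char_arg (padicn_dot x xi) = 0.
    by have /eqP := E xi; rewrite mulf_eq0 => /orP[] /eqP; [left|right].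
  have E1 (xi : V) : pball m xi = pball m xi * cos (char_arg (padicn_dot x xi)).
    by have [->|->] := E' xi; rewrite ?mul0r// cos0 mulr1.
  have E2 (xi : V) : 0 = pball m xi * sin (char_arg (padicn_dot x xi)).
    by have [->|->] := E' xi; rewrite ?mul0r// sin0 mulr0.
  split; first by rewrite mulr1; apply: eq_has_integral (pball_integral haar m) => // xi _; exact: E1.
  by apply: eq_has_integral (has_integral0 mu _) => // xi _; exact: E2.
rewrite mulr0; have [k xk] := padicn_norm_bounded x.
have [I HI] := bounded_char_integral m (lc_cos_char xk) (fun=> cos_max _).
have [J HJ] := bounded_char_integral m (lc_sin_char xk) (fun=> sin_max _).
have x0 : x != 0.
  by apply: contraNneq xm => ->; rewrite padicn_norm0 ltW// ppow_gt0.
have [i xi] := padicn_norm_attained x0.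
have xi0 : x 0 i != 0 by rewrite -padic_abs_eq0 -xi padicn_norm_eq0.
pose b : V := \row_j (if j == i then pscal R pP 1 / x 0 i else 0).
have xb : padicn_dot x b = pscal R pP 1.
  rewrite /padicn_dot (bigD1 i)//= mxE eqxx big1 => [|j ji].
    by rewrite addr0 mulrC divfK.
  by rewrite mxE (negPf ji) mulr0.
have bm : norm b <= pR ^ m.
  apply/padicn_norm_leP => [|j]; first by rewrite ltW// ppow_gt0.
  rewrite mxE; case: eqP => _; last by rewrite padic_abs0 ltW// ppow_gt0.
  rewrite padic_absM padic_absV -xi pscal_abs ler_pdivrMr; last first.
    by rewrite lt_def padicn_norm_ge0 andbT padicn_norm_eq0.
  move: xm; rewrite -padicn_norm_lt_exp -leNgt ppowD// expr1z => xm.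
  by rewrite -(ler_pM2l (ppow_gt0 R pP m)) mulrA -ppowD// subrr expr0z mul1r in xm.
pose c := cos (char_arg (pscal R pP 1)); pose s := sin (char_arg (pscal R pP 1)).
have Eb (y : V) : pball m (b + y) = pball m y by rewrite addrC (pball_shift _ bm).
have EC (y : V) : c * (pball m y * cos (char_arg (padicn_dot x y))) -
    s * (pball m y * sin (char_arg (padicn_dot x y))) =
    pball m (b + y) * cos (char_arg (padicn_dot x (b + y))).
  by rewrite padicn_dotDr xb cos_charD cosD Eb /c /s; ring.
have ES (y : V) : s * (pball m y * cos (char_arg (padicn_dot x y))) +
    c * (pball m y * sin (char_arg (padicn_dot x y))) =
    pball m (b + y) * sin (char_arg (padicn_dot x (b + y))).
  by rewrite padicn_dotDr xb sin_charD sinD Eb /c /s; ring.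
have EI : I = c * I - s * J.
  apply: has_integral_unique (has_integral_translate haar b HI) _.
  have H := has_integralB measurableT (has_integralZ measurableT c HI)
    (has_integralZ measurableT s HJ).
  by apply: eq_has_integral H => // y _; exact: EC.
have EJ : J = s * I + c * J.
  apply: has_integral_unique (has_integral_translate haar b HJ) _.
  have H := has_integralD measurableT (has_integralZ measurableT s HI)
    (has_integralZ measurableT c HJ).
  by apply: eq_has_integral H => // y _; exact: ES.
have D0 : (1 - c) ^+ 2 + s ^+ 2 != 0.
  have : 0 < (1 - c) ^+ 2 by rewrite exprn_even_gt0//= subr_eq0 eq_sym cos_char_pinv.
  by have := sqr_ge0 s => ? ?; rewrite gt_eqF// ltr_wpDr.
have I0 : I = 0.
  apply: (mulfI D0); rewrite mulr0.
  have -> : ((1 - c) ^+ 2 + s ^+ 2) * I =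
    (1 - c) * (I - (c * I - s * J)) - s * (J - (s * I + c * J)) by ring.
  by rewrite -EI -EJ !subrr !mulr0 subr0.
have J0 : J = 0.
  apply: (mulfI D0); rewrite mulr0.
  have -> : ((1 - c) ^+ 2 + s ^+ 2) * J =
    (1 - c) * (J - (s * I + c * J)) + s * (I - (c * I - s * J)) by ring.
  by rewrite -EI -EJ !subrr !mulr0 addr0.
by rewrite -[X in hasint _ X]I0 -[X in _ /\ hasint _ X]J0.
Qed.

End vectors.
End characters.

(** * Geometrically dominated series *)

Section geometric.
Variable R : realType.
Implicit Types (u : nat -> R) (C q : R).

Lemma sum_recr u N : \sum_(i < N.+1) u i = \sum_(i < N) u i + u N.
Proof. by rewrite big_ord_recr. Qed.

Lemma geo_sum_le C q N : 0 <= C -> 0 <= q < 1 ->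
  \sum_(i < N) C * q ^+ i <= C / (1 - q).
Proof.
move=> C0 /andP[q0 q1]; rewrite -mulr_sumr ler_wpM2l//.
have d0 : 0 < 1 - q by rewrite subr_gt0.
rewrite -[X in _ <= X]mul1r ler_pdivlMr//.
have -> : (\sum_(i < N) q ^+ i) * (1 - q) = 1 - q ^+ N.
  elim: N => [|N IH]; first by rewrite big_ord0 mul0r expr0 subrr.
  by rewrite big_ord_recr/= mulrDl IH exprS; ring.
by rewrite lerBlDr lerDl exprn_ge0.
Qed.

Lemma geo_cvg u C q : 0 <= q < 1 -> (forall i, `|u i| <= C * q ^+ i) ->
  cvgn (fun N => \sum_(i < N) u i).
Proof.
move=> /andP[q0 q1] uC.
suff : cvgn (series u) by rewrite /series/=; under eq_fun do rewrite big_mkord.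
apply: normed_cvg; apply: (@series_le_cvg _ _ (geometric C q)).
- by move=> i; exact: normr_ge0.
- by move=> i; exact: le_trans (normr_ge0 _) (uC i).
- exact: uC.
by apply: is_cvg_geometric_series; rewrite ger0_norm.
Qed.

Lemma geo_lim_le u C q : 0 <= q < 1 -> (forall i, `|u i| <= C * q ^+ i) ->
  `|limn (fun N => \sum_(i < N) u i)| <= C / (1 - q).
Proof.
move=> q01 uC; have C0 : 0 <= C by have := le_trans (normr_ge0 _) (uC 0%N); rewrite expr0 mulr1.
have cu := geo_cvg q01 uC.
have cn : cvgn (fun N => `|\sum_(i < N) u i|) by apply: is_cvg_norm.
rewrite -(cvg_lim _ (cvg_norm cu))//.
apply: limr_le => //; apply: nearW => N.
rewrite (le_trans (ler_norm_sum _ _ _))// (le_trans _ (geo_sum_le N C0 q01))//.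
exact: ler_sum.
Qed.

Lemma geo_cvg0 (C q : R) : 0 <= q < 1 -> C * q ^+ N @[N --> \oo] --> (0 : R).
Proof.
move=> /andP[q0 q1]; rewrite -[X in _ --> X](mulr0 C).
by apply: cvgM; [exact: cvg_cst|apply: cvg_expr; rewrite ger0_norm].
Qed.

Lemma geo_squeeze u C q : 0 <= q < 1 -> (forall i, `|u i| <= C * q ^+ i) ->
  u N @[N --> \oo] --> (0 : R).
Proof.
move=> q01 uC; apply: norm_cvg0.
apply: (squeeze_cvgr _ (cvg_cst 0) (geo_cvg0 C q01)).
by apply: nearW => N; rewrite normr_ge0 uC.
Qed.

End geometric.

(** * Integrals against the inverse of a radial weight *)

Section radial_kernel.
Variables (R : realType) (p : nat) (pP : prime p) (n : nat).
Local Notation V := 'rV[padic R pP]_n.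
Local Notation pR := (p%:R : R).
Local Notation norm := (@padicn_norm R p pP n).
Local Notation pball := (@pball R p pP n).
Local Notation vol1 := (pR ^+ n).
Local Notation B := (padicn_borel R pP n).
Variable mu : {measure set B -> \bar R}.
Hypothesis haar : is_haar mu.
Local Notation hasint := (@has_integral _ B R mu setT).
Variables (w : V -> R) (wk : int -> R) (cb Cb s : R).

Definition sphere_mass (k : int) := vol1 ^ k / wk k.

Hypothesis wE : forall y m, norm y = pR ^ m -> w y = wk m.
Hypothesis wk_gt0 : forall m, 0 < wk m.
Hypothesis s01 : 0 < s < 1.
Hypothesis cb_gt0 : 0 < cb.
Hypothesis mass_ge : forall k, cb * s ^ k <= sphere_mass k.
Hypothesis mass_le : forall k, sphere_mass k <= Cb * s ^ k.

Lemma s_gt0 : 0 < s. Proof. by case/andP: s01. Qed.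
Lemma s_neq0 : s != 0. Proof. by rewrite gt_eqF// s_gt0. Qed.

Lemma sD (k : int) (i : nat) : s ^ (k + Posz i) = s ^ k * s ^+ i.
Proof. by rewrite expfzDr ?s_neq0. Qed.

Lemma sS (k : int) (i : nat) : s ^ (k + Posz i.+1) = s ^ (k + 1) * s ^+ i.
Proof. by rewrite intS addrA sD. Qed.

Lemma sphere_mass_gt0 k : 0 < sphere_mass k.
Proof. by rewrite divr_gt0// exprz_gt0// vol1_gt0. Qed.

Lemma Cb_gt0 : 0 < Cb.
Proof.
have := mass_le 0; rewrite expr0z mulr1; apply: lt_le_trans.
exact: sphere_mass_gt0.
Qed.

(** The weight is constant on spheres, so that the integral is the sum over the
    spheres of the integrals of h, which are the differences of its integrals
    over balls. Domination by a geometric series is the place where the growth r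
    of h meets the decay s of the masses of the spheres. *)
Lemma has_integral_radial (k : int) (h : V -> R) (I : nat -> R) (H r S : R) :
  (forall y, norm y <= pR ^ k -> h y = 0) ->
  (forall i, hasint (fun y => pball (k + Posz i) y * h y) (I i)) ->
  0 <= H -> 0 <= r -> r * s < 1 ->
  (forall i y, norm y <= pR ^ (k + Posz i) -> `|h y| <= H * r ^+ i) ->
  \sum_(i < N) (I i.+1 - I i) / wk (k + Posz i.+1) @[N --> \oo] --> S ->
  hasint (fun y => h y / w y) S.
Proof.
move=> h0 hI H0 r0 rs hH cS.
pose psi i (y : V) := (wk (k + Posz i.+1))^-1 * (pball (k + Posz i.+1) y * h y - pball (k + Posz i) y * h y).
pose phi i (y : V) := (wk (k + Posz i.+1))^-1 * (H * r ^+ i.+1) * pball (k + Posz i.+1) y.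
have le_k i : k + Posz i <= k + Posz i.+1 by rewrite lerD2l lez_nat.
apply: (has_integral_series (T := B) measurableT (psi := psi) (phi := phi)
   (v := fun i => (I i.+1 - I i) / wk (k + Posz i.+1))
   (m := fun i => (wk (k + Posz i.+1))^-1 * (H * r ^+ i.+1) * vol1 ^ (k + Posz i.+1))
   (K := H * Cb * r * s ^ (k + 1) / (1 - r * s))).
- move=> i; rewrite mulrC; apply: has_integralZ => //.
  exact: has_integralB.
- move=> i; apply: has_integralZ => //; exact: pball_integral.
- move=> i y _; rewrite /psi /phi normrM ger0_norm ?invr_ge0 ?(ltW (wk_gt0 _))//.
  rewrite -mulrA ler_wpM2l ?invr_ge0 ?(ltW (wk_gt0 _))// -mulrBl normrM.
  have b01 : 0 <= pball (k + Posz i.+1) y - pball (k + Posz i) y <= pball (k + Posz i.+1) y.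
    by rewrite subr_ge0 pball_le//= lerBlDr lerDl pball_ge0.
  have /andP[b0 b1] := b01; rewrite (ger0_norm b0) mulrC.
  case: (leP (norm y) (pR ^ (k + Posz i.+1))) => yi.
    by apply: ler_pM => //; exact: hH.
  have -> : pball (k + Posz i.+1) y - pball (k + Posz i) y = 0.
    apply/eqP; rewrite eq_le b0 andbT (le_trans b1)//.
    by rewrite /pball (lt_geF yi).
  by rewrite mulr0 mulr_ge0 ?pball_ge0// mulr_ge0// exprn_ge0.
- move=> N; apply: le_trans (geo_sum_le N _ _); last 2 first.
  + by rewrite !mulr_ge0// ?(ltW Cb_gt0)// ltW// exprz_gt0// s_gt0.
  + by rewrite rs andbT mulr_ge0// ltW// s_gt0.
  apply: ler_sum => i _.
  have -> : (wk (k + Posz i.+1))^-1 * (H * r ^+ i.+1) * vol1 ^ (k + Posz i.+1) =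
      H * r ^+ i.+1 * sphere_mass (k + Posz i.+1) by rewrite /sphere_mass; ring.
  have -> : H * Cb * r * s ^ (k + 1) * (r * s) ^+ i = H * r ^+ i.+1 * (Cb * s ^ (k + Posz i.+1)).
    rewrite exprMn exprS sS; ring.
  by rewrite ler_wpM2l// mulr_ge0// exprn_ge0.
- move=> y _; rewrite /=.
  case: (leP (norm y) (pR ^ k)) => yk.
    rewrite (h0 _ yk) mul0r; under eq_fun do
      (rewrite big1; last by move=> i _; rewrite /psi (h0 _ yk) !mulr0 subrr mulr0).
    exact: cvg_cst.
  have y0 : y != 0 by apply: contraTneq yk => ->; rewrite padicn_norm0 -leNgt ltW// ppow_gt0.
  have [m ym] := padicn_norm_exp y0; rewrite ym ppow_lt// in yk.
  have [j mE] : exists j : nat, m = k + Posz j.+1.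
    exists (absz (m - k - 1)%R); rewrite intS gez0_abs; first by ring.
    by rewrite -addrA -opprD subr_ge0 lezD1.
  apply: cvg_near_cst; exists j.+1 => // N /= jN.
  have psiE i : psi i y = if i == j then h y / w y else 0.
    rewrite /psi (wE ym) -mulrBl /pball ym !(ppow_le _ pP) mE !lerD2l !lez_nat ltnS.
    case: (ltngtP i j) => [ij|ij|->]; first by rewrite subrr mul0r mulr0.
    - by rewrite subrr mul0r mulr0.
    - by rewrite subr0 mul1r mulrC.
  rewrite (bigD1 (Ordinal jN))//= psiE eqxx big1 ?addr0// => i ij.
  by rewrite psiE; case: eqP => // ij'; case/eqP: ij; exact/val_inj.
- exact: cS.
Qed.

(** The value of the symbol on the frequencies of absolute value p ^ (- k): its
    series runs over the spheres of radius greater than p ^ k, and only the first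
    of them sees the oscillation of the character. *)
Definition symbol_term (k : int) (i : nat) : R :=
  if i is 0%N then sphere_mass (k + 1)
  else (1 - vol1^-1) * sphere_mass (k + Posz i.+1).

Definition symbol (k : int) : R := limn (fun N => \sum_(i < N) symbol_term k i).

Lemma vol1_ge1 : 1 <= vol1. Proof. by rewrite exprn_ege1// ltW// p_gt1. Qed.

Lemma symbol_term_bound (k : int) i : 0 <= symbol_term k i <= Cb * s ^ (k + 1) * s ^+ i.
Proof.
have E : Cb * s ^ (k + 1) * s ^+ i = Cb * s ^ (k + Posz i.+1).
  by rewrite [in RHS]sS mulrA.
have v0 : 0 <= vol1^-1 by rewrite invr_ge0 ltW// vol1_gt0.
rewrite E; case: i {E} => [|i] /=.
  by rewrite (ltW (sphere_mass_gt0 _)) mass_le.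
have v1 : vol1^-1 <= 1 by rewrite invf_le1 ?vol1_gt0// vol1_ge1.
rewrite mulr_ge0 ?subr_ge0 ?(ltW (sphere_mass_gt0 _))//=.
by apply: le_trans (mass_le _); rewrite ler_piMl ?(ltW (sphere_mass_gt0 _))// lerBlDr lerDl.
Qed.

Let s_le : 0 <= s < 1. Proof. by case/andP: s01 => /ltW -> ->. Qed.

Lemma symbol_term_norm (k : int) i : `|symbol_term k i| <= Cb * s ^ (k + 1) * s ^+ i.
Proof. by have /andP[a b] := symbol_term_bound k i; rewrite ger0_norm. Qed.

Lemma symbol_cvg (k : int) : \sum_(i < N) symbol_term k i @[N --> \oo] --> symbol k.
Proof. exact: (geo_cvg s_le (symbol_term_norm k)). Qed.

(** Both series run over the same spheres, apart from the first one. *)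
Lemma symbol_step (k : int) :
  symbol k - symbol (k + 1) = sphere_mass (k + 1) - vol1^-1 * sphere_mass (k + 2).
Proof.
have H N : \sum_(i < N.+2) symbol_term k i =
    sphere_mass (k + 1) - vol1^-1 * sphere_mass (k + 2) + \sum_(i < N.+1) symbol_term (k + 1) i.
  elim: N => [|N IH].
    rewrite !big_ord_recr !big_ord0 /= !add0r -addrA; congr (_ + _).
    have -> : k + 1 + 1 = k + 2 by rewrite -addrA.
    have -> : k + Posz 2 = k + 2 by []. ring.
  have E : symbol_term k N.+2 = symbol_term (k + 1) N.+1.
    by rewrite /= [Posz N.+3]intS addrA.
  by rewrite [LHS]sum_recr [in RHS]sum_recr IH [RHS]addrA E.
apply/eqP; rewrite subr_eq; apply/eqP.
have c1 : \sum_(i < N.+2) symbol_term k i @[N --> \oo] --> symbol k.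
  by have := @symbol_cvg k; rewrite -(cvg_shiftn 2); under eq_fun do rewrite addn2.
have c2 : \sum_(i < N.+2) symbol_term k i @[N --> \oo] -->
    sphere_mass (k + 1) - vol1^-1 * sphere_mass (k + 2) + symbol (k + 1).
  under eq_fun do rewrite H; apply: cvgD; first exact: cvg_cst.
  by have := @symbol_cvg (k + 1); rewrite -(cvg_shiftn 1); under eq_fun do rewrite addn1.
exact: cvg_unique c1 c2.
Qed.

Definition Ca : R := Cb / (1 - s) * s.

Lemma symbol_ge (k : int) : cb * s ^ (k + 1) <= symbol k.
Proof.
apply: le_trans (mass_ge _) _; apply: limr_ge; first exact: (geo_cvg s_le (symbol_term_norm k)).
exists 1%N => // N /= N1; rewrite -(prednK N1) big_ord_recl/= lerDl sumr_ge0// => i _.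
by have /andP[] := symbol_term_bound k (lift ord0 i).
Qed.

Lemma symbol_gt0 (k : int) : 0 < symbol k.
Proof. by apply: lt_le_trans (symbol_ge k); rewrite mulr_gt0// exprz_gt0// s_gt0. Qed.

Lemma symbol_le (k : int) : symbol k <= Ca * s ^ k.
Proof.
rewrite -[symbol k]ger0_norm ?(ltW (symbol_gt0 k))//.
apply: le_trans (geo_lim_le s_le (symbol_term_norm k)) _.
by rewrite /Ca expfzDr ?s_neq0// expr1z le_eqVlt; apply/orP; left; apply/eqP; ring.
Qed.

(** The character is 1 on the ball of radius p ^ k, and has integral 0 over all
    the larger balls. *)
Lemma symbol_integral (xi : V) (k : int) : norm xi = pR ^ (- k) ->
  hasint (fun y => (1 - cos (char_arg (- padicn_dot y xi))) / w y) (symbol k) /\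
  hasint (fun y => (0 - sin (char_arg (- padicn_dot y xi))) / w y) 0.
Proof.
move=> xik.
have dE (y : V) : - padicn_dot y xi = padicn_dot (- xi) y.
  by rewrite padicn_dotC /padicn_dot -sumrN; apply: eq_bigr => i _; rewrite mxE mulNr.
have xiN : norm (- xi) <= pR ^ (- k) by rewrite padicn_normN xik.
have arg0 (y : V) : norm y <= pR ^ k -> char_arg (- padicn_dot y xi) = 0.
  move=> yk; rewrite dE char_arg0// (le_trans (padicn_dot_abs xiN yk))//.
  by rewrite -ppowD// addNr expr0z.
have pbE i : pball (- (k + Posz i)) (- xi) = (i == 0%N)%:R.
  by rewrite /pball padicn_normN xik (ppow_le _ pP) lerN2 gerDl lez_nat leqn0.
have rs : 1 * s < 1 by rewrite mul1r; case/andP: s01.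
split.
  apply: (@has_integral_radial k _ (fun i => vol1 ^ (k + Posz i) * (i != 0%N)%:R) 2 1 _ _ _ _ _ rs) => //.
  - by move=> y /arg0 ->; rewrite cos0 subrr.
  - move=> i; have [HC _] := char_ball_integral haar (- xi) (k + Posz i).
    have -> : vol1 ^ (k + Posz i) * (i != 0%N)%:R = vol1 ^ (k + Posz i) - vol1 ^ (k + Posz i) * pball (- (k + Posz i)) (- xi).
      by rewrite pbE; case: eqP => _ /=; ring.
    apply: eq_has_integral (has_integralB measurableT (pball_integral haar (k + Posz i)) HC) => // y _.
    by rewrite dE; ring.
  - move=> i y _; rewrite expr1n mulr1 (le_trans (ler_normB _ _))// normr1.
    by rewrite -[X in _ <= X]/(1 + 1 : R) lerD2l cos_max.
  have E (i : nat) : (vol1 ^ (k + Posz i.+1) * (i.+1 != 0%N)%:R - vol1 ^ (k + Posz i) * (i != 0%N)%:R) /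
      wk (k + Posz i.+1) = symbol_term k i.
    case: i => [|i] /=; first by rewrite mulr0 subr0 mulr1.
    rewrite !mulr1 /sphere_mass mulrA; congr (_ / _).
    rewrite mulrBl mul1r; congr (_ - _).
    rewrite [Posz i.+2]intS [1 + _]addrC addrA [X in _ = _ * X]expfzDr ?vol1_neq0//.
    by rewrite expr1z mulrCA mulVf ?vol1_neq0// mulr1.
  by under eq_fun do (under eq_bigr do rewrite E); exact: symbol_cvg.
apply: (@has_integral_radial k _ (fun i => 0) 1 1 _ _ _ _ _ rs) => //.
- by move=> y /arg0 ->; rewrite sin0 subrr.
- move=> i; have [_ HS] := char_ball_integral haar (- xi) (k + Posz i).
  have := has_integralZ measurableT (-1) HS; rewrite mulr0.
  by apply: eq_has_integral => // y _; rewrite dE; ring.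
- by move=> i y _; rewrite expr1n mulr1 sub0r normrN sin_max.
- by under eq_fun do (rewrite big1; last by move=> i _; rewrite subrr mul0r); exact: cvg_cst.
Qed.

(** Summation by parts of the sum over the spheres turns the weights of the
    spheres into the values of the symbol, by symbol_step. The boundary term is
    of the order of (r s) ^ N. *)
Lemma operator_integral (l : int) (g : V -> R) x (M r S : R) : lc l g ->
  0 <= M -> 1 <= r -> r * s < 1 ->
  (forall i z, norm (z - x) <= pR ^ (l + Posz i) -> `|g z| <= M * r ^+ i) ->
  \sum_(i < N) symbol (l + Posz i) * avgdiff l i g x @[N --> \oo] --> S ->
  hasint (fun y => (g (x - y) - g x) / w y) (- S).
Proof.
move=> gl M0 r1 rs gM cS; have r0 : 0 <= r by apply: le_trans r1.
have gx i : `|g x| <= M * r ^+ i by apply: gM; rewrite subrr padicn_norm0 ltW// ppow_gt0.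
pose m i := avg l i g x - g x.
have mM i : `|m i| <= 2 * M * r ^+ i.
  rewrite (le_trans (ler_normB _ _))// -mulrA mulr_natl mulr2n lerD//.
  by apply: avg_le => y; exact: gM.
apply: (@has_integral_radial l _ (fun i => vol1 ^ (l + Posz i) * m i) (2 * M) r _ _ _ _ r0 rs) => //.
- by move=> y yl; rewrite gl ?subrr// padicn_normN.
- move=> i; rewrite mulrBr.
  have H1 := avg_ball_integral_conv haar i x gl.
  have H2 := has_integralZ measurableT (g x) (pball_integral haar (l + Posz i)).
  rewrite [_ * g x]mulrC; apply: eq_has_integral (has_integralB measurableT H1 H2) => // y _; ring.
- by rewrite mulr_ge0.
- move=> i y yi; rewrite (le_trans (ler_normB _ _))// -mulrA mulr_natl mulr2n lerD//.
  by apply: gM; rewrite addrAC subrr add0r padicn_normN.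
pose b i := sphere_mass (l + Posz i + 1).
pose a i := symbol (l + Posz i).
have aS i : a i - a i.+1 = b i - vol1^-1 * b i.+1.
  by rewrite /a /b intS [1 + _]addrC addrA symbol_step -!addrA.
have E N : \sum_(i < N) (vol1 ^ (l + Posz i.+1) * m i.+1 - vol1 ^ (l + Posz i) * m i) / wk (l + Posz i.+1) =
    - (\sum_(i < N) a i * avgdiff l i g x) + (vol1^-1 * b N - a N) * m N.
  elim: N => [|N IH].
    by rewrite !big_ord0 /m avg0 subrr mulr0 oppr0 addr0.
  rewrite !big_ord_recr/= IH.
  have -> : (vol1 ^ (l + Posz N.+1) * m N.+1 - vol1 ^ (l + Posz N) * m N) / wk (l + Posz N.+1) =
      b N * m N.+1 - vol1^-1 * b N * m N.
    have lN : l + Posz N.+1 = l + Posz N + 1 by rewrite intS addrCA addrC.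
    rewrite /b /sphere_mass lN expfzDr ?vol1_neq0// expr1z; field.
    by rewrite (gt_eqF (wk_gt0 _)) vol1_neq0.
  have -> : avgdiff l N g x = m N - m N.+1 by rewrite /avgdiff /m; ring.
  have -> : b N = a N - a N.+1 + vol1^-1 * b N.+1 by rewrite aS; ring.
  ring.
under eq_fun do rewrite E.
rewrite -[- S]addr0; apply: cvgD; first exact: cvgN.
apply: (@geo_squeeze _ _ ((Cb * s ^ (l + 1) + Ca * s ^ l) * (2 * M)) (r * s)).
  by rewrite mulr_ge0//= ltW// s_gt0.
move=> i; rewrite normrM exprMn.
have -> : (Cb * s ^ (l + 1) + Ca * s ^ l) * (2 * M) * (r ^+ i * s ^+ i) =
   (Cb * s ^ (l + Posz i + 1) + Ca * s ^ (l + Posz i)) * (2 * M * r ^+ i).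
  rewrite -[l + Posz i + 1]addrA [Posz i + 1]addrC addrA !sD; ring.
apply: ler_pM => //; rewrite (le_trans (ler_normB _ _))// lerD//.
  rewrite ger0_norm; last by rewrite mulr_ge0 ?invr_ge0 ?(ltW vol1_gt0)// ltW// sphere_mass_gt0.
  apply: le_trans (mass_le _); rewrite ler_piMl ?(ltW (sphere_mass_gt0 _))//.
  by rewrite invf_le1 ?vol1_gt0// vol1_ge1.
by rewrite ger0_norm ?symbol_le// ltW// symbol_gt0.
Qed.

End radial_kernel.

(** * The heat kernel as a superposition of balls *)

Lemma expRN_le_pow (R : realType) (K : nat) (y : R) : 0 < y -> expR (- y) <= (K.+1%:R / y) ^+ K.+1.
Proof.
move=> y0; rewrite expRN -[y in X in X <= _](@divfK _ K.+1%:R)// mulrC expRM_natl.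
rewrite -exprVn lerXn2r// ?nnegrE ?invr_ge0 ?expR_ge0 ?divr_ge0 ?(ltW y0)//.
have yK : 0 < y / K.+1%:R by rewrite divr_gt0.
have -> : K.+1%:R / y = (y / K.+1%:R)^-1 by rewrite invf_div.
rewrite lef_pV2 ?posrE ?expR_gt0//.
by apply: le_trans (expR_ge1Dx _); rewrite lerDr.
Qed.

Lemma expR_sub1_le (R : realType) (y : R) : 0 <= y -> `|expR (- y) - 1| <= y.
Proof.
move=> y0; rewrite ler0_norm ?subr_le0 ?expR_le1 ?oppr_le0//.
by have := expR_ge1Dx (- y); lra.
Qed.

Section heat_kernel_real.
Variables (R : realType) (p : nat) (pP : prime p) (n : nat).
Local Notation V := 'rV[padic R pP]_n.
Local Notation pR := (p%:R : R).
Local Notation norm := (@padicn_norm R p pP n).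
Local Notation pball := (@pball R p pP n).
Local Notation vol1 := (pR ^+ n).
Local Notation B := (padicn_borel R pP n).
Variable mu : {measure set B -> \bar R}.
Hypothesis haar : is_haar mu.
Hypothesis n_gt0 : (0 < n)%N.
Local Notation hasint := (@has_integral _ B R mu setT).
Variables (a : int -> R) (ca Ca s tau : R).
Hypothesis s01 : 0 < s < 1.
Hypothesis ca_gt0 : 0 < ca.
Hypothesis a_ge : forall k, ca * s ^ k <= a k.
Hypothesis a_le : forall k, a k <= Ca * s ^ k.
Hypothesis tau_gt0 : 0 < tau.

Let s_gt0 : 0 < s. Proof. by case/andP: s01. Qed.
Let s_lt1 : s < 1. Proof. by case/andP: s01. Qed.
Let s_neq0 : s != 0. Proof. by rewrite gt_eqF. Qed.
Let sk_gt0 (k : int) : 0 < s ^ k. Proof. exact: exprz_gt0. Qed.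
Let v_gt0 : 0 < vol1. Proof. exact: vol1_gt0. Qed.
Let v_neq0 : vol1 != 0. Proof. by rewrite gt_eqF. Qed.
Let vk_gt0 (k : int) : 0 < vol1 ^ k. Proof. exact: exprz_gt0. Qed.

Lemma a_gt0 k : 0 < a k. Proof. by apply: lt_le_trans (a_ge k); rewrite mulr_gt0. Qed.
Lemma ta_ge0 k : 0 <= tau * a k. Proof. by rewrite mulr_ge0// ltW// a_gt0. Qed.

Definition decay (k : int) : R := expR (- (tau * a k)).

Lemma decay01 k : 0 <= decay k <= 1.
Proof. by rewrite expR_ge0/= expR_le1 oppr_le0 ta_ge0. Qed.

Lemma pball_le1 k (x : V) : pball k x <= 1.
Proof. by rewrite /pball -[X in _ <= X]/(1%:R : R) ler_nat leq_b1. Qed.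

Lemma decay_ge0 k : 0 <= decay k. Proof. by have /andP[] := decay01 k. Qed.
Lemma decay_sub1 (k : int) : `|decay k - 1| <= tau * Ca * s ^ k.
Proof.
rewrite (le_trans (expR_sub1_le (ta_ge0 k)))// -mulrA ler_wpM2l//.
by rewrite ltW.
Qed.

(** The values of the symbol grow geometrically at high frequencies, so that
    decay beats the volume of the dual balls, which is what makes the integral
    defining the kernel converge. *)
Lemma decay_high_le (l : int) : exists q C : R, 0 <= q < 1 /\
  forall i : nat, decay (l - Posz i) * vol1 ^+ i <= C * q ^+ i.
Proof.
have [K sK] : exists K, s ^+ K.+1 * vol1 < 2^-1.
  have : s ^+ K.+1 * vol1 @[K --> \oo] --> (0 : R).
    rewrite -[X in _ --> X](mul0r vol1); apply: cvgM; last exact: cvg_cst.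
    have : s ^+ K @[K --> \oo] --> (0 : R) by apply: cvg_expr; rewrite ger0_norm// ltW.
    by rewrite -(cvg_shiftn 1); under eq_fun do rewrite addn1.
  have h0 : 0 < 2^-1 :> R by rewrite invr_gt0.
  by move=> /cvgr_lt /(_ _ h0) /(@filter_ex _ \oo _) [K HK]; exists K.
pose D := K.+1%:R / (tau * (ca * s ^ l)).
have D0 : 0 < D by rewrite divr_gt0// !mulr_gt0.
exists (s ^+ K.+1 * vol1), (D ^+ K.+1).
have sK0 : 0 <= s ^+ K.+1 * vol1 by rewrite mulr_ge0 ?exprn_ge0// ltW.
split; first by rewrite sK0 (lt_trans sK)// invf_lt1// ltr1n.
move=> i; rewrite [(_ * vol1) ^+ i]exprMn mulrA ler_wpM2r ?exprn_ge0// ?(ltW v_gt0)//.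
have y0 : 0 < tau * (ca * s ^ (l - Posz i)) by rewrite !mulr_gt0.
apply: (@le_trans _ _ (expR (- (tau * (ca * s ^ (l - Posz i)))))).
  by rewrite ler_expR lerN2 ler_pM2l.
rewrite (le_trans (expRN_le_pow K y0))// -exprM mulnC exprM -exprMn.
have h1 : 0 < K.+1%:R / (tau * (ca * s ^ (l - Posz i))) by rewrite divr_gt0.
have h2 : 0 < D * s ^+ i by rewrite mulr_gt0 ?exprn_gt0.
rewrite lerXn2r ?nnegrE ?(ltW h1) ?(ltW h2)//.
rewrite expfzDr// -exprnN /D le_eqVlt; apply/orP; left; apply/eqP.
by field; rewrite !(gt_eqF, exprn_gt0, mulr_gt0).
Qed.

(** The masses of the balls of radius p ^ (l - i) and p ^ (l + i + 1) in the heat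
    kernel at time tau. Splitting the radii at p ^ l turns a sum over all the
    integers into sums over the natural numbers, and puts together the balls that
    cannot be told from points by a function constant on balls of radius p ^ l. *)
Definition lowmass (l : int) (i : nat) := decay (l - Posz i) - decay (l - Posz i.+1).
Definition highmass (l : int) (i : nat) := decay (l + Posz i.+1) - decay (l + Posz i).

Definition kernel_term (l : int) (i : nat) (x : V) : R :=
  lowmass l i * vol1 ^ (- (l - Posz i)) * pball (l - Posz i) x +
  highmass l i * vol1 ^ (- (l + Posz i.+1)) * pball (l + Posz i.+1) x.

Definition kernel (l : int) (x : V) : R := limn (fun N => \sum_(i < N) kernel_term l i x).

Lemma lowmass_bound (l : int) : exists q C : R, 0 <= q < 1 /\
  forall i : nat, `|lowmass l i| * vol1 ^+ i <= C * q ^+ i.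
Proof.
have [q [C [q01 HC]]] := decay_high_le l; have [q0 q1] := andP q01.
have C0 : 0 <= C.
  have := HC 0%N; rewrite !expr0 !mulr1; apply: le_trans.
  by have /andP[] := decay01 (l - 0%Z).
exists q, (C + C); split => // i; rewrite mulrDl.
apply: (@le_trans _ _ ((decay (l - Posz i) + decay (l - Posz i.+1)) * vol1 ^+ i)).
  rewrite ler_wpM2r ?exprn_ge0 ?(ltW v_gt0)// (le_trans (ler_normB _ _))//.
  by rewrite !ger0_norm// decay_ge0.
rewrite mulrDl lerD//; have d0 : 0 <= decay (l - Posz i.+1) by have /andP[] := decay01 (l - Posz i.+1).
apply: (@le_trans _ _ (decay (l - Posz i.+1) * vol1 ^+ i.+1)).
  rewrite ler_wpM2l// exprS ler_peMl ?exprn_ge0 ?(ltW v_gt0)//.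
  exact: vol1_ge1.
rewrite (le_trans (HC _))// exprS mulrCA ler_piMl ?mulr_ge0 ?exprn_ge0//.
exact: ltW.
Qed.

Lemma highmass_le (l : int) (i : nat) : `|highmass l i| <= 2 * (tau * Ca * s ^ l) * s ^+ i.
Proof.
have -> : highmass l i = (decay (l + Posz i.+1) - 1) - (decay (l + Posz i) - 1).
  by rewrite /highmass; ring.
have h := decay_sub1 (l + Posz i); have h' := decay_sub1 (l + Posz i.+1).
have E j : tau * Ca * s ^ (l + Posz j) = tau * Ca * s ^ l * s ^+ j.
  by rewrite expfzDr// mulrA.
rewrite (le_trans (ler_normB _ _))// -mulrA mulr_natl mulr2n lerD//; last by rewrite -E.
rewrite (le_trans h')// E exprS mulrCA ler_piMl ?(ltW s_lt1)//.
by rewrite -E (le_trans (normr_ge0 _) h).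
Qed.

Lemma highmass_le1 (l : int) (i : nat) : `|highmass l i| <= 1.
Proof.
have /andP[a0 a1] := decay01 (l + Posz i); have /andP[b0 b1] := decay01 (l + Posz i.+1).
by rewrite /highmass ler_norml; apply/andP; split; lra.
Qed.

Lemma highmass_sum_bound (l : int) (F : nat -> R) (M r : R) N : 0 <= M -> 0 <= r -> r * s < 1 ->
  (forall i, 0 <= F i <= M * r ^+ i) ->
  \sum_(i < N) `|highmass l i| * F i <= 2 * (tau * Ca * s ^ l) * M / (1 - r * s).
Proof.
move=> M0 r0 rs HF.
have t0 : 0 <= 2 * (tau * Ca * s ^ l).
  have := le_trans (normr_ge0 _) (highmass_le l 0); by rewrite expr0 mulr1.
apply: le_trans (geo_sum_le N _ _); last 2 first.
- exact: mulr_ge0.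
- by rewrite rs andbT mulr_ge0// ltW.
apply: ler_sum => i _; have /andP[F0 F1] := HF i.
have -> : 2 * (tau * Ca * s ^ l) * M * (r * s) ^+ i = 2 * (tau * Ca * s ^ l) * s ^+ i * (M * r ^+ i).
  by rewrite exprMn; ring.
by apply: ler_pM => //; exact: highmass_le.
Qed.

Lemma lowmass_sum_bound (l : int) : exists K, forall N, \sum_(i < N) `|lowmass l i| * vol1 ^+ i <= K.
Proof.
have [q [C [q01 HC]]] := lowmass_bound l; have [q0 q1] := andP q01.
have C0 : 0 <= C.
  have := HC 0%N; rewrite !expr0 !mulr1; apply: le_trans; exact: normr_ge0.
exists (C / (1 - q)) => N; apply: le_trans (geo_sum_le N C0 q01).
by apply: ler_sum => i _; exact: HC.
Qed.

Lemma telescope_masses (l : int) (F : int -> R) N :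
  \sum_(i < N) ((F (l - Posz i) - F (l - Posz i.+1)) + (F (l + Posz i.+1) - F (l + Posz i))) =
  F (l + Posz N) - F (l - Posz N).
Proof.
elim: N => [|N IH]; first by rewrite big_ord0 oppr0 subrr.
by rewrite big_ord_recr/= IH; ring.
Qed.

Lemma decay_low_cvg (l : int) : decay (l + Posz N) @[N --> \oo] --> (1 : R).
Proof.
apply/subr_cvg0; apply: (@geo_squeeze _ _ (tau * Ca * s ^ l) s).
  by rewrite (ltW s_gt0).
move=> i; have := decay_sub1 (l + Posz i).
by rewrite expfzDr// mulrA.
Qed.

Lemma decay_high_cvg (l : int) : decay (l - Posz N) @[N --> \oo] --> (0 : R).
Proof.
have [q [C [q01 HC]]] := decay_high_le l.
apply: (@geo_squeeze _ _ C q) => // i.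
have /andP[d0 _] := decay01 (l - Posz i); rewrite ger0_norm//.
apply: le_trans (HC i); rewrite ler_peMr// exprn_ege1//.
exact: vol1_ge1.
Qed.

Lemma kernel_cvg (l : int) (x : V) : \sum_(i < N) kernel_term l i x @[N --> \oo] --> kernel l x.
Proof.
suff H : cvgn (fun N => \sum_(i < N) kernel_term l i x) by exact: H.
have [q [C [q01 HC]]] := lowmass_bound l.
under eq_fun do rewrite /kernel_term big_split/=.
apply: is_cvgD.
  apply: (@geo_cvg _ (fun i => lowmass l i * vol1 ^ (- (l - Posz i)) * pball (l - Posz i) x) (vol1 ^ (- l) * C) q) => // i.
  rewrite normrM [`|pball _ _|]ger0_norm ?pball_ge0//; apply: (@le_trans _ _ `|lowmass l i * vol1 ^ (- (l - Posz i))|).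
    by rewrite ler_piMr// pball_le1.
  rewrite normrM opprB addrC [`|vol1 ^ _|]ger0_norm ?(ltW (vk_gt0 _))//.
  by rewrite expfzDr// mulrCA -mulrA ler_wpM2l// ltW.
apply: (@geo_cvg _ (fun i => highmass l i * vol1 ^ (- (l + Posz i.+1)) * pball (l + Posz i.+1) x) (vol1 ^ (- (l + 1))) (vol1^-1)).
  rewrite invr_ge0 (ltW v_gt0)/= invf_lt1//.
  by rewrite exprn_egt1 ?p_gt1// -lt0n.
move=> i; rewrite normrM [`|pball _ _|]ger0_norm ?pball_ge0//.
apply: (@le_trans _ _ `|highmass l i * vol1 ^ (- (l + Posz i.+1))|).
  by rewrite ler_piMr// pball_le1.
rewrite normrM [`|vol1 ^ _|]ger0_norm ?(ltW (vk_gt0 _))//.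
have -> : vol1 ^ (- (l + 1)) * vol1^-1 ^+ i = vol1 ^ (- (l + Posz i.+1)).
  rewrite intS addrA [X in _ = _ ^ X]opprD [RHS]expfzDr//; congr (_ * _).
  by rewrite -exprnN exprVn.
by rewrite ler_piMl ?highmass_le1// ltW.
Qed.

Section fourier.
Variable A : V -> R.
Hypothesis A0 : A 0 = 0.
Hypothesis AE : forall (xi : V) (k : int), norm xi = pR ^ (- k) -> A xi = a k.

(** For a frequency of absolute value p ^ - k, the dual balls that contain it are
    those with exponent at most k, and their masses telescope to decay k; the
    frequency 0 belongs to all of them and gets the total mass 1. *)
Lemma kernel_term_freq (l : int) (xi : V) :
  \sum_(i < N) (lowmass l i * pball (- (l - Posz i)) xi +
     highmass l i * pball (- (l + Posz i.+1)) xi) @[N --> \oo] --> expR (- (tau * A xi)).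
Proof.
have [->|xi0] := eqVneq xi 0.
  have E i : lowmass l i * pball (- (l - Posz i)) 0 + highmass l i * pball (- (l + Posz i.+1)) 0 =
     (decay (l - Posz i) - decay (l - Posz i.+1)) + (decay (l + Posz i.+1) - decay (l + Posz i)).
    by rewrite /pball padicn_norm0 !(ltW (ppow_gt0 R pP _)) !mulr1.
  under eq_fun do (under eq_bigr do rewrite E; rewrite telescope_masses).
  have H := cvgB (@decay_low_cvg l) (@decay_high_cvg l); rewrite subr0 in H.
  by rewrite A0 mulr0 oppr0 expR0; exact: H.
have [m xim] := padicn_norm_exp xi0.
pose k := - m; have xik : norm xi = pR ^ (- k) by rewrite opprK.
rewrite (AE xik).
pose F (j : int) := if j <= k then decay j else decay k.
have Fk j : (F j - F (j - 1)) = (decay j - decay (j - 1)) * (j <= k)%R%:R.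
  rewrite /F; have jj : j - 1 <= j by rewrite gerBl.
  case: (leP j k) => jk; first by rewrite (le_trans jj jk) mulr1.
  rewrite mulr0; case: ifP => [jk'|_]; last by rewrite subrr.
  have -> : j - 1 = k.
    by apply/eqP; rewrite eq_le jk'/= lerBrDr lezD1.
  by rewrite subrr.
have E i : lowmass l i * pball (- (l - Posz i)) xi + highmass l i * pball (- (l + Posz i.+1)) xi =
     (F (l - Posz i) - F (l - Posz i.+1)) + (F (l + Posz i.+1) - F (l + Posz i)).
  have e1 : l - Posz i.+1 = l - Posz i - 1 by rewrite intS; ring.
  have e2 : l + Posz i = l + Posz i.+1 - 1 by rewrite intS; ring.
  rewrite /lowmass /highmass /pball xik !(ppow_le _ pP) !lerN2.
  by rewrite e1 [in RHS]e2 !Fk -e1 -e2.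
under eq_fun do (under eq_bigr do rewrite E; rewrite telescope_masses).
have H1 : F (l + Posz N) @[N --> \oo] --> decay k.
  apply: cvg_near_cst; exists (absz (k - l)%R) => // N /= HN.
  rewrite /F; case: leP => // kN; congr decay.
  by apply/eqP; rewrite eq_le kN/= -lerBlDl (le_trans (lez_abs _))// lez_nat.
have H2 : F (l - Posz N) @[N --> \oo] --> (0 : R).
  apply: cvg_trans (@decay_high_cvg l); apply: near_eq_cvg.
  exists (absz (l - k)%R) => // N /= HN.
  by rewrite /F ifT// lerBlDr -lerBlDl (le_trans (lez_abs _))// lez_nat.
have H := cvgB H1 H2; rewrite subr0 in H; exact: H.
Qed.

(** The Fourier transform of the indicator function of a ball is a multiple of
    that of the dual ball, by char_ball_integral, and the superposition of balls
    may be integrated termwise. *)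
Lemma kernel_fourier (l : int) (x : V) :
  hasint (fun xi => expR (- (tau * A xi)) * cos (char_arg (padicn_dot x xi))) (kernel l x) /\
  hasint (fun xi => expR (- (tau * A xi)) * sin (char_arg (padicn_dot x xi))) 0.
Proof.
have [K HK] := lowmass_sum_bound l.
pose phi i (xi : V) := `|lowmass l i| * pball (- (l - Posz i)) xi + `|highmass l i| * pball (- (l + Posz i.+1)) xi.
have iphi i : hasint (phi i) (`|lowmass l i| * vol1 ^ (- (l - Posz i)) + `|highmass l i| * vol1 ^ (- (l + Posz i.+1))).
  by apply: has_integralD => //; apply: has_integralZ => //; exact: pball_integral.
have bphi N : \sum_(i < N) (`|lowmass l i| * vol1 ^ (- (l - Posz i)) + `|highmass l i| * vol1 ^ (- (l + Posz i.+1))) <=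
    vol1 ^ (- l) * K + 2 * (tau * Ca * s ^ l) * vol1 ^ (- l) / (1 - 1 * s).
  rewrite big_split/= lerD//.
    have -> : \sum_(i < N) `|lowmass l i| * vol1 ^ (- (l - Posz i)) = vol1 ^ (- l) * \sum_(i < N) `|lowmass l i| * vol1 ^+ i.
      by rewrite mulr_sumr; apply: eq_bigr => i _; rewrite opprB addrC expfzDr// mulrCA.
    by rewrite ler_wpM2l// ltW.
  apply: (@highmass_sum_bound l (fun i => vol1 ^ (- (l + Posz i.+1))) _ 1) => //; rewrite ?mul1r//; first exact: ltW.
  move=> i; rewrite (ltW (vk_gt0 _))/= expr1n mulr1 opprD expfzDr// ler_piMr ?(ltW (vk_gt0 _))//.
  by rewrite -exprnN -exprVn exprn_ile1 ?invr_ge0 ?(ltW v_gt0)// invf_le1// vol1_ge1.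
pose psi (F : R -> R) i (xi : V) := (lowmass l i * pball (- (l - Posz i)) xi +
     highmass l i * pball (- (l + Posz i.+1)) xi) * F (char_arg (padicn_dot x xi)).
have bpsi (F : R -> R) i xi : (forall y, `|F y| <= 1) -> `|psi F i xi| <= phi i xi.
  move=> F1; rewrite /psi /phi normrM; set A' := `|lowmass l i * _ + _|.
  apply: (@le_trans _ _ A'); first by rewrite ler_piMr ?F1 ?normr_ge0.
  rewrite (le_trans (ler_normD _ _))//.
  by rewrite !normrM !(ger0_norm (pball_ge0 _ _)).
have cpsi (F : R -> R) xi : \sum_(i < N) psi F i xi @[N --> \oo] -->
    expR (- (tau * A xi)) * F (char_arg (padicn_dot x xi)).
  under eq_fun do rewrite -mulr_suml.
  by apply: cvgM; [exact: kernel_term_freq|exact: cvg_cst].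
split.
  apply: (has_integral_series (T := B) measurableT (psi := psi (@cos R)) (phi := phi)
    (v := fun i => kernel_term l i x) _ iphi _ bphi) => //.
  - move=> i.
    have H1 := (char_ball_integral haar x (- (l - Posz i))).1.
    have H2 := (char_ball_integral haar x (- (l + Posz i.+1))).1.
    rewrite !opprK in H1 H2; rewrite /kernel_term -!mulrA.
    have H := has_integralD measurableT (has_integralZ measurableT (lowmass l i) H1)
      (has_integralZ measurableT (highmass l i) H2).
    by apply: eq_has_integral H => // xi _; rewrite /psi; ring.
  - by move=> i xi _; apply: bpsi => y; exact: cos_max.
  - exact: kernel_cvg.
apply: (has_integral_series (T := B) measurableT (psi := psi (@sin R)) (phi := phi)
    (v := fun i => 0) _ iphi _ bphi) => //.
- move=> i.
  have H1 := (char_ball_integral haar x (- (l - Posz i))).2.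
  have H2 := (char_ball_integral haar x (- (l + Posz i.+1))).2.
  have := has_integralD measurableT (has_integralZ measurableT (lowmass l i) H1)
      (has_integralZ measurableT (highmass l i) H2).
  rewrite !mulr0 addr0.
  by apply: eq_has_integral => // xi _; rewrite /psi; ring.
- by move=> i xi _; apply: bpsi => y; exact: sin_max.
- by under eq_fun do rewrite big1//; exact: cvg_cst.
Qed.

End fourier.

(** Convolution with the normalized indicator function of a ball is an average, and
    that of a ball of radius at most p ^ l leaves g unchanged. Summation by parts
    turns the masses of the balls into the decay factors of the frequencies, with
    boundary terms that vanish since 1 - decay is of the order of s ^ N. *)
Lemma kernel_conv (l : int) (g : V -> R) x (M r S : R) : lc l g ->
  0 <= M -> 1 <= r -> r * s < 1 ->
  (forall i z, norm (z - x) <= pR ^ (l + Posz i) -> `|g z| <= M * r ^+ i) ->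
  \sum_(i < N) (decay (l + Posz i) - 1) * avgdiff l i g x @[N --> \oo] --> S ->
  hasint (fun y : V => kernel l (x - y) * g y) (g x + S).
Proof.
move=> gl M0 r1 rs gM cS; have r0 : 0 <= r by apply: le_trans r1.
have [K HK] := lowmass_sum_bound l.
have gavg k (h : V -> R) : lc k h -> hasint (fun y : V => pball k (x - y) * h y) (vol1 ^ k * h x).
  by move=> hk; have := avg_ball_integral haar 0 x hk; rewrite addr0 avg0.
have bavg k : hasint (fun y : V => pball k (x - y)) (vol1 ^ k).
  have H := gavg k (fun=> 1) (fun _ _ _ => erefl); rewrite mulr1 in H.
  by apply: eq_has_integral H => // y _; rewrite mulr1.
have vV k : vol1 ^ (- k) * vol1 ^ k = 1 by rewrite -expfzDr// addNr.
pose psi i (y : V) := kernel_term l i (x - y) * g y.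
pose v i := lowmass l i * g x + highmass l i * avg l i.+1 g x.
pose phi i (y : V) := `|lowmass l i| * M * vol1 ^ (- (l - Posz i)) * pball (l - Posz i) (x - y) +
  `|highmass l i| * (M * r ^+ i.+1) * vol1 ^ (- (l + Posz i.+1)) * pball (l + Posz i.+1) (x - y).
apply: (has_integral_series (T := B) measurableT (psi := psi) (phi := phi) (v := v)
  (m := fun i => `|lowmass l i| * M + `|highmass l i| * (M * r ^+ i.+1))
  (K := M * K + 2 * (tau * Ca * s ^ l) * (M * r) / (1 - r * s))).
- move=> i.
  have lcl : lc (l - Posz i) g by apply: lc_le gl; rewrite // gerBl.
  have H1 := has_integralZ measurableT (lowmass l i * vol1 ^ (- (l - Posz i))) (gavg _ _ lcl).
  have H2 := has_integralZ measurableT (highmass l i * vol1 ^ (- (l + Posz i.+1)))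
    (avg_ball_integral haar i.+1 x gl).
  rewrite mulrA -[_ * _ * vol1 ^ _]mulrA vV mulr1 in H1.
  rewrite mulrA -[_ * _ * vol1 ^ _]mulrA vV mulr1 in H2.
  apply: eq_has_integral (has_integralD measurableT H1 H2) => // y _.
  by rewrite /psi /kernel_term; ring.
- move=> i; rewrite /phi; apply: has_integralD => //.
    have := has_integralZ measurableT (`|lowmass l i| * M * vol1 ^ (- (l - Posz i))) (bavg (l - Posz i)).
    by rewrite -(mulrA (`|lowmass l i| * M)) vV mulr1.
  have := has_integralZ measurableT (`|highmass l i| * (M * r ^+ i.+1) * vol1 ^ (- (l + Posz i.+1)))
    (bavg (l + Posz i.+1)).
  by rewrite -(mulrA (`|highmass l i| * (M * r ^+ i.+1))) vV mulr1.
- move=> i y _; rewrite /psi /phi /kernel_term mulrDl (le_trans (ler_normD _ _))//.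
  have bp k c W : 0 <= W -> (norm (y - x) <= pR ^ k -> `|g y| <= W) ->
      `|c * vol1 ^ (- k) * pball k (x - y) * g y| <= `|c| * W * vol1 ^ (- k) * pball k (x - y).
    move=> W0 gW; rewrite !normrM (ger0_norm (pball_ge0 _ _)) [`|vol1 ^ _|]ger0_norm ?(ltW (vk_gt0 _))//.
    rewrite /pball padicn_normB; case: (boolP (norm (y - x) <= _)) => yx.
      by rewrite !mulr1 mulrAC ler_wpM2r ?(ltW (vk_gt0 _))// ler_wpM2l// gW.
    by rewrite !mulr0 mul0r.
  apply: lerD; apply: bp => //; [|by rewrite mulr_ge0// exprn_ge0|exact: gM].
  move=> yx; have := @gM 0%N y; rewrite expr0 mulr1 addr0; apply.
  by rewrite (le_trans yx)// ppow_le// gerBl.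
- move=> N; rewrite big_split/= lerD//.
    rewrite -mulr_suml mulrC ler_wpM2l// (le_trans _ (HK N))//.
    apply: ler_sum => i _; rewrite ler_peMr// exprn_ege1//; exact: vol1_ge1.
  apply: (@highmass_sum_bound l (fun i => M * r ^+ i.+1) _ r) => //; first exact: mulr_ge0.
  by move=> i; rewrite exprS mulrA lexx andbT !mulr_ge0// exprn_ge0.
- move=> y _; rewrite /psi; under eq_fun do rewrite -mulr_suml.
  by apply: cvgM; [exact: kernel_cvg|exact: cvg_cst].
pose e i := decay (l + Posz i).
have E N : \sum_(i < N) v i = (g x + \sum_(i < N) (e i - 1) * avgdiff l i g x) +
    ((e N - 1) * avg l N g x - decay (l - Posz N) * g x).
  elim: N => [|N IH].
    by rewrite !big_ord0 /e oppr0 !addr0 avg0; ring.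
  rewrite !big_ord_recr/= IH /v /lowmass /highmass /avgdiff /e; ring.
have C1 : (e N - 1) * avg l N g x @[N --> \oo] --> (0 : R).
  apply: (@geo_squeeze _ _ (tau * Ca * s ^ l * M) (r * s)).
    by rewrite rs andbT mulr_ge0// ltW.
  move=> i; rewrite normrM exprMn.
  have -> : tau * Ca * s ^ l * M * (r ^+ i * s ^+ i) = tau * Ca * s ^ (l + Posz i) * (M * r ^+ i).
    by rewrite expfzDr// -exprnP; ring.
  apply: ler_pM => //; first exact: decay_sub1.
  by apply: avg_le => y; exact: gM.
have C2 : decay (l - Posz N) * g x @[N --> \oo] --> 0 * g x.
  by apply: cvgM; [exact: decay_high_cvg|exact: cvg_cst].
have C := cvgD (cvgD (cvg_cst (g x)) cS) (cvgB C1 C2).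
rewrite mul0r subr0 addr0 in C.
by under eq_fun do rewrite E; exact: C.
Qed.

End heat_kernel_real.

(** * Primitives and linear first order equations *)

Section primitives.
Variable R : realType.
Local Notation leb := (@lebesgue_measure R).
Implicit Types (h g : R -> R) (b t c d : R).

Lemma measurable_segment b t : measurable (`[b, t]%classic : set (measurableTypeR R)).
Proof. exact: measurable_itv. Qed.

Lemma continuous_integrable h b t : continuous h -> leb.-integrable `[b, t] (EFin \o h).
Proof.
move=> ch; apply: continuous_compact_integrable; first exact: segment_compact.
by apply: continuous_subspaceT => x; exact: ch.
Qed.

(** The two integrals make prim h a primitive of h on the whole line. *)
Definition prim h t : R := \int[leb]_(x in `[0, t]) h x - \int[leb]_(x in `[t, 0]) h x.

Lemma prim0 h : prim h 0 = 0. Proof. by rewrite /prim subrr. Qed.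

Lemma int_chasles h b t s : continuous h -> b <= t -> t <= s ->
  \int[leb]_(x in `[b, s]) h x = \int[leb]_(x in `[b, t]) h x + \int[leb]_(x in `[t, s]) h x.
Proof.
move=> ch bt ts; apply/eqP; rewrite addrC -subr_eq; apply/eqP.
rewrite Rintegral_itvB ?bnd_simp//; last exact: continuous_integrable.
rewrite Rintegral_itv_obnd_cbnd//.
by apply: integrableS (continuous_integrable t s ch) => //; exact: subset_itv_oc_cc.
Qed.

Lemma int_gt h b t : t <= b -> \int[leb]_(x in `[b, t]) h x = 0.
Proof.
rewrite le_eqVlt => /predU1P[->|tb]; first by rewrite set_itv1 Rintegral_set1.
by rewrite set_itv_ge ?Rintegral_set0// bnd_simp -ltNge.
Qed.

Lemma prim_shift h b t : continuous h -> b <= 0 -> b <= t ->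
  prim h t = \int[leb]_(x in `[b, t]) h x - \int[leb]_(x in `[b, 0]) h x.
Proof.
move=> ch b0 bt; rewrite /prim; have [t0|t0] := leP 0 t.
  by rewrite (int_gt _ t0) (int_chasles ch b0 t0) subr0; ring.
by rewrite (int_gt _ (ltW t0)) (int_chasles ch bt (ltW t0)) sub0r; ring.
Qed.

Lemma prim_is_derive h t : continuous h -> is_derive t 1 (prim h) (h t).
Proof.
move=> ch; pose b := Num.min 0 t - 1.
have b0 : b < 0 by rewrite ltrBlDr add0r gt_min ltr01.
have bt : b < t by rewrite ltrBlDr gt_min ltrDl ltr01 orbT.
pose F (x : R) := \int[leb]_(y in `[b, x]) h y.
have [dF F'] : derivable F t 1 /\ derive1 F t = h t.
  apply: (@continuous_FTC1_closed _ h b t (t + 1)) => //; first by rewrite ltrDl.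
  - exact: continuous_integrable.
  - exact: ch.
have dF1 : is_derive t 1 F (h t).
  by rewrite -F' derive1E; exact: derivableP.
have dG : is_derive t 1 (fun x => F x - F 0) (h t).
  have := @is_deriveB R R R F (cst (F 0)) t 1 _ _ dF1 (is_derive_cst _ _ _).
  by rewrite subr0.
apply: near_eq_is_derive dG => //.
near=> x; rewrite (prim_shift ch (ltW b0))//.
by apply: ltW; near: x; exact: lt_nbhsr.
Unshelve. all: by end_near. Qed.

Lemma prim_continuous h : continuous h -> continuous (prim h).
Proof.
move=> ch t; apply/differentiable_continuous/derivable1_diffP.
by have [] := prim_is_derive t ch.
Qed.

Lemma prim_integral h t : continuous h -> 0 <= t -> has_integral leb `[0, t] h (prim h t).
Proof.
move=> ch t0; have : leb.-integrable `[0, t] (EFin \o h) by exact: continuous_integrable.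
move=> /(integrable_has_integral (measurable_segment _ _)).
by rewrite /prim (int_gt h t0) subr0.
Qed.

Lemma has_integral_cst_itv t c : 0 <= t -> has_integral leb `[0, t] (fun=> c) (c * t).
Proof.
move=> t0; split.
  by apply: continuous_integrable => x; exact: cvg_cst.
rewrite integral_cst//= lebesgue_measure_itv/= lte_fin.
case: ltP => [_|t0']; first by rewrite oppr0 adde0.
have -> : t = 0 by apply/eqP; rewrite eq_le t0 t0'.
by rewrite mule0 mulr0.
Qed.

Lemma has_integral_bound h t v (G : R) : 0 <= t -> has_integral leb `[0, t] h v ->
  (forall x : R, 0 <= x <= t -> `|h x| <= G) -> `|v| <= G * t.
Proof.
move=> t0 hv hG; rewrite ler_norml; apply/andP; split.
  rewrite -mulNr; apply: (has_integral_le (measurable_segment _ _) _ (has_integral_cst_itv (- G) t0) hv).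
  by move=> x /=; rewrite in_itv/= => /hG; rewrite ler_norml => /andP[].
apply: (has_integral_le (measurable_segment _ _) _ hv (has_integral_cst_itv G t0)).
by move=> x /=; rewrite in_itv/= => /hG; rewrite ler_norml => /andP[].
Qed.

(** The solution of y' = - c y + g with initial value d. *)
Definition relax c d g t : R := expR (- (c * t)) * (d + prim (fun s => expR (c * s) * g s) t).

Lemma continuous_expR_lin c : continuous (fun s : R => expR (c * s)).
Proof.
move=> s; apply: (@continuous_comp _ _ _ (fun s => c * s) expR).
  exact: mulrl_continuous.
exact: continuous_expR.
Qed.

Lemma continuous_expR_mul c g : continuous g -> continuous (fun s => expR (c * s) * g s).
Proof. by move=> cg s; apply: cvgM; [exact: continuous_expR_lin|exact: cg]. Qed.

Lemma is_derive_expR_lin c t : is_derive t 1 (fun s => expR (- (c * s))) (- c * expR (- (c * t))).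
Proof.
have H : is_derive t 1 (fun s : R => (- c) * s) (- c).
  have := @is_deriveZ R R R id (- c) t 1 1 (is_derive_id _ _).
  by rewrite /GRing.scale/= mulr1.
have -> : (fun s => expR (- (c * s))) = expR \o (fun s => - c * s).
  by apply/funext => s /=; rewrite mulNr.
rewrite mulrC -mulNr; exact: (is_derive1_comp (is_derive_expR _) H).
Qed.

Lemma relax_is_derive c d g t : continuous g ->
  is_derive t 1 (relax c d g) (- c * relax c d g t + g t).
Proof.
move=> cg; have H1 := is_derive_expR_lin c t.
have H2 := prim_is_derive t (@continuous_expR_mul c g cg).
have H3 : is_derive t 1 (fun s => d + prim (fun s => expR (c * s) * g s) s) (expR (c * t) * g t).
  have := @is_deriveD R R R (cst d) (prim (fun s => expR (c * s) * g s)) t 1 _ _ (is_derive_cst _ _ _) H2.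
  by rewrite add0r.
apply: is_derive_eq (@is_deriveM _ _ _ _ _ _ _ _ H1 H3) _.
rewrite /GRing.scale/= /relax mulrA -expRD addNr expR0; ring.
Qed.

Lemma relax_continuous c d g : continuous g -> continuous (relax c d g).
Proof.
move=> cg t; apply/differentiable_continuous/derivable1_diffP.
by have [] := relax_is_derive c d t cg.
Qed.

Lemma relax0 c d g : relax c d g 0 = d.
Proof. by rewrite /relax prim0 mulr0 oppr0 expR0 mul1r addr0. Qed.

(** The differential equation in integrated form. *)
Lemma relax_prim c d g t : continuous g ->
  relax c d g t - d - prim g t = - c * prim (relax c d g) t.
Proof.
move=> cg; pose F s := relax c d g s - prim g s + c * prim (relax c d g) s.
have dF (s : R) : is_derive s 1 F 0.
  have H1 := relax_is_derive c d s cg; have H2 := prim_is_derive s cg.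
  have H3 := prim_is_derive s (@relax_continuous c d g cg).
  have H4 := @is_deriveZ R R R _ c s 1 _ H3.
  have H := is_deriveD (is_deriveB H1 H2) H4.
  apply: is_derive_eq H _; rewrite /GRing.scale/=; ring.
have := @is_derive_0_is_cst R F t 0 dF.
rewrite /F relax0 !prim0 mulr0 subr0 addr0 => H; rewrite -[X in _ - X - _]H; ring.
Qed.

Lemma relax_bound c d g t (G : R) : continuous g -> 0 <= c -> 0 <= t ->
  (forall s : R, 0 <= s <= t -> `|g s| <= G) -> `|relax c d g t| <= `|d| + G * t.
Proof.
move=> cg c0 t0 gG.
have E : relax c d g t = expR (- (c * t)) * d + expR (- (c * t)) * prim (fun s => expR (c * s) * g s) t.
  by rewrite /relax mulrDr.
rewrite E (le_trans (ler_normD _ _))// lerD//.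
  rewrite normrM ger0_norm ?expR_ge0// ler_piMl//.
  by rewrite expR_le1 oppr_le0 mulr_ge0.
have H := has_integralZ (measurable_segment 0 t) (expR (- (c * t)))
  (prim_integral (@continuous_expR_mul c g cg) t0).
apply: has_integral_bound H _ => // s /andP[s0 st].
rewrite mulrA -expRD normrM ger0_norm ?expR_ge0//.
apply: le_trans (gG s _); last by rewrite s0.
rewrite ler_piMl// expR_le1 addrC subr_le0 ler_wpM2l//.
Qed.

(** The contribution of one frequency to the difference between the inhomogeneous
    solution and the primitive of the inhomogeneity. *)
Lemma duhamel_integral c g t : continuous g -> 0 <= t ->
  has_integral leb `[0, t] (fun s => (expR (- (c * (t - s))) - 1) * g s)
    (relax c 0 g t - prim g t).
Proof.
move=> cg t0.
have H1 := has_integralZ (measurable_segment 0 t) (expR (- (c * t)))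
  (prim_integral (@continuous_expR_mul c g cg) t0).
rewrite /relax add0r.
apply: eq_has_integral (has_integralB (measurable_segment 0 t) H1 (prim_integral cg t0)).
  exact: measurable_segment.
move=> s _; have -> : - (c * (t - s)) = - (c * t) + c * s by ring.
rewrite expRD; ring.
Qed.

Lemma relax_split c d g t : relax c d g t = expR (- (c * t)) * d + relax c 0 g t.
Proof. by rewrite /relax; ring. Qed.

(** For the Duhamel integral, whose integrand involves the kernel at time 0 at the
    end of the interval. *)
Lemma has_integral_but_end h g t v : has_integral leb `[0, t] h v ->
  (forall s : R, 0 <= s < t -> h s = g s) -> has_integral leb `[0, t] g v.
Proof.
move=> hv hg; pose k : measurableTypeR R -> R := \1_[set t].
pose Dt : set R := `[0, t]%classic.
have k0 : (leb ([set t] `&` Dt) <= 0)%E.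
  rewrite -(lebesgue_measure_set1 t); apply: le_measure.
  - by rewrite inE; apply: measurableI => //; exact: measurable_segment.
  - by rewrite inE.
  - by move=> x [].
have kv : has_integral leb `[0, t] k 0.
  split; last by rewrite integral_indic//; apply/eqP; rewrite eq_le measure_ge0 k0.
  apply/integrableP; split; first exact/measurable_EFinP/measurable_indic.
  under eq_integral do rewrite /= ger0_norm//.
  by rewrite integral_indic// (le_lt_trans k0).
have := has_integralD (measurable_segment 0 t) hv (has_integralZ (measurable_segment 0 t) (g t - h t) kv).
rewrite mulr0 addr0; apply: eq_has_integral; first exact: measurable_segment.
move=> s /=; rewrite in_itv/= => /andP[s0]; rewrite le_eqVlt => /predU1P[->|st].
  by rewrite /k indicE mem_set//= mulr1 addrCA subrr addr0.
by rewrite /k indicE memNset ?mulr0 ?addr0 ?hg ?s0//= => sE; rewrite sE ltxx in st.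
Qed.

End primitives.

(** * The solution, frequency by frequency *)

Section uniform_series.
Variable R : realType.

Lemma sum_continuous (u : nat -> R -> R) N : (forall i, continuous (u i)) ->
  continuous (fun t => \sum_(i < N) u i t).
Proof.
move=> cu; elim: N => [|N IH].
  have -> : (fun t => \sum_(i < 0) u i t) = fun=> 0 by apply/funext => t; rewrite big_ord0.
  by move=> t; exact: cvg_cst.
have -> : (fun t => \sum_(i < N.+1) u i t) = fun t => \sum_(i < N) u i t + u N t.
  by apply/funext => t; rewrite big_ord_recr.
by move=> t; apply: cvgD; [exact: IH|exact: cu].
Qed.

Lemma geo_tail (u : nat -> R) C q N : 0 <= q < 1 -> (forall i, `|u i| <= C * q ^+ i) ->
  `|limn (fun M => \sum_(i < M) u i) - \sum_(i < N) u i| <= C / (1 - q) * q ^+ N.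
Proof.
move=> q01 uC; have [q0 q1] := andP q01.
have uN i : `|u (N + i)%N| <= C * q ^+ N * q ^+ i by rewrite -mulrA -exprD.
have := geo_lim_le q01 uN; rewrite mulrAC; apply: le_trans; rewrite le_eqVlt.
apply/orP; left; apply/eqP; congr `|_|.
apply/eqP; rewrite subr_eq addrC eq_sym; apply/eqP.
have E M : \sum_(i < M + N) u i = \sum_(i < N) u i + \sum_(i < M) u (N + i)%N.
  by rewrite addnC big_split_ord/=.
have c1 : \sum_(i < N) u i + \sum_(i < M) u (N + i)%N @[M --> \oo] -->
    \sum_(i < N) u i + limn (fun M => \sum_(i < M) u (N + i)%N).
  by apply: cvgD; [exact: cvg_cst|exact: geo_cvg q01 uN].
have c2 : \sum_(i < M + N) u i @[M --> \oo] --> limn (fun M => \sum_(i < M) u i).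
  have H : \sum_(i < M) u i @[M --> \oo] --> limn (fun M => \sum_(i < M) u i).
    exact: geo_cvg q01 uC.
  by rewrite -(cvg_shiftn N) in H.
have c3 : \sum_(i < M + N) u i @[M --> \oo] -->
    \sum_(i < N) u i + limn (fun M => \sum_(i < M) u (N + i)%N).
  by under eq_fun do rewrite E; exact: c1.
exact: cvg_unique c3 c2.
Qed.

Lemma uniform_series_continuous (u : nat -> R -> R) C q : 0 <= q < 1 ->
  (forall i, continuous (u i)) -> (forall i t, `|u i t| <= C * q ^+ i) ->
  continuous (fun t => limn (fun N => \sum_(i < N) u i t)).
Proof.
move=> q01 cu uC t; set L := fun t => limn _.
apply/cvgrPdist_le => e e0.
have e3 : 0 < e / 3 by rewrite divr_gt0.
have [N HN] : exists N, C / (1 - q) * q ^+ N <= e / 3.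
  have /cvgr_le /(_ _ e3) H := geo_cvg0 (C / (1 - q)) q01.
  by have [N HN] := filter_ex H; exists N.
have tail s : `|L s - \sum_(i < N) u i s| <= e / 3.
  exact: le_trans (geo_tail N q01 (fun i => uC i s)) HN.
have /cvgrPdist_le /(_ _ e3) := @sum_continuous u N cu t.
apply: filterS => s hs.
have -> : L t - L s = (L t - \sum_(i < N) u i t) + (\sum_(i < N) u i t - \sum_(i < N) u i s)
   - (L s - \sum_(i < N) u i s) by ring.
have t1 := tail t; have t2 := tail s.
rewrite (le_trans (ler_normB _ _))//.
have h1 : `|L t - \sum_(i < N) u i t + (\sum_(i < N) u i t - \sum_(i < N) u i s)| <= e / 3 + e / 3.
  by rewrite (le_trans (ler_normD _ _))// lerD.
by have := lerD h1 t2; lra.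
Qed.

End uniform_series.

Section solution.
Variables (R : realType) (p : nat) (pP : prime p) (n : nat).
Local Notation V := 'rV[padic R pP]_n.
Local Notation pR := (p%:R : R).
Local Notation norm := (@padicn_norm R p pP n).
Local Notation B := (padicn_borel R pP n).
Local Notation leb := (@lebesgue_measure R).
Variable mu : {measure set B -> \bar R}.
Hypothesis haar : is_haar mu.
Variables (l : int) (a : nat -> R) (A s r kappa T M : R) (K : V -> R).
Variables (phi : V -> R) (f : V -> R -> R).
Hypothesis a_ge0 : forall i, 0 <= a i.
Hypothesis a_le : forall i, a i <= A * s ^+ i.
Hypothesis s_ge0 : 0 <= s.
Hypothesis r_ge1 : 1 <= r.
Hypothesis rs_lt1 : r * s < 1.
Hypothesis kappa_gt0 : 0 < kappa.
Hypothesis T_gt0 : 0 < T.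
Hypothesis M_ge0 : 0 <= M.
Hypothesis K_ge0 : forall x, 0 <= K x.
Hypothesis K_ball : forall x i z, norm (z - x) <= pR ^ (l + Posz i) -> K z <= K x * r ^+ i.
Hypothesis phi_lc : lc l phi.
Hypothesis phi_le : forall z, `|phi z| <= M * K z.
Hypothesis f_lc : forall t, lc l (f ^~ t).
Hypothesis f_le : forall z t, `|f z t| <= M * K z.
Hypothesis f_cont : forall x, continuous (f x).

Implicit Types (x y z : V) (t : R) (i j : nat).

Let c i := kappa * a i.
Let c_ge0 i : 0 <= c i. Proof. by rewrite mulr_ge0// ltW. Qed.
Let r_ge0 : 0 <= r. Proof. exact: le_trans r_ge1. Qed.
Let rs01 : 0 <= r * s < 1. Proof. by rewrite rs_lt1 mulr_ge0. Qed.

(** The component of the inhomogeneity of absolute frequency p ^ - (l + i). *)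
Definition forcing i x t : R := avgdiff l i (f ^~ t) x.

(** The component of the solution of the same frequency. *)
Definition mode i x t : R := relax (c i) (avgdiff l i phi x) (forcing i x) t.

Lemma ball_bound (g : V -> R) x i : (forall z, `|g z| <= M * K z) ->
  forall z, norm (z - x) <= pR ^ (l + Posz i) -> `|g z| <= M * K x * r ^+ i.
Proof. by move=> gM z zx; rewrite (le_trans (gM z))// -mulrA ler_wpM2l// K_ball. Qed.

Lemma avgdiff_bound (g : V -> R) x i : (forall z, `|g z| <= M * K z) ->
  `|avgdiff l i g x| <= 2 * M * r * K x * r ^+ i.
Proof.
move=> gM; rewrite (le_trans (ler_normB _ _))//.
have h1 := avg_le (ball_bound (x := x) (i := i) gM).
have h2 := avg_le (ball_bound (x := x) (i := i.+1) gM).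
have MK : 0 <= M * K x * r ^+ i by rewrite !mulr_ge0// exprn_ge0.
rewrite exprS in h2.
have h3 : M * K x * r ^+ i <= M * K x * r ^+ i * r by rewrite ler_peMr.
lra.
Qed.

Lemma forcing_continuous i x : continuous (forcing i x).
Proof.
have H j : continuous (fun t => avg l j (f ^~ t) x).
  move=> t; rewrite /avg; apply: cvgM; first exact: cvg_cst.
  elim: (reps _ _ _ l j) => [|v vs IH].
    by under eq_fun do rewrite big_nil; rewrite big_nil; exact: cvg_cst.
  by under eq_fun do rewrite big_cons; rewrite big_cons; apply: cvgD => //; exact: f_cont.
by move=> t; apply: cvgB; exact: H.
Qed.

Lemma mode_continuous i x : continuous (mode i x).
Proof. exact/relax_continuous/forcing_continuous. Qed.

Lemma mode_bound i x t : 0 <= t <= T -> `|mode i x t| <= 2 * M * r * K x * (1 + T) * r ^+ i.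
Proof.
move=> /andP[t0 tT].
have h1 := @relax_bound R (c i) (avgdiff l i phi x) (forcing i x) t _
  (@forcing_continuous i x) (c_ge0 i) t0 (fun u _ => @avgdiff_bound (f ^~ u) x i (f_le ^~ u)).
have h2 := @avgdiff_bound phi x i phi_le.
have D0 : 0 <= 2 * M * r * K x * r ^+ i by rewrite !mulr_ge0// exprn_ge0.
have h3 : 2 * M * r * K x * r ^+ i * t <= 2 * M * r * K x * r ^+ i * T by rewrite ler_wpM2l.
rewrite (le_trans h1)//; lra.
Qed.

(** Extends a function of the time in [0, T] to the whole line, where continuity and
    derivatives are two-sided. *)
Definition clampT t := Num.max 0 (Num.min t T).

Lemma clampT_itv t : 0 <= clampT t <= T.
Proof. by rewrite /clampT le_max lexx/= ge_max (ltW T_gt0) ge_min lexx orbT. Qed.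

Lemma clampT_id t : 0 <= t <= T -> clampT t = t.
Proof. by move=> /andP[t0 tT]; rewrite /clampT min_l// max_r. Qed.

Lemma clampT_continuous : continuous clampT.
Proof.
move=> t; apply: (@continuous_max _ _ (fun=> 0) (fun t => Num.min t T)); first exact: cvg_cst.
by apply: (@continuous_min _ _ id (fun=> T)); [exact: cvg_id|exact: cvg_cst].
Qed.

(** This will be - kappa W u for the solution u. *)
Definition dissipation x t : R := limn (fun N => \sum_(i < N) c i * mode i x (clampT t)).

Let E x := kappa * A * (2 * M * r * K x * (1 + T)).

Lemma dissipation_term_bound i x t : 0 <= t <= T -> `|c i * mode i x t| <= E x * (r * s) ^+ i.
Proof.
move=> tT; rewrite normrM ger0_norm// /E exprMn.
have -> : kappa * A * (2 * M * r * K x * (1 + T)) * (r ^+ i * s ^+ i) =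
  kappa * (A * s ^+ i) * (2 * M * r * K x * (1 + T) * r ^+ i) by ring.
apply: ler_pM => //; last exact: mode_bound.
by rewrite ler_wpM2l// ltW.
Qed.

Lemma dissipation_continuous x : continuous (dissipation x).
Proof.
apply: (@uniform_series_continuous _ (fun i t => c i * mode i x (clampT t)) (E x) (r * s)) => //.
  move=> i t; apply: cvgM; first exact: cvg_cst.
  apply: continuous_comp; [exact: clampT_continuous|exact: mode_continuous].
by move=> i t; apply: dissipation_term_bound; exact: clampT_itv.
Qed.

(** The equation in integrated form serves as the definition of the solution, so
    that no series has to be differentiated. *)
Definition sol x t : R := phi x + prim (f x) t - prim (dissipation x) t.

Lemma sol0 x : sol x 0 = phi x.
Proof. by rewrite /sol !prim0 addr0 subr0. Qed.

Lemma sol_is_derive x t : is_derive t 1 (sol x) (f x t - dissipation x t).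
Proof.
have H1 := prim_is_derive t (@f_cont x).
have H2 := prim_is_derive t (@dissipation_continuous x).
have H3 := @is_deriveD R R R (cst (phi x)) (prim (f x)) t 1 _ _ (is_derive_cst _ _ _) H1.
have := @is_deriveB R R R _ _ t 1 _ _ H3 H2.
by rewrite add0r.
Qed.

Lemma sol_continuous x : continuous (sol x).
Proof.
move=> t; apply: cvgB; last exact/prim_continuous/dissipation_continuous.
by apply: cvgD; [exact: cvg_cst|exact/prim_continuous/f_cont].
Qed.

Lemma sol_lc t : lc l (sol ^~ t).
Proof.
move=> x x' x'l; rewrite /sol (phi_lc x x'l).
have -> : f (x + x') = f x by apply/funext => u; exact: (f_lc u).
suff -> : dissipation (x + x') = dissipation x by [].
apply/funext => u; rewrite /dissipation; congr (limn _); apply/funext => N.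
apply: eq_bigr => i _; congr (_ * _); rewrite /mode (@lc_avgdiff _ _ _ _ _ l i _ phi_lc x x' x'l).
by congr relax; apply/funext => v; rewrite /forcing (@lc_avgdiff _ _ _ _ _ l i _ (f_lc v) x x' x'l).
Qed.

Lemma dissipation_bound x t : `|dissipation x t| <= E x / (1 - r * s).
Proof.
apply: (@geo_lim_le _ (fun i => c i * mode i x (clampT t))) => // i.
apply: dissipation_term_bound; exact: clampT_itv.
Qed.

Lemma sol_bound x t : 0 <= t <= T ->
  `|sol x t| <= (M + M * T + kappa * A * (2 * M * r * (1 + T)) / (1 - r * s) * T) * K x.
Proof.
move=> /andP[t0 tT].
have h0 := phi_le x.
have h1 := has_integral_bound t0 (prim_integral (@f_cont x) t0) (fun u _ => f_le x u).
have h2 := has_integral_bound t0 (prim_integral (@dissipation_continuous x) t0)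
  (fun u _ => dissipation_bound x u).
have h3 : M * K x * t <= M * K x * T by rewrite ler_wpM2l// mulr_ge0.
have h4 : E x / (1 - r * s) * t <= E x / (1 - r * s) * T.
  by rewrite ler_wpM2l//; exact: le_trans (normr_ge0 _) (dissipation_bound x 0).
have -> : (M + M * T + kappa * A * (2 * M * r * (1 + T)) / (1 - r * s) * T) * K x =
   M * K x + M * K x * T + E x / (1 - r * s) * T by rewrite /E; ring.
rewrite /sol (le_trans (ler_normB _ _))// lerD//; last exact: le_trans h2 h4.
by rewrite (le_trans (ler_normD _ _))// lerD//; exact: le_trans h1 h3.
Qed.

(** What the i-th mode adds to phi + prim f, the solution without the operator. *)
Definition mode_defect i x t : R := - c i * prim (mode i x) t.

Lemma mode_defectE i x t :
  mode_defect i x t = mode i x t - avgdiff l i phi x - prim (forcing i x) t.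
Proof. by rewrite /mode_defect /mode -relax_prim//; exact: forcing_continuous. Qed.

Lemma mode_defect_cvg x t : 0 <= t <= T ->
  \sum_(i < N) mode_defect i x t @[N --> \oo] --> - prim (dissipation x) t.
Proof.
move=> /andP[t0 tT].
have bnd i : `|c i * prim (mode i x) t| <= E x * t * (r * s) ^+ i.
  have H := has_integralZ (measurable_segment 0 t) (c i) (prim_integral (@mode_continuous i x) t0).
  rewrite [X in _ <= X]mulrAC; apply: (has_integral_bound t0 H) => u /andP[u0 ut].
  by apply: dissipation_term_bound; rewrite u0 (le_trans ut).
have cv := geo_cvg rs01 bnd.
have H : has_integral leb `[0, t] (dissipation x) (limn (fun N => \sum_(i < N) c i * prim (mode i x) t)).
  apply: (has_integral_series (measurable_segment 0 t) (psi := fun i u => c i * mode i x u)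
    (phi := fun i u => E x * (r * s) ^+ i) (v := fun i => c i * prim (mode i x) t)
    (m := fun i => E x * (r * s) ^+ i * t) (K := E x * t / (1 - r * s))).
  - move=> i; apply: has_integralZ; first exact: measurable_segment.
    exact/prim_integral/t0/mode_continuous.
  - by move=> i; exact: has_integral_cst_itv.
  - move=> i u /=; rewrite in_itv/= => /andP[u0 ut]; apply: dissipation_term_bound.
    by rewrite u0 (le_trans ut).
  - move=> N; under eq_bigr do rewrite mulrAC; apply: geo_sum_le => //.
    have := le_trans (normr_ge0 _) (bnd 0%N); by rewrite expr0 mulr1.
  - move=> u /=; rewrite in_itv/= => /andP[u0 ut].
    have uT : 0 <= u <= T by rewrite u0 (le_trans ut).
    have := @geo_cvg _ (fun i => c i * mode i x u) (E x) (r * s) rs01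
      (fun i => dissipation_term_bound i x uT).
    by rewrite /dissipation clampT_id.
  - exact: cv.
have HE := has_integral_unique (prim_integral (@dissipation_continuous x) t0) H.
rewrite HE; under eq_fun do (under eq_bigr do rewrite /mode_defect mulNr; rewrite sumrN).
exact: cvgN.
Qed.

Lemma sol_series x t : 0 <= t <= T ->
  \sum_(i < N) mode_defect i x t @[N --> \oo] --> sol x t - phi x - prim (f x) t.
Proof.
move=> tT; have -> : sol x t - phi x - prim (f x) t = - prim (dissipation x) t by rewrite /sol; ring.
exact: mode_defect_cvg.
Qed.

Let memory i t y := relax (c i) 0 (forcing i y) t - prim (forcing i y) t.

(** The defect is the damping of the initial value plus the effect of the past of
    the inhomogeneity. *)
Lemma mode_defect_memory i x t :
  mode_defect i x t = (expR (- (c i * t)) - 1) * avgdiff l i phi x + memory i t x.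
Proof. by rewrite mode_defectE /mode relax_split /memory; ring. Qed.

Lemma avgdiff_prim i x t : 0 <= t ->
  avgdiff l i (fun y => prim (f y) t) x = prim (forcing i x) t.
Proof.
move=> t0; have H := avgdiff_has_integral l i x (measurable_segment 0 t)
  (fun y => prim_integral (@f_cont y) t0).
exact: has_integral_unique H (prim_integral (@forcing_continuous i x) t0).
Qed.

Lemma avgdiff_memory i j x t : 0 <= t ->
  avgdiff l i (memory j t) x = if i == j then memory i t x else 0.
Proof.
move=> t0; have H := avgdiff_has_integral l i x (measurable_segment 0 t)
  (fun y => duhamel_integral (c j) (@forcing_continuous j y) t0).
apply: has_integral_unique H _; case: eqP => [->|ij].
  apply: eq_has_integral (duhamel_integral (c j) (@forcing_continuous j x) t0).
    exact: measurable_segment.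
  by move=> u _; rewrite avgdiffZ /forcing (avgdiff_avgdiff haar)// eqxx.
apply: eq_has_integral (has_integral0 leb `[0, t]); first exact: measurable_segment.
move=> u _; rewrite avgdiffZ /forcing (avgdiff_avgdiff haar)//.
by case: eqP => //; rewrite mulr0.
Qed.

Lemma avgdiff_mode_defect i j x t : 0 <= t ->
  avgdiff l i (mode_defect j ^~ t) x = if i == j then mode_defect i x t else 0.
Proof.
move=> t0; have -> : mode_defect j ^~ t = fun y =>
    (expR (- (c j * t)) - 1) * avgdiff l j phi y + memory j t y.
  by apply/funext => y; exact: mode_defect_memory.
rewrite avgdiffD avgdiffZ (avgdiff_avgdiff haar)// avgdiff_memory//.
by case: eqP => [->|_]; [rewrite -mode_defect_memory|rewrite mulr0 addr0].
Qed.

(** The projection may be applied to the series of the modes termwise, being a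
    finite average, and it keeps only one of them. *)
Lemma avgdiff_sol i x t : 0 <= t <= T -> avgdiff l i (sol ^~ t) x = mode i x t.
Proof.
move=> tT; have [t0 _] := andP tT.
have S1 : avgdiff l i (fun y => \sum_(j < N) mode_defect j y t) x @[N --> \oo] -->
    avgdiff l i (fun y => sol y t - phi y - prim (f y) t) x.
  by apply: avgdiff_cvg => y; exact: sol_series.
have S2 : avgdiff l i (fun y => \sum_(j < N) mode_defect j y t) x @[N --> \oo] --> mode_defect i x t.
  apply: cvg_near_cst; exists i.+1 => // N /= iN.
  have -> : avgdiff l i (fun y => \sum_(j < N) mode_defect j y t) x =
      \sum_(j < N) avgdiff l i (mode_defect j ^~ t) x.
    elim: N {iN} => [|N IH].
      rewrite big_ord0 /avgdiff; under eq_fun do rewrite big_ord0.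
      by rewrite !avg_cst subrr.
    rewrite big_ord_recr/= -IH -avgdiffD; congr (avgdiff l i _ x).
    by apply/funext => y; rewrite big_ord_recr.
  under eq_bigr do rewrite avgdiff_mode_defect//.
  rewrite (bigD1 (Ordinal iN))//= eqxx big1 ?addr0// => j ij.
  by case: eqP => // ij'; case/eqP: ij; exact/val_inj.
have S3 := cvg_unique _ S1 S2; rewrite mode_defectE in S3.
have S4 : avgdiff l i (sol ^~ t) x = avgdiff l i (fun y => sol y t - phi y - prim (f y) t) x
    + avgdiff l i phi x + prim (forcing i x) t.
  rewrite -avgdiff_prim// -!avgdiffD; congr (avgdiff l i _ x).
  by apply/funext => y; ring.
by rewrite S4 S3//; ring.
Qed.

Lemma sol_operator x t : 0 <= t <= T ->
  \sum_(i < N) a i * avgdiff l i (sol ^~ t) x @[N --> \oo] --> kappa^-1 * dissipation x t.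
Proof.
move=> tT; under eq_fun do (under eq_bigr do rewrite avgdiff_sol//).
have H := @geo_cvg _ (fun i => c i * mode i x t) (E x) (r * s) rs01
  (fun i => dissipation_term_bound i x tT).
have EN N : \sum_(i < N) a i * mode i x t = kappa^-1 * \sum_(i < N) c i * mode i x t.
  rewrite mulr_sumr; apply: eq_bigr => i _; rewrite /c !mulrA mulVf ?mul1r//.
  by rewrite gt_eqF.
under eq_fun do rewrite EN; apply: cvgM; first exact: cvg_cst.
by rewrite /dissipation clampT_id.
Qed.

(** The sums S0 and h u are what convolution with the kernel adds to phi and to
    f(., u), so that the integral and the last equation are the representation of
    the solution by the kernel. The series of the modes splits into the part S0
    coming from phi and the series of the integrals of the terms of h, which is
    the integral of the series h. *)
Lemma sol_duhamel x t : 0 <= t <= T -> exists S0 h v,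
  [/\ \sum_(i < N) (expR (- (kappa * t * a i)) - 1) * avgdiff l i phi x @[N --> \oo] --> S0,
   forall u, 0 <= u <= t -> \sum_(i < N) (expR (- (kappa * (t - u) * a i)) - 1) *
      avgdiff l i (f ^~ u) x @[N --> \oo] --> h u,
   has_integral leb `[0, t] (fun u => f x u + h u) v & phi x + S0 + v = sol x t].
Proof.
move=> tT; have [t0 tT'] := andP tT.
pose F := kappa * T * A * (2 * M * r * K x).
have b1 (g : V -> R) i u : (forall z, `|g z| <= M * K z) -> 0 <= u <= T ->
    `|(expR (- (c i * u)) - 1) * avgdiff l i g x| <= F * (r * s) ^+ i.
  move=> gM /andP[u0 uT]; rewrite normrM exprMn.
  have -> : F * (r ^+ i * s ^+ i) = kappa * (A * s ^+ i) * T * (2 * M * r * K x * r ^+ i).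
    by rewrite /F; ring.
  apply: ler_pM => //; last exact: avgdiff_bound.
  apply: le_trans (expR_sub1_le _) _; first exact: mulr_ge0.
  by apply: ler_pM => //; rewrite /c ler_wpM2l// ltW.
have cE i u : kappa * u * a i = c i * u by rewrite /c mulrAC.
pose h u := limn (fun N => \sum_(i < N) (expR (- (c i * (t - u))) - 1) * avgdiff l i (f ^~ u) x).
have cS0 := geo_cvg rs01 (fun i => b1 phi i t phi_le tT).
have tu u : 0 <= u <= t -> 0 <= t - u <= T.
  by move=> /andP[u0 ut]; rewrite subr_ge0 ut/= lerBlDr (le_trans tT')// lerDl.
have ch u (ut : 0 <= u <= t) := geo_cvg rs01 (fun i => b1 (f ^~ u) i (t - u) (f_le ^~ u) (tu u ut)).
have F0 : 0 <= F.
  by have := le_trans (normr_ge0 _) (b1 phi 0%N t phi_le tT); rewrite expr0 mulr1.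
have bm i : `|memory i t x| <= F * t * (r * s) ^+ i.
  rewrite mulrAC; apply: (has_integral_bound t0 (duhamel_integral (c i) (@forcing_continuous i x) t0)).
  by move=> u ut; apply: b1 => //; exact: tu.
have cm := geo_cvg rs01 bm.
have H : has_integral leb `[0, t] h (limn (fun N => \sum_(i < N) memory i t x)).
  apply: (has_integral_series (measurable_segment 0 t)
    (psi := fun i u => (expR (- (c i * (t - u))) - 1) * avgdiff l i (f ^~ u) x)
    (phi := fun i u => F * (r * s) ^+ i) (v := fun i => memory i t x)
    (m := fun i => F * (r * s) ^+ i * t) (K := F * t / (1 - r * s))).
  - by move=> i; exact: (duhamel_integral (c i) (@forcing_continuous i x) t0).
  - by move=> i; exact: has_integral_cst_itv.
  - by move=> i u /=; rewrite in_itv/= => ut; apply: b1 => //; exact: tu.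
  - by move=> N; under eq_bigr do rewrite mulrAC; apply: geo_sum_le => //; rewrite mulr_ge0.
  - by move=> u /=; rewrite in_itv/= => ut; exact: ch.
  - exact: cm.
exists (limn (fun N => \sum_(i < N) (expR (- (c i * t)) - 1) * avgdiff l i phi x)), h,
  (prim (f x) t + limn (fun N => \sum_(i < N) memory i t x)); split.
- by under eq_fun do (under eq_bigr do rewrite cE); exact: cS0.
- by move=> u ut; under eq_fun do (under eq_bigr do rewrite cE); exact: ch.
- by apply: has_integralD => //; exact: prim_integral.
have H1 : \sum_(i < N) mode_defect i x t @[N --> \oo] -->
   limn (fun N => \sum_(i < N) (expR (- (c i * t)) - 1) * avgdiff l i phi x) +
   limn (fun N => \sum_(i < N) memory i t x).
  by under eq_fun do (under eq_bigr do rewrite mode_defect_memory; rewrite big_split/=); exact: cvgD.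
have H2 := cvg_unique _ H1 (@mode_defect_cvg x t tT).
by rewrite /sol addrACA H2// addrA.
Qed.

End solution.

(** * Real and imaginary parts *)

Section complex_parts.
Variable R : realType.
Local Notation C := R[i].
Implicit Types (z : C) (a : R).

Lemma complex_eq z z' : complex.Re z = complex.Re z' -> complex.Im z = complex.Im z' -> z = z'.
Proof. by case: z z' => [a b] [a' b'] /= -> ->. Qed.

Lemma Re_mulC a z : complex.Re (a%:C%C * z) = a * complex.Re z.
Proof. by case: z => x y /=; rewrite mul0r subr0. Qed.

Lemma Im_mulC a z : complex.Im (a%:C%C * z) = a * complex.Im z.
Proof. by case: z => x y /=; rewrite mul0r addr0. Qed.

Lemma Re_divC z a : complex.Re (z / a%:C%C) = complex.Re z / a.
Proof. by rewrite -fmorphV mulrC Re_mulC mulrC. Qed.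

Lemma Im_divC z a : complex.Im (z / a%:C%C) = complex.Im z / a.
Proof. by rewrite -fmorphV mulrC Im_mulC mulrC. Qed.

Lemma Re_sub z z' : complex.Re (z - z') = complex.Re z - complex.Re z'.
Proof. by case: z z' => [a b] [a' b']. Qed.

Lemma Im_sub z z' : complex.Im (z - z') = complex.Im z - complex.Im z'.
Proof. by case: z z' => [a b] [a' b']. Qed.

Lemma Re_le_norm z : (`|complex.Re z|)%:C%C <= `|z|.
Proof. exact: normc_ge_Re. Qed.

Lemma Im_le_norm z : (`|complex.Im z|)%:C%C <= `|z|.
Proof.
rewrite normc_def lecR -sqrtr_sqr ler_wsqrtr// lerDr sqr_ge0//.
Qed.

Lemma norm_le_parts z : `|z| <= (`|complex.Re z| + `|complex.Im z|)%:C%C.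
Proof.
rewrite normc_def lecR -[X in _ <= X]ger0_norm ?addr_ge0// -sqrtr_sqr ler_wsqrtr//.
rewrite -(real_normK (num_real (complex.Re z))) -(real_normK (num_real (complex.Im z))).
have := normr_ge0 (complex.Re z); have := normr_ge0 (complex.Im z); nra.
Qed.

Lemma cvg_complex (T : Type) (F : set_system T) (g : T -> C) z : Filter F ->
  complex.Re (g x) @[x --> F] --> complex.Re z ->
  complex.Im (g x) @[x --> F] --> complex.Im z ->
  (g x : C^o) @[x --> F] --> (z : C^o).
Proof.
move=> FF /cvgrPdist_lt gr /cvgrPdist_lt gi; apply/cvgrPdist_lt => e.
rewrite ltcE /= => /andP[/eqP ei e0].
have e2 : 0 < complex.Re e / 2 by rewrite divr_gt0.
have eE : e = (complex.Re e)%:C%C by apply: complex_eq => //=.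
near=> x; rewrite eE (le_lt_trans (norm_le_parts _))// ltcR Re_sub Im_sub.
have h1 : `|complex.Re z - complex.Re (g x)| < complex.Re e / 2 by near: x; exact: gr.
have h2 : `|complex.Im z - complex.Im (g x)| < complex.Re e / 2 by near: x; exact: gi.
lra.
Unshelve. all: by end_near. Qed.

Lemma cvg_Re (T : Type) (F : set_system T) (g : T -> C) z : Filter F ->
  (g x : C^o) @[x --> F] --> (z : C^o) -> complex.Re (g x) @[x --> F] --> complex.Re z.
Proof.
move=> FF /cvgrPdist_lt gz; apply/cvgrPdist_lt => e e0.
have e0' : 0 < e%:C%C :> C by rewrite ltcR.
near=> x; rewrite -Re_sub -ltcR (le_lt_trans (Re_le_norm _))//.
by near: x; exact: gz.
Unshelve. all: by end_near. Qed.

Lemma cvg_Im (T : Type) (F : set_system T) (g : T -> C) z : Filter F ->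
  (g x : C^o) @[x --> F] --> (z : C^o) -> complex.Im (g x) @[x --> F] --> complex.Im z.
Proof.
move=> FF /cvgrPdist_lt gz; apply/cvgrPdist_lt => e e0.
have e0' : 0 < e%:C%C :> C by rewrite ltcR.
near=> x; rewrite -Im_sub -ltcR (le_lt_trans (Im_le_norm _))//.
by near: x; exact: gz.
Unshelve. all: by end_near. Qed.

Lemma cintegralP d (X : measurableType d) (nu : {measure set X -> \bar R}) (D : set X)
    (g : X -> C) a b :
  has_integral nu D (fun x => complex.Re (g x)) a ->
  has_integral nu D (fun x => complex.Im (g x)) b ->
  cintegrable nu D g /\ cintegral nu D g = (a +i* b)%C.
Proof.
move=> ha hb; split; first by split; [case: ha|case: hb].
by rewrite /cintegral (has_integral_Rintegral ha) (has_integral_Rintegral hb).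
Qed.

Lemma cexp_real a : cexp a%:C%C = (expR a)%:C%C.
Proof. by rewrite /cexp /= cos0 sin0; apply: complex_eq => /=; ring. Qed.

Lemma padic_charE (p : nat) (pP : prime p) (y : padic R pP) :
  padic_char y = (cos (char_arg y) +i* sin (char_arg y))%C.
Proof. by rewrite /padic_char /cexp /= expR0 -/(char_arg y); apply: complex_eq => /=; ring. Qed.

(** A two-sided derivative restricts to the difference quotients taken in D. *)
Lemma derive_within (D : set R) (g : R -> C) (u v : R -> R) (t a b : R) :
  (forall s, D s -> g s = (u s +i* v s)%C) -> D t ->
  is_derive t 1 u a -> is_derive t 1 v b ->
  has_derivative_within D g t (a +i* b)%C.
Proof.
move=> gE Dt.
have H (w : R -> R) c : is_derive t 1 w c ->
    (s - t)^-1 * (w s - w t) @[s --> t^'] --> c.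
  move=> [dw <-]; have := dw; rewrite /derivable /derive => cw.
  have sub : (s - t) @[s --> t^'] --> (0 : R)^'.
    move=> A /nbhs_ballP[e /= e0 He]; apply/nbhs_ballP; exists e => // s /=.
    rewrite /ball/= distrC => st st0; apply: He; rewrite /ball/= ?sub0r ?normrN//.
    by rewrite subr_eq0.
  have := cvg_comp _ _ sub cw.
  apply: cvg_trans; apply: near_eq_cvg; near=> s => /=.
  by rewrite /GRing.scale/= mulr1 subrK.
move=> /H du /H dv; rewrite /has_derivative_within.
have hw (w : R -> R) (c : R) : (s - t)^-1 * (w s - w t) @[s --> t^'] --> c ->
    (s - t)^-1 * (w s - w t) @[s --> within D t^'] --> c.
  by apply: cvg_trans; apply: cvg_app; exact: cvg_within.
have gt s : D s -> (s - t)^-1%:C%C * (g s - g t) =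
    ((s - t)^-1 * (u s - u t) +i* ((s - t)^-1 * (v s - v t)))%C.
  by move=> Ds; rewrite !gE//; apply: complex_eq; rewrite ?Re_mulC ?Im_mulC.
apply: cvg_complex => /=.
  apply: cvg_trans (hw _ _ du); apply: near_eq_cvg; near=> s.
  by rewrite gt//; near: s; exact: withinT.
apply: cvg_trans (hw _ _ dv); apply: near_eq_cvg; near=> s.
by rewrite gt//; near: s; exact: withinT.
Unshelve. all: by end_near. Qed.

End complex_parts.

(** * Powers of p and the weight *)

Section weight.
Variables (R : realType) (p : nat) (pP : prime p) (n : nat).
Local Notation V := 'rV[padic R pP]_n.
Local Notation pR := (p%:R : R).
Local Notation norm := (@padicn_norm R p pP n).
Local Notation vol1 := (pR ^+ n).

Lemma powR_lt (a b : R) : a < b -> pR `^ a < pR `^ b.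
Proof.
move=> ab; rewrite /powR gt_eqF ?p_gt0// ltr_expR ltr_pM2r//.
by rewrite ln_gt0// p_gt1.
Qed.

Lemma powR_expz (k : int) (a : R) : (pR ^ k) `^ a = (pR `^ a) ^ k.
Proof.
have p0 := ltW (p_gt0 R pP).
have E1 : pR ^ k = pR `^ k%:~R by exact: esym (powR_intmul k p0).
have E2 : (pR `^ a) ^ k = (pR `^ a) `^ k%:~R by exact: esym (powR_intmul k (powR_ge0 _ _)).
by rewrite E1 E2 -powRrM -powRrM [a * _]mulrC.
Qed.

Section bounds.
Variables (alpha lambda : R) (w : V -> R).
Hypothesis n_gt0 : (0 < n)%N.
Hypothesis n_lt_alpha : n%:R < alpha.
Hypothesis lambda_ge0 : 0 <= lambda.
Hypothesis lambda_lt : lambda < alpha - n%:R.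
Hypothesis hw : is_weight alpha w.

Definition weightk (k : int) : R := w (pvec R pP n k).
Definition ratio : R := vol1 / pR `^ alpha.
Definition growth : R := pR `^ lambda.

Lemma weightE y m : norm y = pR ^ m -> w y = weightk m.
Proof. by move=> ym; case: hw => _ hr _ _ _; apply: hr; rewrite pvec_norm. Qed.

Lemma weightk_gt0 m : 0 < weightk m.
Proof.
case: hw => _ _ w0 w00 _; rewrite lt_def w0 andbT; apply/eqP => /w00 /eqP.
by rewrite -padicn_norm_eq0 pvec_norm// gt_eqF// ppow_gt0.
Qed.

Lemma alpha_pow_gt0 : 0 < pR `^ alpha. Proof. by rewrite powR_gt0// p_gt0. Qed.

Lemma ratio01 : 0 < ratio < 1.
Proof.
rewrite /ratio divr_gt0 ?vol1_gt0 ?alpha_pow_gt0//= ltr_pdivrMr ?alpha_pow_gt0// mul1r.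
by rewrite -powR_mulrn ?ler0n// powR_lt.
Qed.

Lemma growth_ge1 : 1 <= growth.
Proof. by rewrite /growth -[X in X <= _](powRr0 pR) ler_powR// ltW// p_gt1. Qed.

(** The product is p ^ (lambda + n - alpha). *)
Lemma growth_ratio : growth * ratio < 1.
Proof.
rewrite /growth /ratio mulrA ltr_pdivrMr ?alpha_pow_gt0// mul1r -powR_mulrn ?ler0n//.
rewrite -powRD; last by rewrite p_neq0// implybT.
by rewrite powR_lt// -ltrBrDr.
Qed.

Lemma sphere_mass_bounds : exists cb Cb, 0 < cb /\
  forall k, cb * ratio ^ k <= sphere_mass p n weightk k <= Cb * ratio ^ k.
Proof.
case: hw => _ _ _ _ [C0 [C1 [C00 C10 HC]]]; exists C1^-1, C0^-1; split; first by rewrite invr_gt0.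
move=> k; have := HC (pvec R pP n k); rewrite pvec_norm// powR_expz -/(weightk k).
have ak : 0 < (pR `^ alpha) ^ k by rewrite exprz_gt0// alpha_pow_gt0.
have vk : 0 < vol1 ^ k by rewrite exprz_gt0// vol1_gt0.
have wk := weightk_gt0 k.
have -> : ratio ^ k = vol1 ^ k / (pR `^ alpha) ^ k.
  by rewrite /ratio expfzMl exprz_inv invr_expz.
rewrite /sphere_mass => /andP[h0 h1]; apply/andP; split.
  rewrite mulrCA ler_pM2l// -invfM lef_pV2 ?posrE ?mulr_gt0//.
rewrite mulrCA ler_pM2l// -invfM lef_pV2 ?posrE ?mulr_gt0//.
Qed.

(** Comparable with 1 + |x| ^ lambda, but constant on the ball of radius p ^ l
    around 0: thus it grows at most by the factor p ^ lambda from a ball of radius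
    p ^ (l + i) to the next one, already from i = 0 on. *)
Definition envelope (l : int) (x : V) : R := 1 + Num.max (norm x) (pR ^ l) `^ lambda.

Lemma envelope_ge0 l x : 0 <= envelope l x.
Proof. by rewrite addr_ge0// powR_ge0. Qed.

Lemma envelope_ball l x i z : norm (z - x) <= pR ^ (l + Posz i) ->
  envelope l z <= envelope l x * growth ^+ i.
Proof.
move=> zx; rewrite /envelope mulrDl mul1r lerD//.
  by rewrite exprn_ege1// growth_ge1.
have p0 := ltW (p_gt0 R pP).
have m0 : 0 <= Num.max (norm x) (pR ^ l) by rewrite le_max padicn_norm_ge0.
have pi1 : 1 <= pR ^+ i by rewrite exprn_ege1// ltW// p_gt1.
have le_m : Num.max (norm z) (pR ^ l) <= Num.max (norm x) (pR ^ l) * pR ^+ i.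
  have lx : pR ^ l <= Num.max (norm x) (pR ^ l) by rewrite le_max lexx orbT.
  have xm : norm x <= Num.max (norm x) (pR ^ l) by rewrite le_max lexx.
  have mi : Num.max (norm x) (pR ^ l) <= Num.max (norm x) (pR ^ l) * pR ^+ i by rewrite ler_peMr.
  rewrite ge_max (le_trans lx mi) andbT -(subrK x z); apply: padicn_normD_le.
    by rewrite (le_trans zx)// ppowD// ler_wpM2r// exprn_ge0.
  exact: le_trans xm mi.
have -> : growth ^+ i = (pR ^+ i) `^ lambda.
  by rewrite (exprnP pR) powR_expz -exprnP.
rewrite -powRM// ?exprn_ge0//; apply: ge0_ler_powR => //; rewrite nnegrE.
  by rewrite le_max padicn_norm_ge0.
by rewrite mulr_ge0// exprn_ge0.
Qed.

Lemma le_envelope l x : 1 + norm x `^ lambda <= envelope l x.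
Proof.
rewrite lerD2l; apply: ge0_ler_powR => //; rewrite ?nnegrE ?padicn_norm_ge0//.
  by rewrite le_max padicn_norm_ge0.
by rewrite le_max lexx.
Qed.

Lemma envelope_le l x : envelope l x <= (1 + (pR ^ l) `^ lambda) * (1 + norm x `^ lambda).
Proof.
have a0 := powR_ge0 (norm x) lambda; have b0 := powR_ge0 (pR ^ l) lambda.
have : Num.max (norm x) (pR ^ l) `^ lambda <= norm x `^ lambda + (pR ^ l) `^ lambda.
  by case: (leP (norm x) (pR ^ l)) => _; rewrite ?lerDl ?lerDr.
by rewrite /envelope; nra.
Qed.

End bounds.
End weight.

(** * The Cauchy problem *)

Section cauchy_problem.
Variables (R : realType) (p : nat) (pP : prime p) (n : nat).
Local Notation C := R[i].
Local Notation V := 'rV[padic R pP]_n.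
Local Notation pR := (p%:R : R).
Local Notation norm := (@padicn_norm R p pP n).
Local Notation B := (padicn_borel R pP n).
Variable mu : {measure set B -> \bar R}.
Local Notation hasint := (@has_integral _ B R mu setT).
Variables (alpha kappa lambda cb Cb : R) (w : V -> R).
Hypothesis haar : is_haar mu.
Hypothesis n_gt0 : (0 < n)%N.
Hypothesis n_lt_alpha : n%:R < alpha.
Hypothesis kappa_gt0 : 0 < kappa.
Hypothesis lambda_ge0 : 0 <= lambda.
Hypothesis lambda_lt : lambda < alpha - n%:R.
Hypothesis hw : is_weight alpha w.
Local Notation s := (ratio p n alpha).
Local Notation r := (growth p lambda).
Local Notation wk := (weightk w).
Local Notation sym := (symbol p n wk).
Hypothesis cb_gt0 : 0 < cb.
Hypothesis mass_ge : forall k, cb * s ^ k <= sphere_mass p n wk k.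
Hypothesis mass_le : forall k, sphere_mass p n wk k <= Cb * s ^ k.

Let s01 : 0 < s < 1. Proof. exact: ratio01. Qed.
Let s_gt0 : 0 < s. Proof. by case/andP: s01. Qed.
Let wk_gt0 m : 0 < wk m. Proof. exact: (weightk_gt0 n_gt0 hw). Qed.
Let wE y m : norm y = pR ^ m -> w y = wk m. Proof. exact: (weightE n_gt0 hw). Qed.
Let ca_gt0 : 0 < cb * s. Proof. exact: mulr_gt0. Qed.
Let sym_ge k : cb * s * s ^ k <= sym k.
Proof.
have := symbol_ge pP wk_gt0 s01 mass_ge mass_le k.
by rewrite expfzDr ?gt_eqF// expr1z mulrA mulrAC.
Qed.
Let sym_le k : sym k <= Ca Cb s * s ^ k.
Proof. exact: (symbol_le pP wk_gt0 s01 cb_gt0 mass_ge mass_le k). Qed.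
Let rs1 : r * s < 1. Proof. exact: growth_ratio. Qed.
Let r1 : 1 <= r. Proof. exact: growth_ge1. Qed.

Lemma W_symbolE (xi : V) k : norm xi = pR ^ (- k) -> W_symbol mu w xi = (sym k)%:C%C.
Proof.
move=> xik; have [H1 H2] := symbol_integral haar wE wk_gt0 s01 mass_le xik.
rewrite /W_symbol.
rewrite -[(sym k)%:C%C]/(sym k +i* 0)%C; apply: (proj2 (cintegralP _ _)).
- by apply: eq_has_integral H1 => // y _; rewrite Re_divC padic_charE Re_sub.
- by apply: eq_has_integral H2 => // y _; rewrite Im_divC padic_charE Im_sub.
Qed.

Lemma W_symbol0 : W_symbol mu w 0 = 0.
Proof.
have d0 (y : V) : padicn_dot y 0 = 0.
  by rewrite /padicn_dot big1// => i _; rewrite mxE mulr0.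
have c0 (y : V) : padic_char (- padicn_dot y 0) = 1.
  rewrite d0 oppr0 padic_charE char_arg0 ?cos0 ?sin0//.
  by rewrite padic_abs0 ler01.
rewrite /W_symbol.
rewrite -[RHS]/(0 +i* 0)%C; apply: (proj2 (cintegralP _ _)).
- by apply: eq_has_integral (has_integral0 mu _) => // y _; rewrite c0 subrr mul0r.
- by apply: eq_has_integral (has_integral0 mu _) => // y _; rewrite c0 subrr mul0r.
Qed.

Lemma heat_kernelE (l : int) (x : V) (t : R) : 0 < t ->
  heat_kernel mu w kappa x t = (kernel sym (kappa * t) l x)%:C%C.
Proof.
move=> t0; pose A (xi : V) : R := complex.Re (W_symbol mu w xi).
have AE (xi : V) k : norm xi = pR ^ (- k) -> A xi = sym k.
  by move=> /W_symbolE; rewrite /A => ->.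
have A0 : A 0 = 0 by rewrite /A W_symbol0.
have WA (xi : V) : W_symbol mu w xi = (A xi)%:C%C.
  have [->|/padicn_norm_exp[m xm]] := eqVneq xi 0; first by rewrite A0 W_symbol0.
  have xm' : norm xi = pR ^ (- (- m)) by rewrite opprK.
  by rewrite (W_symbolE xm') (AE _ _ xm').
have tau0 : 0 < kappa * t by rewrite mulr_gt0.
have [H1 H2] := kernel_fourier haar n_gt0 s01 ca_gt0 sym_ge sym_le tau0 A0 AE l x.
have E (xi : V) : cexp (- (kappa * t)%:C%C * W_symbol mu w xi) * padic_char (padicn_dot x xi) =
    (expR (- (kappa * t * A xi)))%:C%C * (cos (char_arg (padicn_dot x xi)) +i* sin (char_arg (padicn_dot x xi)))%C.
  by rewrite WA padic_charE -cexp_real -mulNr !rmorphM rmorphN rmorphM.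
rewrite /heat_kernel.
rewrite -[RHS]/(kernel sym (kappa * t) l x +i* 0)%C; apply: (proj2 (cintegralP _ _)).
- by apply: eq_has_integral H1 => // y _; rewrite E Re_mulC.
- by apply: eq_has_integral H2 => // y _; rewrite E Im_mulC.
Qed.

Definition moderate (l : int) (M : R) (g : V -> R) :=
  lc l g /\ forall z, `|g z| <= M * envelope lambda l z.

Lemma moderate_ball l M g x i z : 0 <= M -> moderate l M g ->
  norm (z - x) <= pR ^ (l + Posz i) -> `|g z| <= M * envelope lambda l x * r ^+ i.
Proof.
move=> M0 [_ gM] zx; rewrite (le_trans (gM z))// -mulrA ler_wpM2l//.
exact: (envelope_ball lambda_ge0 zx).
Qed.

Lemma heat_convE (l : int) (M t : R) (g : V -> C) x S1 S2 : 0 < t -> 0 <= M ->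
  moderate l M (fun z => complex.Re (g z)) -> moderate l M (fun z => complex.Im (g z)) ->
  \sum_(i < N) (expR (- (kappa * t * sym (l + Posz i))) - 1) *
    avgdiff l i (fun z => complex.Re (g z)) x @[N --> \oo] --> (S1 : R) ->
  \sum_(i < N) (expR (- (kappa * t * sym (l + Posz i))) - 1) *
    avgdiff l i (fun z => complex.Im (g z)) x @[N --> \oo] --> (S2 : R) ->
  cintegrable mu setT (fun y : V => heat_kernel mu w kappa (x - y) t * g y) /\
  heat_conv mu w kappa t g x = ((complex.Re (g x) + S1) +i* (complex.Im (g x) + S2))%C.
Proof.
move=> t0 M0 g1 g2 c1 c2; have tau0 : 0 < kappa * t by rewrite mulr_gt0.
have K0 : 0 <= M * envelope lambda l x by rewrite mulr_ge0// envelope_ge0.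
have H g' S' (mg : moderate l M g') := @kernel_conv R p pP n mu haar n_gt0 sym _ _ _ _ s01 ca_gt0
  sym_ge sym_le tau0 l g' x (M * envelope lambda l x) r S' mg.1 K0 r1 rs1
  (fun i z => moderate_ball M0 mg).
rewrite /heat_conv; apply: cintegralP.
  apply: eq_has_integral (H _ _ g1 c1) => // y _.
  by rewrite (heat_kernelE l (x - y) t0) Re_mulC.
apply: eq_has_integral (H _ _ g2 c2) => // y _.
by rewrite (heat_kernelE l (x - y) t0) Im_mulC.
Qed.

Lemma W_opE (l : int) (M : R) (g : V -> C) x S1 S2 : 0 <= M ->
  moderate l M (fun z => complex.Re (g z)) -> moderate l M (fun z => complex.Im (g z)) ->
  \sum_(i < N) sym (l + Posz i) * avgdiff l i (fun z => complex.Re (g z)) x @[N --> \oo] --> (S1 : R) ->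
  \sum_(i < N) sym (l + Posz i) * avgdiff l i (fun z => complex.Im (g z)) x @[N --> \oo] --> (S2 : R) ->
  cintegrable mu setT (W_integrand w g x) /\ W_op mu w g x = ((- S1) +i* (- S2))%C.
Proof.
move=> M0 g1 g2 c1 c2.
have K0 : 0 <= M * envelope lambda l x by rewrite mulr_ge0// envelope_ge0.
have H g' S' (mg : moderate l M g') := @operator_integral R p pP n mu haar w wk _ _ _ wE wk_gt0 s01
  cb_gt0 mass_ge mass_le l g' x (M * envelope lambda l x) r S' mg.1 K0 r1 rs1
  (fun i z => moderate_ball M0 mg).
rewrite /W_op; apply: cintegralP.
  by apply: eq_has_integral (H _ _ g1 c1) => // y _; rewrite /W_integrand Re_divC Re_sub.
by apply: eq_has_integral (H _ _ g2 c2) => // y _; rewrite /W_integrand Im_divC Im_sub.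
Qed.

Section components.
Variables (l : int) (M T : R).
Hypothesis M_ge0 : 0 <= M.
Hypothesis T_gt0 : 0 < T.
Local Notation rate := (fun i : nat => sym (l + Posz i)).

Section real_component.
Variables (phi : V -> R) (f : V -> R -> R).
Hypothesis phi_mod : moderate l M phi.
Hypothesis f_mod : forall t, moderate l M (f ^~ t).
Hypothesis f_cont : forall x, continuous (f x).
Local Notation u := (sol l rate kappa T phi f).
Local Notation diss := (dissipation l rate kappa T phi f).

Let rate_ge0 i : 0 <= rate i.
Proof. by rewrite ltW// (symbol_gt0 pP wk_gt0 s01 cb_gt0 mass_ge mass_le). Qed.

Let rate_le i : rate i <= Ca Cb s * s ^ l * s ^+ i.
Proof. by rewrite (le_trans (sym_le _))// expfzDr ?gt_eqF// mulrA. Qed.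

Let env_ball (x : V) (i : nat) (z : V) : norm (z - x) <= pR ^ (l + Posz i) ->
  envelope lambda l z <= envelope lambda l x * r ^+ i.
Proof. exact: envelope_ball. Qed.

Let f_le z t : `|f z t| <= M * envelope lambda l z. Proof. exact: (f_mod t).2. Qed.

Lemma component_is_derive x (t : R) : is_derive t 1 (u x) (f x t - diss x t).
Proof.
exact: (sol_is_derive rate_ge0 rate_le (ltW s_gt0) r1 rs1 kappa_gt0 T_gt0 M_ge0
  (envelope_ge0 lambda l) env_ball phi_mod.2 f_le f_cont).
Qed.

Lemma component_continuous x : continuous (u x).
Proof.
exact: (sol_continuous rate_ge0 rate_le (ltW s_gt0) r1 rs1 kappa_gt0 T_gt0 M_ge0
  (envelope_ge0 lambda l) env_ball phi_mod.2 f_le f_cont).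
Qed.

Lemma component_velocity_continuous x : continuous (fun t => f x t - diss x t).
Proof.
move=> t; apply: cvgB; first exact: f_cont.
exact: (dissipation_continuous rate_ge0 rate_le (ltW s_gt0) r1 rs1 kappa_gt0 T_gt0 M_ge0
  (envelope_ge0 lambda l) env_ball phi_mod.2 f_le f_cont).
Qed.

Lemma component_moderate : exists2 M', 0 <= M' &
  forall t, 0 <= t <= T -> moderate l M' (u ^~ t).
Proof.
pose M' := M + M * T + kappa * (Ca Cb s * s ^ l) * (2 * M * r * (1 + T)) / (1 - r * s) * T.
have bnd t : 0 <= t <= T -> forall x, `|u x t| <= M' * envelope lambda l x.
  move=> tT x; exact: (sol_bound rate_ge0 rate_le (ltW s_gt0) r1 rs1 kappa_gt0 T_gt0 M_ge0
    (envelope_ge0 lambda l) env_ball phi_mod.2 f_le f_cont).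
have e1 (x : V) : 0 < envelope lambda l x.
  by rewrite (lt_le_trans _ (le_envelope lambda_ge0 l x))// ltr_wpDr// powR_ge0.
exists M'.
  have h : 0 <= (0 : R) <= T by rewrite lexx ltW.
  have := le_trans (normr_ge0 _) (bnd 0 h 0).
  by rewrite pmulr_lge0.
move=> t tT; split; last exact: bnd.
by apply: sol_lc; [exact: phi_mod.1|move=> v; exact: (f_mod v).1].
Qed.

Lemma component_operator x (t : R) : 0 <= t <= T ->
  \sum_(i < N) sym (l + Posz i) * avgdiff l i (u ^~ t) x @[N --> \oo] --> kappa^-1 * diss x t.
Proof.
exact: (sol_operator haar rate_ge0 rate_le (ltW s_gt0) r1 rs1 kappa_gt0 T_gt0 M_ge0
  (envelope_ge0 lambda l) env_ball phi_mod.1 phi_mod.2 (fun t => (f_mod t).1) f_le f_cont).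
Qed.

Lemma component_duhamel x (t : R) : 0 <= t <= T -> exists (S0 : R) (h : R -> R) (v : R),
  [/\ \sum_(i < N) (expR (- (kappa * t * sym (l + Posz i))) - 1) * avgdiff l i phi x @[N --> \oo] --> S0,
   forall u : R, 0 <= u <= t -> \sum_(i < N) (expR (- (kappa * (t - u) * sym (l + Posz i))) - 1) *
      avgdiff l i (f ^~ u) x @[N --> \oo] --> h u,
   has_integral (@lebesgue_measure R) `[0, t] (fun u => f x u + h u) v & phi x + S0 + v = u x t].
Proof.
exact: (sol_duhamel rate_ge0 rate_le (ltW s_gt0) r1 rs1 kappa_gt0 T_gt0 M_ge0
  (envelope_ge0 lambda l) env_ball phi_mod.2 f_le f_cont).
Qed.

End real_component.

Variables (phi : V -> C) (f : V -> R -> C).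
Hypothesis phi_Re : moderate l M (fun z => complex.Re (phi z)).
Hypothesis phi_Im : moderate l M (fun z => complex.Im (phi z)).
Hypothesis f_Re : forall t, 0 <= t <= T -> moderate l M (fun z => complex.Re (f z t)).
Hypothesis f_Im : forall t, 0 <= t <= T -> moderate l M (fun z => complex.Im (f z t)).
Hypothesis f_cont : continuous_xt T f.

Let phi1 (z : V) := complex.Re (phi z).
Let phi2 (z : V) := complex.Im (phi z).
Let f1 (z : V) (t : R) := complex.Re (f z (clampT T t)).
Let f2 (z : V) (t : R) := complex.Im (f z (clampT T t)).
Let u1 := sol l rate kappa T phi1 f1.
Let u2 := sol l rate kappa T phi2 f2.
Let d1 := dissipation l rate kappa T phi1 f1.
Let d2 := dissipation l rate kappa T phi2 f2.

Let f1_mod t : moderate l M (f1 ^~ t). Proof. exact/f_Re/clampT_itv. Qed.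
Let f2_mod t : moderate l M (f2 ^~ t). Proof. exact/f_Im/clampT_itv. Qed.

(** The clamped time never leaves [0, T], where f is continuous. *)
Lemma clamped_cvg (x : V) (t : R) :
  (f x (clampT T v) : C^o) @[v --> t] --> (f x (clampT T t) : C^o).
Proof.
have At : ([set: V] `*` `[0, T]) (x, clampT T t) by split => //=; rewrite in_itv/= clampT_itv.
have H : (fun z : V * R => f z.1 z.2 : C^o) @ within ([set: V] `*` `[0, T]) (nbhs (x, clampT T t)) -->
    (f x (clampT T t) : C^o).
  by move/subspace_continuousP : f_cont => /(_ _ At).
have G : (x, clampT T v) @[v --> t] --> within ([set: V] `*` `[0, T]) (nbhs (x, clampT T t)).
  have c2 : (x, clampT T v) @[v --> t] --> (x, clampT T t).
    have c1 : clampT T v @[v --> t] --> clampT T t by exact: clampT_continuous.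
    have cx : x @[v --> t] --> x by exact: cvg_cst.
    exact: (cvg_pair cx c1).
  move=> P HP; have := c2 _ HP; rewrite /= !nbhs_filterE /=; apply: filterS => v /=; apply.
  by split => //=; rewrite in_itv/= clampT_itv.
exact: (cvg_comp _ _ G H).
Qed.

Let f1_cont x : continuous (f1 x).
Proof. by move=> t; apply: (cvg_Re (g := fun v => f x (clampT T v))); exact: clamped_cvg. Qed.
Let f2_cont x : continuous (f2 x).
Proof. by move=> t; apply: (cvg_Im (g := fun v => f x (clampT T v))); exact: clamped_cvg. Qed.

Lemma heat_u_solution x t : 0 < t <= T ->
  heat_u_defined mu w kappa phi f x t /\ heat_u mu w kappa phi f x t = (u1 x t +i* u2 x t)%C.
Proof.
move=> /andP[t0 tT]; have t0T : 0 <= t <= T by rewrite (ltW t0).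
have [S1 [h1 [v1 [cS1 ch1 I1 E1]]]] := component_duhamel phi_Re f1_mod f1_cont x t0T.
have [S2 [h2 [v2 [cS2 ch2 I2 E2]]]] := component_duhamel phi_Im f2_mod f2_cont x t0T.
have [c0 e0] := heat_convE t0 M_ge0 phi_Re phi_Im cS1 cS2.
have K th : 0 <= th < t ->
    cintegrable mu setT (fun y : V => heat_kernel mu w kappa (x - y) (t - th) * f y th) /\
    heat_conv mu w kappa (t - th) (f ^~ th) x =
      ((f1 x th + h1 th) +i* (f2 x th + h2 th))%C.
  move=> /andP[th0 tht]; have thT : 0 <= th <= T by rewrite th0 (le_trans (ltW tht)).
  have tht' : 0 <= th <= t by rewrite th0 ltW.
  have dt : 0 < t - th by rewrite subr_gt0.
  have := ch1 _ tht'; have := ch2 _ tht'; rewrite /f1 /f2 (clampT_id thT) => k2 k1.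
  exact: (heat_convE dt M_ge0 (f_Re thT) (f_Im thT) k1 k2).
have J1 : has_integral (@lebesgue_measure R) `[0, t]
    (fun th => complex.Re (heat_conv mu w kappa (t - th) (f ^~ th) x)) v1.
  by apply: has_integral_but_end I1 _ => th /K[_ ->].
have J2 : has_integral (@lebesgue_measure R) `[0, t]
    (fun th => complex.Im (heat_conv mu w kappa (t - th) (f ^~ th) x)) v2.
  by apply: has_integral_but_end I2 _ => th /K[_ ->].
have [cI eI] := cintegralP J1 J2.
split; first by split => // th /K[].
rewrite /heat_u gt_eqF// eI e0; by apply: complex_eq => /=; [exact: E1|exact: E2].
Qed.

Lemma heat_u_parts x t : 0 <= t <= T -> heat_u mu w kappa phi f x t = (u1 x t +i* u2 x t)%C.
Proof.
move=> /andP[t0 tT]; have [t00|t00] := eqVneq t 0.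
  by rewrite t00 /heat_u eqxx /u1 /u2 !sol0; apply: complex_eq.
by have [] // := @heat_u_solution x t _; rewrite lt_def t00 t0.
Qed.

(** As u is constant in x on the balls of radius p ^ l for all t at once, its joint
    continuity follows from the continuity in t. *)
Lemma heat_u_is_solution : is_solution mu w kappa lambda T phi f (heat_u mu w kappa phi f).
Proof.
have [M1 M10 m1] := component_moderate phi_Re f1_mod f1_cont.
have [M2 M20 m2] := component_moderate phi_Im f2_mod f2_cont.
have m1' t : 0 <= t <= T -> moderate l (M1 + M2) (u1 ^~ t).
  move=> /m1[a b]; split => // z; rewrite (le_trans (b z))// ler_wpM2r ?envelope_ge0//.
  by rewrite lerDl.
have m2' t : 0 <= t <= T -> moderate l (M1 + M2) (u2 ^~ t).
  move=> /m2[a b]; split => // z; rewrite (le_trans (b z))// ler_wpM2r ?envelope_ge0//.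
  by rewrite lerDr.
have M120 : 0 <= M1 + M2 by rewrite addr_ge0.
have ulc t : 0 <= t <= T -> loc_const l ((heat_u mu w kappa phi f) ^~ t).
  move=> tT x x' x'l; rewrite (heat_u_parts _ tT) (heat_u_parts _ tT).
  by apply: complex_eq; [exact: (m1' _ tT).1|exact: (m2' _ tT).1].
have ugr t : 0 <= t <= T ->
    growth_le lambda ((M1 + M2) * (1 + (pR ^ l) `^ lambda)) ((heat_u mu w kappa phi f) ^~ t).
  move=> tT x; rewrite (heat_u_parts _ tT) (le_trans (norm_le_parts _))// lecR /=.
  have := (m1 _ tT).2 x; have := (m2 _ tT).2 x => b2 b1.
  rewrite (le_trans (lerD b1 b2))// -mulrDl -mulrA ler_wpM2l//.
  exact: envelope_le.
split.
- rewrite /continuous_xt; apply/subspace_continuousP => -[x t] [_ /=].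
  rewrite in_itv/= => tT.
  have near_eq : \forall z \near within ([set: V] `*` `[0, T]) (nbhs (x, t)),
      heat_u mu w kappa phi f z.1 z.2 = (u1 x z.2 +i* u2 x z.2)%C.
    have nx : \forall z \near within ([set: V] `*` `[0, T]) (nbhs (x, t)), norm (z.1 - x) <= pR ^ l.
      apply: cvg_within.
      have fx : (fun z : V * R => z.1) @ nbhs (x, t) --> x by exact: cvg_fst.
      exact: (fx _ (near_padicn_norm x l)).
    near=> z; have zT : 0 <= z.2 <= T.
      have : ([set: V] `*` `[0, T]) z by near: z; exact: withinT.
      by case=> _ /=; rewrite in_itv.
    rewrite (lc_near (ulc _ zT) (_ : norm (z.1 - x) <= _)); last by near: z.
    exact: heat_u_parts.
  have c2 : z.2 @[z --> within ([set: V] `*` `[0, T]) (nbhs (x, t))] --> t.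
    apply: cvg_within_filter; exact: cvg_snd.
  have H : ((u1 x z.2 +i* u2 x z.2)%C : C^o) @[z --> within ([set: V] `*` `[0, T]) (nbhs (x, t))]
      --> (heat_u mu w kappa phi f x t : C^o).
    rewrite (heat_u_parts x tT).
    have k1 : u1 x v @[v --> t] --> u1 x t by exact: (component_continuous phi_Re f1_mod f1_cont).
    have k2 : u2 x v @[v --> t] --> u2 x t by exact: (component_continuous phi_Im f2_mod f2_cont).
    by apply: cvg_complex => /=; [exact: (cvg_comp _ _ c2 k1)|exact: (cvg_comp _ _ c2 k2)].
  apply: cvg_trans H; apply: near_eq_cvg; apply: filterS near_eq => z zE.
  exact: esym zE.
- move=> t tT; split; first by exists l; exact: ulc.
  by eexists; exact: ugr.
- exists l, ((M1 + M2) * (1 + (pR ^ l) `^ lambda)) => t /=; rewrite in_itv/= => tT.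
  by split; [exact: ulc|exact: ugr].
- exists (fun x t => ((f1 x t - d1 x t) +i* (f2 x t - d2 x t))%C); split.
    move=> x; apply: continuous_subspaceT => t; apply: cvg_complex => /=.
      exact: (component_velocity_continuous phi_Re f1_mod f1_cont).
    exact: (component_velocity_continuous phi_Im f2_mod f2_cont).
  move=> x t tT; have tT0 : 0 <= t <= T by case/andP: tT => /ltW -> ->.
  have c1 := @component_operator phi1 f1 phi_Re f1_mod f1_cont x t tT0.
  have c2 := @component_operator phi2 f2 phi_Im f2_mod f2_cont x t tT0.
  have uR : (fun z => complex.Re (heat_u mu w kappa phi f z t)) = u1 ^~ t.
    by apply/funext => z; rewrite heat_u_parts.
  have uI : (fun z => complex.Im (heat_u mu w kappa phi f z t)) = u2 ^~ t.
    by apply/funext => z; rewrite heat_u_parts.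
  have := @W_opE l (M1 + M2) ((heat_u mu w kappa phi f) ^~ t) x
    (kappa^-1 * d1 x t) (kappa^-1 * d2 x t) M120.
  rewrite uR uI => /(_ (m1' _ tT0) (m2' _ tT0) c1 c2)[Wi We].
  have k0 : kappa != 0 by rewrite gt_eqF.
  split => //.
    apply: (@derive_within _ _ _ (u1 x) (u2 x)).
    - move=> v /=; rewrite in_itv/= => /andP[v0 vT]; apply: heat_u_parts.
      by rewrite (ltW v0).
    - by rewrite /= in_itv.
    - exact: (component_is_derive phi_Re f1_mod f1_cont).
    - exact: (component_is_derive phi_Im f2_mod f2_cont).
  rewrite We; apply: complex_eq.
    by rewrite Re_sub Re_mulC /= mulrN opprK mulVKf// subrK /f1 (clampT_id tT0).
  by rewrite Im_sub Im_mulC /= mulrN opprK mulVKf// subrK /f2 (clampT_id tT0).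
- by move=> x; rewrite /heat_u eqxx.
Unshelve. all: by end_near. Qed.

End components.

End cauchy_problem.

Theorem theorem4p1 (R : realType) (p : nat) (pP : prime p) (n : nat)
    (mu : {measure set (padicn_borel R pP n) -> \bar R})
    (alpha kappa T lambda : R)
    (w : 'rV[padic R pP]_n -> R)
    (phi : 'rV[padic R pP]_n -> R[i])
    (f : 'rV[padic R pP]_n -> R -> R[i]) :
  is_haar mu ->
  (1 <= n)%N ->
  n%:R < alpha -> 0 < kappa -> 0 < T -> 0 <= lambda -> lambda < alpha - n%:R ->
  is_weight alpha w ->
  M_space lambda phi ->
  continuous_xt T f ->
  M_space_unif lambda `[0, T] f ->
  (forall x t, 0 < t <= T -> heat_u_defined mu w kappa phi f x t) /\
  is_solution mu w kappa lambda T phi f (heat_u mu w kappa phi f).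

Proof.
move=> haar n0 na k0 T0 l0 lan hw [[l1 phil] [M1 phiM]] fc [l2 [M2 fM]].
have [cb [Cb [cb0 mass]]] := sphere_mass_bounds n0 hw.
pose l := Num.min l1 l2; pose M := `|M1| + `|M2|.
have M0 : 0 <= M by rewrite addr_ge0.
have ll1 : l <= l1 by rewrite ge_min lexx.
have ll2 : l <= l2 by rewrite ge_min lexx orbT.
have bound (g : 'rV[padic R pP]_n -> R[i]) m c : l <= m -> `|c| <= M ->
    loc_const m g -> growth_le lambda c g ->
    moderate lambda l M (fun z => complex.Re (g z)) /\
    moderate lambda l M (fun z => complex.Im (g z)).
  move=> lm cM gm gc; have gl := lc_le lm gm.
  have le (z : 'rV[padic R pP]_n) : c * (1 + padicn_norm z `^ lambda) <= M * envelope lambda l z.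
    have e0 : 0 <= 1 + padicn_norm z `^ lambda by rewrite addr_ge0// powR_ge0.
    rewrite (le_trans (ler_wpM2r e0 (le_trans (ler_norm c) cM)))// ler_wpM2l//.
    exact: le_envelope.
  split; split=> [x x' x'l|z]; try by rewrite gl.
    by rewrite (le_trans _ (le z))// -lecR (le_trans (Re_le_norm _) (gc z)).
  by rewrite (le_trans _ (le z))// -lecR (le_trans (Im_le_norm _) (gc z)).
have M1M : `|M1| <= M by rewrite lerDl.
have M2M : `|M2| <= M by rewrite lerDr.
have [phi1 phi2] := bound phi l1 M1 ll1 M1M phil phiM.
have fb t : 0 <= t <= T -> moderate lambda l M (fun z => complex.Re (f z t)) /\
    moderate lambda l M (fun z => complex.Im (f z t)).
  move=> tT; have Dt : `[0, T]%classic t by rewrite /= in_itv.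
  by have [fl fg] := fM t Dt; exact: bound ll2 M2M fl fg.
have mass_ge k := (andP (mass k)).1; have mass_le k := (andP (mass k)).2.
split.
  move=> x t tT.
  exact: (heat_u_solution haar n0 na k0 l0 lan hw cb0 mass_ge mass_le M0 T0 phi1 phi2
    (fun t tT => (fb t tT).1) (fun t tT => (fb t tT).2) fc x tT).1.
exact: (heat_u_is_solution haar n0 na k0 l0 lan hw cb0 mass_ge mass_le M0 T0 phi1 phi2
    (fun t tT => (fb t tT).1) (fun t tT => (fb t tT).2) fc).
Qed.
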